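(* Let $N\ge 10$ be an integer (equivalently, the rank $n=\lfloor N/2\rfloor$ of $\mathrm{SO}(N)$ satisfies $n>4$), and let $d=N(N-1)/2$. Let $\mathcal{N}(\lambda)$ be the eigenvalue counting function of $-\Delta$ on $M=\mathrm{SO}(N)$ and let $$C_d=\frac{2\,\mathrm{Vol}(M)}{d\,(4\pi)^{d/2}\,\Gamma(d/2)}.$$ Then $\mathcal{N}(\lambda)-C_d\lambda^{d/2}$ is not $o\big(\lambda^{d/2-1}\big)$ as $\lambda\to\infty$.
   Context: $\mathrm{SO}(N)$ is the compact Lie group of real orthogonal $N\times N$ matrices of determinant $1$. It carries the bi-invariant Riemannian metric which at the identity is $\langle X,Y\rangle=\tfrac12\mathrm{tr}(X^{T}Y)$ for $X,Y\in\mathfrak{so}(N)$ (with this normalization the eigenvalues of $-\Delta$ are $k^2$, $k\in\mathbb{Z}$, on $\mathrm{SO}(2)$ and $l(l+1)$, $l\in\mathbb{Z}_{\ge0}$, with multiplicity $(2l+1)^2$, on $\mathrm{SO}(3)$). $\mathrm{Vol}(M)$ is the total Riemannian volume of $M$. $-\Delta$ is the Laplace-Beltrami operator acting on functions, with sign chosen so that its eigenvalues are nonnegative. $\mathcal{N}(\lambda)$ is the number of eigenvalues of $-\Delta$ less than or equal to $\lambda$, counted with multiplicity. *)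

(* Defs.v *)
From HB Require Import structures.
From mathcomp Require Import all_boot all_order all_algebra.
From mathcomp Require Import all_classical all_reals all_analysis.
Import Order.TTheory GRing.Theory Num.Theory.
Import numFieldNormedType.Exports.

Set Implicit Arguments.
Unset Strict Implicit.
Unset Printing Implicit Defensive.

Local Open Scope classical_set_scope.
Local Open Scope ring_scope.

(** * Calculus on R^d, with R^d = 'rV[R]_d *)

Section EuclideanSpace.
Context {R : realType}.

Definition partial (d : nat) (W : normedModType R) (i : 'I_d)
    (h : 'rV[R]_d -> W) (x : 'rV[R]_d) : W :=
  'D_(delta_mx 0 i) h x.

Fixpoint Ck (d : nat) (W : normedModType R) (k : nat) (U : set 'rV[R]_d)
    (h : 'rV[R]_d -> W) : Prop :=
  (forall x, U x -> {for x, continuous h}) /\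
  match k with
  | 0 => True
  | k'.+1 => forall i : 'I_d,
      (forall x, U x -> derivable h x (delta_mx 0 i)) /\ Ck k' U (partial i h)
  end.

(* Only meaningful for open U. *)
Definition smooth_on (d : nat) (W : normedModType R) (U : set 'rV[R]_d)
    (h : 'rV[R]_d -> W) : Prop :=
  forall k, Ck k U h.

(* The integral over R^d as an iterated Lebesgue integral; by Tonelli this is
   the d-dimensional Lebesgue integral for the nonnegative, continuous,
   compactly supported functions it is applied to below. *)
Fixpoint integral_Rn (d : nat) : ('rV[R]_d -> \bar R) -> \bar R :=
  match d with
  | 0 => fun h => h 0
  | d'.+1 => fun h =>
      (\int[lebesgue_measure]_(t in [set: R])
         integral_Rn (fun y : 'rV[R]_d' => h (row_mx (t%:M : 'rV[R]_1) y)))%E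
  end.

(* Euler's integral, for s > 0. *)
Definition Gamma (s : R) : R :=
  \int[lebesgue_measure]_(t in `]0, +oo[%classic) (t `^ (s - 1) * expR (- t)).

End EuclideanSpace.

(** * The Riemannian manifold SO(N) *)

Definition dimSO (N : nat) : nat := (N * N.-1) %/ 2.

Section SpecialOrthogonal.
Context {R : realType} (N : nat).
Notation d := (dimSO N).

Definition SO : set 'M[R]_N := [set g | g^T *m g = 1%:M /\ \det g = 1].

(* The inner product of the vectors V, W tangent to SO(N) at g: they are
   left-translated to the identity, where <X, Y> = tr(X^T Y) / 2. *)
Definition metric (g V W : 'M[R]_N) : R :=
  2^-1 * \tr ((invmx g *m V)^T *m (invmx g *m W)).

(* The matrix (g_ij) of the metric in the coordinates given by phi. *)
Definition gram (phi : 'rV[R]_d -> 'M[R]_N) (x : 'rV[R]_d) : 'M[R]_d :=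
  \matrix_(i, j) metric (phi x) (partial i phi x) (partial j phi x).

Definition volume_density (phi : 'rV[R]_d -> 'M[R]_N) (x : 'rV[R]_d) : R :=
  Num.sqrt (\det (gram phi x)).

(* phi is the inverse of a chart of SO(N): a smooth immersion of the open set
   U which is a homeomorphism onto an open subset of SO(N). *)
Definition local_parametrization (U : set 'rV[R]_d)
    (phi : 'rV[R]_d -> 'M[R]_N) : Prop :=
  [/\ open U,
      smooth_on U phi,
      forall x, U x -> SO (phi x),
      forall x, U x -> forall c : 'I_d -> R,
        \sum_i c i *: partial i phi x = 0 -> forall i, c i = 0 &
      {in U &, injective phi} /\
      forall V, open V -> V `<=` U ->
        exists2 W : set 'M[R]_N, open W & phi @` V = W `&` SO].

(* Functions on SO(N) are represented by functions on all matrices, whose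
   values outside SO(N) are irrelevant. *)
Definition smooth_on_SO (f : 'M[R]_N -> R) : Prop :=
  forall U phi, local_parametrization U phi -> smooth_on U (f \o phi).

(* Delta f = |g|^(-1/2) sum_i d_i (|g|^(1/2) sum_j g^ij d_j f)
   in the coordinates given by phi. *)
Definition laplace_beltrami (phi : 'rV[R]_d -> 'M[R]_N) (f : 'M[R]_N -> R)
    (x : 'rV[R]_d) : R :=
  (volume_density phi x)^-1 *
  \sum_i partial i (fun y => volume_density phi y *
    \sum_j invmx (gram phi y) i j * partial j (f \o phi) y) x.

(* f is in the eigenspace of -Delta for the value mu. *)
Definition eigenspace_LB (mu : R) (f : 'M[R]_N -> R) : Prop :=
  smooth_on_SO f /\
  forall U phi, local_parametrization U phi ->
  forall x, U x -> - laplace_beltrami phi f x = mu * f (phi x).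

Definition linearly_independent_SO (k : nat)
    (F : 'I_k -> 'M[R]_N -> R) : Prop :=
  forall c : 'I_k -> R,
    (forall g, SO g -> \sum_i c i * F i g = 0) -> forall i, c i = 0.

(* The dimension of the eigenspace, which is 0 if mu is not an eigenvalue. *)
Definition multiplicity (mu : R) : \bar R :=
  ereal_sup [set k%:R%:E | k in [set k : nat |
    exists2 F : 'I_k -> 'M[R]_N -> R,
      forall i, eigenspace_LB mu (F i) & linearly_independent_SO F]].

(* The value of the sum is finite, SO(N) being compact. *)
Definition eigenvalue_count (lambda : R) : R :=
  fine (\esum_(mu in [set mu : R | (mu <= lambda)%R]) multiplicity mu)%E.

(* v is the total volume computed from a finite atlas phi_1, ..., phi_m and a
   subordinate partition of unity rho_1, ..., rho_m; the result does not depend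
   on these choices, and continuity of the rho_i is enough. *)
Definition is_riemannian_volume (v : R) : Prop :=
  exists (m : nat) (U : 'I_m -> set 'rV[R]_d)
    (phi : 'I_m -> 'rV[R]_d -> 'M[R]_N) (rho : 'I_m -> 'M[R]_N -> R),
  [/\ forall i, local_parametrization (U i) (phi i),
      forall i, {within SO, continuous (rho i)} /\
        forall g, SO g -> 0 <= rho i g,
      forall i, exists K : set 'rV[R]_d, [/\ compact K, K `<=` U i &
        forall g, SO g -> ~ (phi i @` K) g -> rho i g = 0],
      forall g, SO g -> \sum_i rho i g = 1 &
      v%:E = (\sum_i integral_Rn (fun x : 'rV[R]_d =>
        if x \in U i then (rho i (phi i x) * volume_density (phi i) x)%:E
        else 0))%E].

Definition Vol : R := xget 0 [set v | is_riemannian_volume v].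

Definition weyl_constant : R :=
  2 * Vol / (d%:R * (4 * pi) `^ (d%:R / 2) * Gamma (d%:R / 2)).

End SpecialOrthogonal.

Arguments eigenvalue_count {R} N lambda.
Arguments weyl_constant R N : clear implicits.

(* Main.v *)
Require Import Defs.
From HB Require Import structures.
From mathcomp Require Import all_boot all_order all_algebra.
From mathcomp Require Import all_classical all_reals all_analysis.
From mathcomp Require Import complex zify ring lra.
Import Order.TTheory GRing.Theory Num.Theory.
Import numFieldNormedType.Exports.

Local Open Scope classical_set_scope.
Local Open Scope ring_scope.

Set Implicit Arguments.
Unset Strict Implicit.
Unset Printing Implicit Defensive.

(* All eigenvalues of -Delta on SO(N) are integers. Hence the counting function
   takes the same value at k and at k + 1/2, while C_d lambda^(d/2) grows by at
   least C_d k^(d/2-1) / 2 between these two points; since C_d <> 0, the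
   remainder is not o(lambda^(d/2-1)).

   Integrality avoids the Peter-Weyl theorem. At the center g h of the Cayley
   chart x |-> g Cay(x) h the metric is Euclidean to first order, so there the
   Laplacian is the sum of the second derivatives along plane rotations. A
   coupling version of the maximum principle on SO(N) x [0, 1] then bounds the
   Lipschitz constant of an eigenfunction along plane rotations by its sup norm.
   As SO(N) consists of products of a fixed number of plane rotations, each
   eigenspace is finite-dimensional, hence a representation of SO(N) on which
   the Casimir element acts by the eigenvalue. Taking top weights k_0, k_1, ...
   for the planes (0, 1), (2, 3), ... in succession gives
   mu = sum_a (k_a^2 + (N - 2a - 2) k_a), and the k_a are integers because
   rotations are 2 pi-periodic.

   C_d <> 0 amounts to Vol > 0 (and Gamma(d/2) > 0): a finite net of Cayley
   charts with bump functions shows that the volume exists, and any admissible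
   atlas gives a positive value because the Gram matrices are positive
   definite. *)

(** * Highest weights of so(N) *)

(** An eigenfunction is known only through smoothness and the eigenvalue equation in every
    parametrization, so the finite dimension of an eigenspace has to come from that equation. It is
    used at chart centers only, every point of SO(N) being one. There the metric matters only to
    first order, since the divergence form of the Laplacian differentiates its coefficients once.
    Coordinate lines through a center are plane rotations up to the change of parameter t |-> 2
    tan(t/2), which is odd and tangent to the identity at 0 and so preserves limits of second
    difference quotients.

    The maximum principle doubles the variable: in f(g R(t)) - f(g) the eigenvalue equation at the
    two points leaves only terms bounded by the sup norm, and the strict sign comes from a concave
    modulus in the single plane where the two points move apart.

    Planes can be treated in succession because the top weight space of one plane is stable under
    rotations of the remaining coordinates, and because its raising operators turn each pair of
    squares in the Casimir into a multiple of the weight. *)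

Section HighestWeight.
Variables (C : numClosedFieldType) (m N : nat).
Implicit Types (v w : 'rV[C]_m) (W H : 'M[C]_m).

(** In a row basis of [W] the restriction of [H] is a square matrix [D] of positive size, which has
    an eigenvalue because [C] is algebraically closed. *)
Lemma stable_eigenvector W H : W != 0 -> stablemx W H ->
  exists (c : C) v, [/\ v != 0, (v <= W)%MS & v *m H = c *: v].
Proof.
move=> W0; rewrite -stablemx_row_base => /submxP[D eD].
have [a /eigenvalueP[v va v0]] : exists a, eigenvalue D a.
  have /closed_rootP[a ra] : size (char_poly D) != 1%N.
    by rewrite size_char_poly eqSS mxrank_eq0.
  by exists a; rewrite eigenvalue_root_char.
exists a, (v *m row_base W); split; first by rewrite mulmx_free_eq0 ?row_base_free.
  by rewrite (submx_trans (submxMl _ _)) ?eq_row_base.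
by rewrite -mulmxA eD mulmxA va -scalemxAl.
Qed.

(** The first m + 1 terms would be distinct roots of a characteristic polynomial of degree m. *)
Lemma eigenvalue_seq_noninj H (c : nat -> C) :
  injective c -> ~ (forall n, eigenvalue H (c n)).
Proof.
move=> ci He; have := @max_poly_roots _ (char_poly H) [seq c i | i <- iota 0 m.+1].
rewrite -size_poly_eq0 size_char_poly size_map size_iota ltnn.
move=> /(_ isT) P; apply: notF; apply: P; last by rewrite map_inj_uniq ?iota_uniq.
by apply/allP => _ /mapP[i _ ->]; rewrite -eigenvalue_root_char.
Qed.

(* Operators raising the weight by one vanish on the top weight space. *)
Lemma top_weight W H : W != 0 -> stablemx W H ->
  (forall c : C, eigenvalue H c -> exists k : int, c = 'i * k%:~R) ->
  exists k : int, (exists v, [/\ v != 0, (v <= W)%MS & v *m H = ('i * k%:~R) *: v]) /\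
     (forall w, (w <= W)%MS -> w *m H = ('i * (k + 1)%:~R) *: w -> w = 0).
Proof.
move=> W0 Wst Hint; apply: contrapT => /forallNP nk.
have [c [v [v0 vW vc]]] := stable_eigenvector W0 Wst.
have [k0 ck] : exists k : int, c = 'i * k%:~R.
  by apply: Hint; apply/eigenvalueP; exists v.
have up n : exists v, [/\ v != 0, (v <= W)%MS &
    v *m H = ('i * (k0 + n%:Z)%:~R) *: v].
  elim: n => [|n IHn]; first by exists v; rewrite addr0 -ck.
  apply: contrapT => /forallNP nw; apply: (nk (k0 + n%:Z)); split => // w wW wH.
  apply/eqP/negP => /negP w0; apply: (nw w); split => //.
  by rewrite wH -addrA (intS n) (addrC 1).
apply: (@eigenvalue_seq_noninj H (fun n : nat => 'i * (k0 + n%:Z)%:~R)).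
  by move=> a b /(mulfI (neq0Ci C)) /intr_inj /addrI [].
by move=> n; have [w [w0 _ wH]] := up n; apply/eigenvalueP; exists w.
Qed.

Variable A : 'I_N -> 'I_N -> 'M[C]_m.
(** The bracket relations of so(N) for the generators E_ij - E_ji. Vectors are rows, so operators
    act from the right. [A_int] is what the 2 pi-periodicity of plane rotations will provide. *)
Hypothesis A_comm : forall i j k l, A i j *m A k l - A k l *m A i j =
  A i l *+ (j == k) - A i k *+ (j == l) - A j l *+ (i == k) + A j k *+ (i == l).
Hypothesis A_anti : forall i j, A j i = - A i j.
Hypothesis A_int : forall i j (c : C), eigenvalue (A i j) c ->
  exists k : int, c = 'i * k%:~R.

(** The Casimir element of the so(N - a) that acts on the coordinates from [a] on. It is the plain
    sum of squares of skew generators, so [partial_casimir 0] will act by - mu. *)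
Definition partial_casimir (a : nat) : 'M[C]_m :=
  \sum_(i < N | (a <= i)%N) \sum_(j < N | (i < j)%N) A i j *m A i j.

(** The planes (p, j) and (q, j) are paired because only the sum of their two squares factors
    through raising and lowering operators. *)
Lemma casimir_step (p q : 'I_N) : q = p.+1 :> nat ->
  partial_casimir p = A p q *m A p q +
   \sum_(j < N | (q < j)%N) (A p j *m A p j + A q j *m A q j) + partial_casimir q.+1.
Proof.
have ne (x y : 'I_N) : (x != y) = (nat_of_ord x != nat_of_ord y) by [].
move=> qp; rewrite /partial_casimir (bigD1 p) //= (bigD1 q) /=; last by lia.
rewrite [X in _ + X](bigD1 q) /=; last by rewrite ne; lia.
rewrite big_split /= -!addrA; congr (_ + _).
have -> : \sum_(i < N | (p < i)%N && (i != q)) A p i *m A p i =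
          \sum_(i < N | (q < i)%N) A p i *m A p i.
  by apply: eq_bigl => j; rewrite ne; lia.
by congr (_ + (_ + _)); apply: eq_bigl => j; rewrite !ne; lia.
Qed.

(* Peeling off one rotation plane: on the top eigenspace of [A p q] in [W] the
   Casimir of so(N - p) differs from that of so(N - p - 2) by an integer. *)
Lemma peel_plane (p q : 'I_N) W : q = p.+1 :> nat -> W != 0 ->
  (forall i j : 'I_N, (p <= i)%N -> (p <= j)%N -> stablemx W (A i j)) ->
  exists (c : int) W', [/\ W' != 0, (W' <= W)%MS,
   forall i j : 'I_N, (q < i)%N -> (q < j)%N -> stablemx W' (A i j) &
   forall v, (v <= W')%MS -> v *m partial_casimir p =
      v *m partial_casimir q.+1 + c%:~R *: v].
Proof.
move=> qp W0 Wst; set H := A p q.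
have pq : p == q = false by apply/eqP => /(congr1 val) /=; lia.
have lpq : (p <= q)%N by lia.
have [k [[v [v0 vW vH]] top]] := top_weight W0 (Wst p q (leqnn p) lpq) (@A_int p q).
set W' := (W :&: eigenspace H ('i * k%:~R))%MS.
have vW' : (v <= W')%MS by rewrite sub_capmx vW; apply/eigenspaceP.
pose n := #|[pred j : 'I_N | (q < j)%N]|.
(* The square of [H] contributes - k^2, and each of the [n] indices beyond [q] contributes - k. *)
exists (- (k * k + k *+ n)), W'; split.
- by apply: contraNneq v0 => W'0; move: vW'; rewrite W'0 submx0.
- exact: capmxSl.
(* Generators of planes disjoint from {p, q} commute with [H] and hence preserve its eigenspace. *)
- move=> i j qi qj; rewrite sub_capmx (submx_trans (submxMr _ (capmxSl _ _))) ?Wst //;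
    try lia.
  rewrite (submx_trans (submxMr _ (capmxSr _ _))) // comm_mx_stable_eigenspace //.
  have ne (x y : 'I_N) : (x < y)%N -> (x == y = false) * (y == x = false).
    by move=> xy; split; apply/eqP => /(congr1 val) /=; lia.
  apply/eqP; rewrite -subr_eq0 A_comm.
  by rewrite !ne ?mulr0n ?addr0 ?subr0 //; lia.
move=> w; rewrite sub_capmx => /andP[wW /eigenspaceP wH].
rewrite (casimir_step qp) !mulmxDr -/H mulmxA wH -scalemxAl wH scalerA.
rewrite mulmx_sumr.
have -> : \sum_(j < N | (q < j)%N) w *m (A p j *m A p j + A q j *m A q j) =
    \sum_(j < N | (q < j)%N) ((- k)%:~R *: w).
  apply: eq_bigr => j qj.
  have jp : j == p = false by apply/eqP => /(congr1 val) /=; lia.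
  have jq : j == q = false by apply/eqP => /(congr1 val) /=; lia.
  (* Raising and lowering operators for [H]: P H = H P + i P, so [P] maps the top weight space to
     weight k + 1 and therefore kills it. What is left of the two squares, which sum to P Q + i H,
     is i times i k = - k. *)
  pose P := A p j - 'i *: A q j; pose Q := A p j + 'i *: A q j.
  have HP : P *m H = H *m P + 'i *: P.
    have e1 : A p j *m H - H *m A p j = A q j.
      by rewrite /H A_comm jp jq pq eqxx !mulr0n mulr1n addr0 subr0 add0r -A_anti.
    have e2 : A q j *m H - H *m A q j = - A p j.
      by rewrite /H A_comm jp jq [q == p]eq_sym pq eqxx !mulr0n mulr1n !subr0 add0r A_anti.
    rewrite /P mulmxBl mulmxBr -scalemxAl -scalemxAr.
    have -> : A p j *m H = H *m A p j + A q j by rewrite -e1 addrC subrK.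
    have -> : A q j *m H = H *m A q j - A p j by rewrite -e2 addrC subrK.
    rewrite !scalerBr !scalerA -expr2 sqrCi scaleN1r.
    move: (H *m A p j) (A q j) ('i *: (H *m _)) ('i *: A p j) => a b c d.
    by apply/matrixP => x y; rewrite !mxE; ring.
  have wP : w *m P = 0.
    apply: top.
      by rewrite /P mulmxBr -scalemxAr addmx_sub ?eqmx_opp ?scalemx_sub //;
         apply: (submx_trans (submxMr _ wW)); apply: Wst; lia.
    rewrite -mulmxA HP mulmxDr mulmxA wH -scalemxAl -scalemxAr -scalerDl.
    by rewrite intrD mulrDr mulr1.
  have PQ : A p j *m A p j + A q j *m A q j = P *m Q + 'i *: H.
    have e3 : A p j *m A q j = A q j *m A p j - H.
      apply/eqP; rewrite addrC -subr_eq; apply/eqP; rewrite A_comm jq eqxx pq.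
      by rewrite [p == j]eq_sym jp !mulr0n mulr1n addr0 subr0 add0r.
    rewrite /P /Q mulmxBl !mulmxDr -!scalemxAl -!scalemxAr scalerA -expr2 sqrCi.
    rewrite e3 scaleN1r opprD opprK scalerBr.
    move: (A p j *m _) (A q j *m A q j) ('i *: (_ *m _)) ('i *: H) => a b c h.
    by apply/matrixP => x y; rewrite !mxE; ring.
  by rewrite PQ mulmxDr mulmxA wP mul0mx add0r -scalemxAr wH scalerA mulrA
     -expr2 sqrCi mulN1r intrN.
rewrite sumr_const -[#|_|]/n [RHS]addrC; congr (_ + _).
rewrite -scaler_nat scalerA -scalerDl; congr (_ *: _).
rewrite mulrACA -expr2 sqrCi; ring.
Qed.

Lemma casimir_scalar_int (x : C) : (0 < m)%N -> partial_casimir 0 = x%:M ->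
  exists k : int, x = k%:~R.
Proof.
move=> m0 casx.
have peel a : (a.*2 <= N)%N -> exists (c : int) W, [/\ W != 0,
    forall i j : 'I_N, (a.*2 <= i)%N -> (a.*2 <= j)%N -> stablemx W (A i j) &
    forall v, (v <= W)%MS -> x *: v = v *m partial_casimir a.*2 + c%:~R *: v].
  elim: a => [_|a IHa aN].
    exists 0, 1%:M; split => [|i j _ _|v _]; last 1 first.
    - by rewrite casx mul_mx_scalar scale0r addr0.
    - by rewrite -mxrank_eq0 mxrank1 -lt0n.
    - exact: submx1.
  have [|c [W [W0 Wst Wc]]] := IHa; first by lia.
  have pN : (a.*2 < N)%N by lia.
  have qN : (a.*2.+1 < N)%N by lia.
  have [c' [W' [W'0 W'W W'st W'c]]] :=
    @peel_plane (Ordinal pN) (Ordinal qN) W erefl W0 Wst.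
  exists (c' + c), W'; split=> // v vW'.
  rewrite Wc ?(submx_trans vW') // (W'c _ vW') doubleS -addrA -scalerDl.
  by rewrite intrD.
(* After [N./2] planes at most one index remains, so the remaining partial Casimir is an empty
   sum. *)
have [|c [W [W0 _ Wc]]] := peel N./2; first by lia.
exists c; have /rowV0Pn[v vW v0] := W0.
have : x *: v = c%:~R *: v.
  rewrite Wc // /partial_casimir big1 ?mulmx0 ?add0r // => i Ni.
  by rewrite big1 // => j ij; have := ltn_ord j; lia.
by move/eqP; rewrite -subr_eq0 -scalerBl scaler_eq0 (negPf v0) orbF subr_eq0 => /eqP.
Qed.
End HighestWeight.

(** * Cayley transform and plane rotations *)

Section Planes.
Variable N : nat.

Definition planes := [set p : 'I_N * 'I_N | (p.1 < p.2)%N]%SET.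

Lemma card_planes : #|planes| = dimSO N.
Proof.
rewrite /planes cardsE -sum1_card /=.
rewrite (eq_bigl (fun p : 'I_N * 'I_N => true && (p.1 < p.2)%N)) //.
rewrite -(pair_big_dep xpredT (fun i j : 'I_N => (i < j)%N) (fun _ _ => 1%N)) /=.
rewrite (eq_bigr (fun i : 'I_N => N.-1 - i)%N).
  rewrite /dimSO divn2 -bin2 -triangular_sum.
  rewrite (reindex_inj rev_ord_inj) /= big_mkord.
  by apply: eq_bigr => i _; rewrite /= subnS; have := ltn_ord i; lia.
move=> i _; under eq_bigl => j do rewrite -[(i < j)%N]andTb.
rewrite -(big_geq_mkord _ _ xpredT (fun _ => 1%N)) sum_nat_const_nat; lia.
Qed.

(** Parametrizations have domain R^(dimSO N), so the coordinate planes are numbered by ordinals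
    rather than indexed by pairs. *)
Definition plane (k : 'I_(dimSO N)) : 'I_N * 'I_N :=
  enum_val (cast_ord (esym card_planes) k).

Lemma plane_lt k : ((plane k).1 < (plane k).2)%N.
Proof.
by have := enum_valP (cast_ord (esym card_planes) k); rewrite /planes inE.
Qed.

Lemma plane_neq k : (plane k).1 != (plane k).2.
Proof. by have := plane_lt k; rewrite ltn_neqAle => /andP[]. Qed.

Lemma plane_inj : injective plane.
Proof. by move=> k l /enum_val_inj /cast_ord_inj. Qed.

Lemma planeP (i j : 'I_N) : (i < j)%N -> exists k, plane k = (i, j).
Proof.
move=> ij; have ijP : (i, j) \in planes by rewrite /planes inE.
exists (cast_ord card_planes (enum_rank_in ijP (i, j))).
by rewrite /plane cast_ordK enum_rankK_in.
Qed.

Lemma sum_planes (V : nmodType) (F : 'I_N -> 'I_N -> V) :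
  \sum_(k < dimSO N) F (plane k).1 (plane k).2 =
  \sum_(i < N) \sum_(j < N | (i < j)%N) F i j.
Proof.
rewrite pair_big_dep /= (eq_bigl [in planes]); last first.
  by move=> p; rewrite /planes inE.
rewrite (big_enum_val (fun p => F p.1 p.2)) /=.
rewrite (reindex (cast_ord (esym card_planes))) //=.
by exists (cast_ord card_planes) => k _; rewrite ?cast_ordK ?cast_ordKV.
Qed.

End Planes.

Section Skew.
Variables (R : realType) (N : nat).
Notation d := (dimSO N).
Implicit Types (A B g h : 'M[R]_N) (x : 'rV[R]_d).

Definition gen (i j : 'I_N) : 'M[R]_N := delta_mx i j - delta_mx j i.

Definition skew x : 'M[R]_N :=
  \sum_k x 0 k *: gen (plane k).1 (plane k).2.

Definition coords A : 'rV[R]_d := \row_k A (plane k).1 (plane k).2.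

Lemma tr_gen i j : (gen i j)^T = - gen i j.
Proof. by rewrite /gen linearB /= !trmx_delta opprB. Qed.

Lemma gen_anti i j : gen j i = - gen i j.
Proof. by rewrite /gen opprB. Qed.

Lemma tr_skew x : (skew x)^T = - skew x.
Proof.
rewrite /skew linear_sum /= -sumrN; apply: eq_bigr => k _.
by rewrite linearZ /= tr_gen scalerN.
Qed.

Lemma skewD x y : skew (x + y) = skew x + skew y.
Proof.
by rewrite /skew -big_split; apply: eq_bigr => k _; rewrite mxE scalerDl.
Qed.

Lemma skewZ c x : skew (c *: x) = c *: skew x.
Proof.
by rewrite /skew scaler_sumr; apply: eq_bigr => k _; rewrite mxE scalerA.
Qed.

HB.instance Definition _ := GRing.isSemilinear.Build R 'rV[R]_d 'M[R]_N _ skew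
  (skewZ, skewD).

Lemma coords_skew x : coords (skew x) = x.
Proof.
apply/rowP => k; rewrite mxE summxE (bigD1 k) //= big1 ?addr0.
  have lt := plane_lt k; rewrite !mxE !eqxx /= -!val_eqE /=.
  by rewrite ltn_eqF // subr0 mulr1.
move=> l lk; rewrite !mxE.
have := plane_lt k; have := plane_lt l.
have : plane k != plane l by apply: contraNneq lk => /plane_inj ->.
case: (plane k) (plane l) => [a b] [e f] /= ne lt1 lt2.
rewrite (_ : (a == e) && (b == f) = false); last first.
  by apply/negP => /andP[/eqP ae /eqP bf]; rewrite ae bf eqxx in ne.
rewrite (_ : (a == f) && (b == e) = false) ?subrr ?mulr0 //.
by apply/negP => /andP[/eqP ae /eqP bf]; rewrite ae bf in lt2; lia.
Qed.

Lemma skew_inj : injective skew.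
Proof. exact: can_inj coords_skew. Qed.

Lemma anti_entry A (i j : 'I_N) : A^T = - A -> A j i = - A i j.
Proof. by move/matrixP/(_ i j); rewrite !mxE. Qed.

Lemma skew_coords A : A^T = - A -> skew (coords A) = A.
Proof.
move=> At; have e (i j : 'I_N) : (i < j)%N -> skew (coords A) i j = A i j.
  move=> /planeP[k pk]; have /rowP/(_ k) := coords_skew (coords A).
  by rewrite !mxE pk.
apply/matrixP => i j; have [ij|ji|/val_inj ->] := ltngtP i j.
- exact: e.
- by rewrite (anti_entry _ _ (tr_skew _)) e // -(anti_entry _ _ At).
- have := anti_entry j j At; have := anti_entry j j (tr_skew (coords A)).
  by move=> h1 h2; lra.
Qed.

Lemma skew_delta k : skew (delta_mx 0 k) = gen (plane k).1 (plane k).2.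
Proof.
rewrite /skew (bigD1 k) //= big1 ?addr0 => [|l lk]; rewrite mxE eqxx ?eqxx.
  by rewrite scale1r.
by rewrite (negPf lk) scale0r.
Qed.

Lemma skew_quad A (v : 'rV[R]_N) : A^T = - A -> (v *m A *m v^T) 0 0 = 0.
Proof.
move=> At; have /matrixP/(_ 0 0) : (v *m A *m v^T)^T = - (v *m A *m v^T).
  by rewrite !trmx_mul trmxK At mulNmx mulmxN mulmxA.
by rewrite mxE [RHS]mxE => h; lra.
Qed.

Lemma row_normsq_eq0 n (v : 'rV[R]_n) : (v *m v^T) 0 0 = 0 -> v = 0.
Proof.
rewrite mxE => /eqP; rewrite psumr_eq0 => [/allP v0|k _]; last first.
  by rewrite mxE -expr2 sqr_ge0.
apply/rowP => k; have /= := v0 k (mem_index_enum _).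
by rewrite !mxE -expr2 sqrf_eq0 => /eqP.
Qed.

(** If v A = v, then v v^T = v A v^T, which vanishes for skew A. *)
Lemma skew_unit A : A^T = - A -> 1%:M - A \in unitmx.
Proof.
move=> At; rewrite unitmxE unitfE; apply/negP => /det0P[v v0 /eqP].
rewrite mulmxBr mulmx1 subr_eq0 => /eqP vA.
have := skew_quad v At; rewrite -vA => /row_normsq_eq0 ve.
by rewrite ve eqxx in v0.
Qed.

(** The Cayley transform (1 + A/2)(1 - A/2)^-1, in a form with a single inverse, which is easier to
    differentiate. The factor 1/2 makes its derivative at 0 the identity. *)
Definition cay A : 'M[R]_N := 2 *: invmx (1%:M - 2^-1 *: A) - 1%:M.

(** This is 2 (g - 1)(1 + g)^-1, the inverse of [cay] where -1 is not an eigenvalue of g. *)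
Definition icay g : 'M[R]_N := 2%:M - 4 *: invmx (1%:M + g).

Lemma halfskew A : A^T = - A -> (2^-1 *: A)^T = - (2^-1 *: A).
Proof. by move=> At; rewrite linearZ /= At scalerN. Qed.

Lemma halfskew_unit A : A^T = - A -> 1%:M - 2^-1 *: A \in unitmx.
Proof. by move/halfskew/skew_unit. Qed.

Lemma cay0 : cay 0 = 1%:M.
Proof. by rewrite /cay scaler0 subr0 invmx1 scaler_nat mulr2n addrK. Qed.

Lemma cayE A : A^T = - A ->
  cay A = (1%:M + 2^-1 *: A) *m invmx (1%:M - 2^-1 *: A).
Proof.
move=> /halfskew_unit u; rewrite /cay.
have -> : 1%:M + 2^-1 *: A = 2%:M - (1%:M - 2^-1 *: A).
  by apply/matrixP => i j; rewrite !mxE; case: eqP => _; rewrite ?mulr1n ?mulr0n; ring.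
by rewrite mulmxBl mul_scalar_mx mulmxV.
Qed.

Lemma cay_unique A g : A^T = - A ->
  g *m (1%:M - 2^-1 *: A) = 1%:M + 2^-1 *: A -> g = cay A.
Proof. by move=> At e; rewrite cayE // -e mulmxK // halfskew_unit. Qed.

Lemma cayN A : A^T = - A -> cay A *m cay (- A) = 1%:M.
Proof.
move=> At; have Nt : (- A)^T = - - A by rewrite linearN /= At.
have u := halfskew_unit At; have := halfskew_unit Nt.
rewrite scalerN opprK => u'.
rewrite cayE // cayE // scalerN opprK.
set B := 1%:M - _; set B' := 1%:M + _.
have BB' : B *m B' = B' *m B.
  rewrite /B /B' !(mulmxBl, mulmxBr, mulmxDl, mulmxDr) !mulmx1 !mul1mx.
  rewrite mulNmx; set X := 2^-1 *: A; set Y := X *m X; move: X Y => X Y.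
  by apply/matrixP => i j; rewrite !mxE; ring.
by rewrite !mulmxA mulmxKV // mulmxV.
Qed.

Lemma tr_cay A : A^T = - A -> (cay A)^T = cay (- A).
Proof.
move=> At; rewrite /cay linearB linearZ /= trmx_inv trmx1 linearB linearZ /=.
by rewrite trmx1 At.
Qed.

Lemma SO_cay A : A^T = - A -> SO (cay A).
Proof.
move=> At; have Nt : (- A)^T = - - A by rewrite linearN /= At.
split; first by rewrite tr_cay // -{2}[A]opprK cayN.
rewrite cayE // det_mulmx det_inv.
(* Numerator and denominator of the Cayley transform are transposes of each other, so their
   determinants agree. *)
have -> : 1%:M + 2^-1 *: A = (1%:M - 2^-1 *: A)^T.
  by rewrite linearB linearZ /= trmx1 At scalerN opprK.
by rewrite det_tr mulfV // -unitfE -unitmxE halfskew_unit.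
Qed.

Lemma add1_cay A : A^T = - A -> invmx (1%:M + cay A) = 2^-1 *: (1%:M - 2^-1 *: A).
Proof.
move=> At; rewrite /cay addrC subrK; set B := 1%:M - _.
have u : B \in unitmx := halfskew_unit At.
by rewrite invmxZ ?invmxK // unitmxZ ?unitfE ?pnatr_eq0 // unitmx_inv.
Qed.

Lemma add1_cay_unit A : A^T = - A -> 1%:M + cay A \in unitmx.
Proof.
move=> At; rewrite /cay addrC subrK unitmxZ ?unitfE // unitmx_inv.
exact: halfskew_unit.
Qed.

Lemma cayK A : A^T = - A -> icay (cay A) = A.
Proof.
move=> At; rewrite /icay add1_cay //.
by apply/matrixP => i j; rewrite !mxE; case: eqP => _; rewrite ?mulr1n ?mulr0n; field.
Qed.

Lemma tr_icay g : g^T *m g = 1%:M -> 1%:M + g \in unitmx -> (icay g)^T = - icay g.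
Proof.
move=> gg u; rewrite /icay linearB linearZ /= tr_scalar_mx trmx_inv linearD /= trmx1.
suff -> : invmx (1%:M + g^T) = 1%:M - invmx (1%:M + g).
  by apply/matrixP => i j; rewrite !mxE; case: eqP => _; rewrite ?mulr1n ?mulr0n; ring.
have ut : 1%:M + g^T \in unitmx by rewrite -unitmx_tr linearD /= trmx1 trmxK.
apply: (can_inj (mulmxK u)); rewrite mulmxBl mul1mx mulVmx // [1%:M + g]addrC addrK.
rewrite -[g in RHS](mulKmx ut); congr (_ *m _).
by rewrite mulmxDl mul1mx gg addrC.
Qed.

Lemma icayK g : g^T *m g = 1%:M -> 1%:M + g \in unitmx -> cay (icay g) = g.
Proof.
move=> gg u; apply/esym/cay_unique; first exact: tr_icay.
rewrite /icay !scalerBr scalerA !scale_scalar_mx mulVf ?pnatr_eq0 //.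
have -> : 2^-1 * 4 = 2 :> R by field.
rewrite opprB addrCA subrr addr0 -scalemxAr.
have -> : g *m invmx (1%:M + g) = 1%:M - invmx (1%:M + g).
  apply: (can_inj (mulmxK u)); rewrite mulmxKV // mulmxBl mul1mx mulVmx //.
  by rewrite [1%:M + g]addrC addrK.
by apply/matrixP => i j; rewrite !mxE; case: eqP => _; rewrite ?mulr1n ?mulr0n; ring.
Qed.

End Skew.

Section Rotations.
Variables (R : realType) (N : nat).
Implicit Types (A B g h : 'M[R]_N) (i j k : 'I_N).

Lemma SO1 : SO (1%:M : 'M[R]_N).
Proof. by split; rewrite ?trmx1 ?mulmx1 ?det1. Qed.

Lemma SO_mul g h : SO g -> SO h -> SO (g *m h).
Proof.
move=> [g1 g2] [h1 h2]; split; last by rewrite det_mulmx g2 h2 mulr1.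
by rewrite trmx_mul mulmxA -[_ *m _ *m g]mulmxA g1 mulmx1.
Qed.

Lemma SO_mulVr g : SO g -> g *m g^T = 1%:M.
Proof. by case=> g1 _; exact: mulmx1C. Qed.

Lemma SO_tr g : SO g -> SO g^T.
Proof. by move=> gS; split; rewrite ?trmxK ?SO_mulVr // det_tr; case: gS. Qed.

Lemma SO_conj_cay g A : SO g -> A^T = - A -> g *m cay A *m g^T = cay (g *m A *m g^T).
Proof.
move=> gS At; apply: cay_unique.
  by rewrite !trmx_mul trmxK At mulNmx mulmxN mulmxA.
have e (c : R) : 1%:M + c *: (g *m A *m g^T) = g *m (1%:M + c *: A) *m g^T.
  by rewrite mulmxDr mulmx1 mulmxDl SO_mulVr // -scalemxAr -scalemxAl.
rewrite -scaleNr !e; set B := 1%:M + - _ *: A.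
have -> : g *m cay A *m g^T *m (g *m B *m g^T) = g *m cay A *m (g^T *m g) *m B *m g^T.
  by rewrite !mulmxA.
rewrite (proj1 gS) mulmx1 -[_ *m _ *m B]mulmxA; congr (_ *m _ *m _).
rewrite /B cayE // scaleNr mulmxKV //.
exact: halfskew_unit.
Qed.

(** The closed form of exp(t J) for J = [gen R i j]: when i and j differ, - J^2 is the projection
    onto the plane. *)
Definition rot i j (t : R) : 'M[R]_N :=
  1%:M + sin t *: gen R i j + (cos t - 1) *: (delta_mx i i + delta_mx j j).

Lemma rot0 i j : rot i j 0 = 1%:M.
Proof. by rewrite /rot sin0 cos0 subrr !scale0r !addr0. Qed.

Section Plane.
Variables i j : 'I_N.
Hypothesis ij : i != j.
Let J : 'M[R]_N := gen R i j.
Let P : 'M[R]_N := delta_mx i i + delta_mx j j.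
Let ji : (j == i) = false. Proof. by rewrite eq_sym; exact: negPf. Qed.

Let dmul (a b c e : 'I_N) : delta_mx a b *m delta_mx c e = (b == c)%:R *: delta_mx a e :> 'M[R]_N.
Proof.
case: eqP => [->|/eqP bc]; first by rewrite mul_delta_mx scale1r.
by rewrite mul_delta_mx_0 // scale0r.
Qed.

Let PP : P *m P = P.
Proof.
rewrite /P mulmxDl !mulmxDr !dmul !eqxx (negPf ij) ji !scale0r !scale1r.
by rewrite addr0 add0r.
Qed.
Let PJ : P *m J = J.
Proof.
rewrite /P /J /gen mulmxDl !mulmxBr !dmul !eqxx (negPf ij) ji !scale0r !scale1r.
by rewrite subr0 sub0r.
Qed.
Let JP : J *m P = J.
Proof.
rewrite /P /J /gen mulmxBl !mulmxDr !dmul !eqxx (negPf ij) ji !scale0r !scale1r.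
by rewrite addr0 add0r.
Qed.
Let JJ : J *m J = - P.
Proof.
rewrite /P /J /gen mulmxBl !mulmxBr !dmul !eqxx (negPf ij) ji !scale0r !scale1r.
by rewrite subr0 sub0r opprD.
Qed.

Lemma rotD s t : rot i j (s + t) = rot i j s *m rot i j t.
Proof.
rewrite /rot -/J -/P !(mulmxDl, mulmxDr) !mul1mx !mulmx1 -!scalemxAl -!scalemxAr.
rewrite PP JJ PJ JP sinD cosD; apply/matrixP => a b; rewrite !mxE; ring.
Qed.

Lemma tr_rot t : (rot i j t)^T = rot i j (- t).
Proof.
apply/matrixP => a b; rewrite !mxE sinN cosN !(andbC (a == _)) [b == a]eq_sym; ring.
Qed.

Lemma SO_rot t : SO (rot i j t).
Proof.
have o s : (rot i j s)^T *m rot i j s = 1%:M by rewrite tr_rot -rotD addNr rot0.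
(* A rotation is the square of the rotation h by half its angle, so its determinant is (det h)^2 =
   det (h^T h) = 1. *)
split=> //; have -> : t = 2^-1 * t + 2^-1 * t by field.
rewrite rotD det_mulmx; have /(congr1 determinant) := o (2^-1 * t).
by rewrite det_mulmx det_tr det1.
Qed.

Lemma rot_2pi : rot i j (pi *+ 2) = 1%:M.
Proof. by rewrite /rot sin2pi cos2pi subrr !scale0r !addr0. Qed.

(** The half-angle substitution: the coefficient is 2 tan(t/2). It makes the coordinate lines
    through the center of a Cayley chart into reparametrized plane rotations. *)
Lemma rot_cay t : 1 + cos t != 0 -> rot i j t = cay ((2 * sin t / (1 + cos t)) *: J).
Proof.
move=> c0; apply: cay_unique; first by rewrite linearZ /= tr_gen scalerN.
rewrite scalerA; set u := 2^-1 * _.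
have us : u * (1 + cos t) = sin t by rewrite /u; field.
have su : u * sin t = 1 - cos t.
  apply: (mulIf c0); rewrite mulrAC us -expr2.
  by rewrite sin2cos2; ring.
rewrite /rot -/J -/P !(mulmxDl, mulmxBr) !mul1mx !mulmx1 -!scalemxAl -!scalemxAr.
rewrite JJ PJ !scalerA scalerN.
have -> : sin t * u = 1 - cos t by rewrite mulrC.
have -> : (cos t - 1) * u = sin t - u *+ 2 by rewrite -us; ring.
apply/matrixP => a b; rewrite !mxE -us; ring.
Qed.

End Plane.
End Rotations.

(** * Limits at 0 *)

Section Limits.
Variable R : realType.

Lemma cvg_ext (T : Type) (F : set_system T) (f g : T -> R) (l l' : R) :
  f x @[x --> F] --> l -> (forall x, f x = g x) -> l = l' -> g x @[x --> F] --> l'.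
Proof. by move=> fl /funext <- <-. Qed.

Lemma cvg_near_ext (f g : R -> R) (l l' : R) : f t @[t --> (0 : R)^'] --> l ->
  (\forall t \near (0 : R)^', f t = g t) -> l = l' -> g t @[t --> (0 : R)^'] --> l'.
Proof.
move=> fl fg <-; apply: cvg_trans fl; apply: near_eq_cvg.
by apply: filterS fg => t ->.
Qed.

Lemma dnbhs0_scale (c : R) : c != 0 -> (c * t) @[t --> 0^'] --> 0^'.
Proof.
move=> c0 A [e /= e0 eA]; exists (e / `|c|) => /=; first by rewrite divr_gt0 ?normr_gt0.
move=> t /=; rewrite !sub0r !normrN => te t0; apply: eA => /=.
  by rewrite sub0r normrN normrM mulrC -ltr_pdivlMr ?normr_gt0.
by rewrite mulf_neq0.
Qed.

Lemma dnbhs0_opp : (- t : R) @[t --> 0^'] --> 0^'.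
Proof.
by have := @dnbhs0_scale (-1); rewrite oppr_eq0 oner_eq0 => /(_ isT); under eq_fun do rewrite mulN1r.
Qed.

Lemma diff_quotient (f : R -> R) (l : R) : is_derive (0 : R) (1 : R) f l ->
  t^-1 * (f t - f 0) @[t --> 0^'] --> l.
Proof.
move=> [df <-]; have : (h^-1 *: (f (h *: 1 + 0) - f 0)) @[h --> 0^'] --> 'D_1 f 0 := df.
by under eq_fun do rewrite addr0 [_ *: 1]mulr1.
Qed.

Lemma sin_quotient : t^-1 * sin t @[t --> (0 : R)^'] --> (1 : R).
Proof.
have := @diff_quotient sin _ (is_derive_sin 0); rewrite cos0 sin0.
by under eq_fun do rewrite subr0.
Qed.

Lemma cos_quotient : t^-1 * (cos t - 1) @[t --> (0 : R)^'] --> (0 : R).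
Proof.
by have := @diff_quotient cos _ (is_derive_cos 0); rewrite sin0 oppr0 cos0.
Qed.

(** This is 2 tan(t/2), the parameter change between rotations and Cayley transforms; it is odd and
    has derivative 1 at 0. *)
Definition tau (t : R) : R := 2 * sin t / (1 + cos t).

Lemma cvg_dnbhs (f : R -> R) (a l : R) : f @ a --> l -> f @ a^' --> l.
Proof. by apply: cvg_trans; apply: cvg_app; exact: cvg_within. Qed.

Lemma cos_near1 : cos t @[t --> (0 : R)^'] --> (1 : R).
Proof. by apply: cvg_dnbhs; rewrite -[X in _ --> X]cos0; exact: continuous_cos. Qed.

Lemma tau_quotient : t^-1 * tau t @[t --> (0 : R)^'] --> (1 : R).
Proof.
have -> : (fun t : R => t^-1 * tau t) = (fun t => 2 * (t^-1 * sin t) * (1 + cos t)^-1).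
  by apply/funext => t; rewrite /tau; ring.
rewrite [X in _ --> X](_ : 1 = 2 * 1 * (1 + 1)^-1); last by field.
apply: cvgM; first by apply: cvgM; [exact: cvg_cst|exact: sin_quotient].
apply: (@cvgV _ _ _ _ (fun t : R => 1 + cos t)).
  by rewrite (_ : 1 + 1 = 2 :> R) ?pnatr_eq0.
by apply: cvgD; [exact: cvg_cst|exact: cos_near1].
Qed.

Lemma tau_dnbhs : tau t @[t --> (0 : R)^'] --> (0 : R)^'.
Proof.
have t0 : tau t @[t --> (0 : R)^'] --> (0 : R).
  rewrite -[X in _ --> X](mul0r 1).
  have -> : tau = fun t : R => t * (t^-1 * tau t).
    apply/funext => t; have [->|t0] := eqVneq t 0; last by rewrite mulVKf.
    by rewrite mul0r /tau sin0 mulr0 mul0r.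
  by apply: cvgM tau_quotient; apply: cvg_dnbhs; exact: cvg_id.
have ne : \forall t \near (0 : R)^', tau t != 0.
  have : \forall t \near (0 : R)^', 0 < t^-1 * tau t.
    exact: (cvgr_gt _ tau_quotient _ ltr01).
  by apply: filterS => t; apply: contraTneq => ->; rewrite mulr0 ltxx.
move=> A [e /= e0 eA].
have b : \forall t \near (0 : R)^', ball 0 e (tau t).
  exact: t0 (nbhsx_ballx (0 : R) e e0).
change (\forall t \near (0 : R)^', A (tau t)).
by apply: filterS2 b ne => t /= tb tn; exact: eA.
Qed.

Lemma near_cosD1 : \forall t \near (0 : R)^', 1 + cos t != 0 :> R.
Proof.
have c : \forall t \near (0 : R)^', 0 < cos t.
  exact: cvgr_gt _ cos_near1 _ ltr01.
by apply: filterS c => t ct; rewrite gt_eqF // addr_gt0.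
Qed.

End Limits.

(** * Tangents at the identity of paths of matrices *)

Section MatrixLimits.
Variable R : realType.

Lemma cvg_sum (I T : Type) (F : set_system T) {FF : Filter F} (r : seq I)
    (P : pred I) (f : I -> T -> R) (l : I -> R) :
  (forall i, P i -> f i x @[x --> F] --> l i) ->
  \sum_(i <- r | P i) f i x @[x --> F] --> \sum_(i <- r | P i) l i.
Proof. by move=> fl; apply: cvg_big => //; exact: add_continuous. Qed.

Lemma cvg_prod (I T : Type) (F : set_system T) {FF : Filter F} (r : seq I)
    (P : pred I) (f : I -> T -> R) (l : I -> R) :
  (forall i, P i -> f i x @[x --> F] --> l i) ->
  \prod_(i <- r | P i) f i x @[x --> F] --> \prod_(i <- r | P i) l i.
Proof. by move=> fl; apply: cvg_big => //; exact: mul_continuous. Qed.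

Definition mxlim m n (F : R -> 'M[R]_(m, n)) (M : 'M[R]_(m, n)) : Prop :=
  forall a b, F t a b @[t --> (0 : R)^'] --> M a b.

Lemma mxlim_cst m n (M : 'M[R]_(m, n)) : mxlim (fun=> M) M.
Proof. by move=> a b; exact: cvg_cst. Qed.

Lemma mxlimD m n F G (A B : 'M[R]_(m, n)) :
  mxlim F A -> mxlim G B -> mxlim (fun t => F t + G t) (A + B).
Proof.
move=> FA GB a b; rewrite mxE; under eq_fun do rewrite mxE.
by apply: cvgD; [exact: FA | exact: GB].
Qed.

Lemma mxlimZ m n c F (k : R) (A : 'M[R]_(m, n)) :
  c t @[t --> (0 : R)^'] --> k -> mxlim F A -> mxlim (fun t => c t *: F t) (k *: A).
Proof.
move=> ck FA a b; rewrite mxE; under eq_fun do rewrite mxE.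
by apply: cvgM; [exact: ck | exact: FA].
Qed.

Lemma mxlimZc m n F (k : R) (A : 'M[R]_(m, n)) :
  mxlim F A -> mxlim (fun t => k *: F t) (k *: A).
Proof. by apply: mxlimZ; exact: cvg_cst. Qed.
Arguments mxlimZc {m n F} k {A} _.

Lemma mxlim_sum (I : Type) (r : seq I) (P : pred I) m n (F : I -> R -> 'M[R]_(m, n)) A :
  (forall i, P i -> mxlim (F i) (A i)) ->
  mxlim (fun t => \sum_(i <- r | P i) F i t) (\sum_(i <- r | P i) A i).
Proof.
move=> FA a b; rewrite summxE; under eq_fun do rewrite summxE.
by apply: cvg_sum => i Pi; exact: FA.
Qed.

Lemma mxlimM m n p F G (A : 'M[R]_(m, n)) (B : 'M[R]_(n, p)) :
  mxlim F A -> mxlim G B -> mxlim (fun t => F t *m G t) (A *m B).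
Proof.
move=> FA GB a b; rewrite mxE; under eq_fun do rewrite mxE.
by apply: cvg_sum => i _; apply: cvgM; [exact: FA | exact: GB].
Qed.

Lemma mxlimMl m n p F (A : 'M[R]_(m, n)) (B : 'M[R]_(n, p)) :
  mxlim F A -> mxlim (fun t => F t *m B) (A *m B).
Proof. by move=> FA; apply: mxlimM FA _; exact: mxlim_cst. Qed.
Arguments mxlimMl {m n p F A} B _.

Lemma mxlimMr m n p F (A : 'M[R]_(m, n)) (B : 'M[R]_(p, m)) :
  mxlim F A -> mxlim (fun t => B *m F t) (B *m A).
Proof. by move=> FA; apply: mxlimM FA; exact: mxlim_cst. Qed.
Arguments mxlimMr {m n p F A} B _.

Lemma mxlim_comp m n F (A : 'M[R]_(m, n)) (f : R -> R) :
  f t @[t --> (0 : R)^'] --> (0 : R)^' -> mxlim F A -> mxlim (F \o f) A.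
Proof. by move=> f0 FA a b; exact: cvg_comp f0 (FA a b). Qed.

Lemma mxlim_unique m n F (A B : 'M[R]_(m, n)) : mxlim F A -> mxlim F B -> A = B.
Proof.
by move=> FA FB; apply/matrixP => a b; apply: cvg_unique (FA a b) (FB a b).
Qed.

Lemma mxlim_near m n F G (A : 'M[R]_(m, n)) :
  (\forall t \near (0 : R)^', F t = G t) -> mxlim F A -> mxlim G A.
Proof.
move=> FG FA a b; apply: cvg_trans (FA a b); apply: near_eq_cvg.
by apply: filterS FG => t ->.
Qed.

Lemma near_dnbhs0_neq0 : \forall t \near (0 : R)^', t != 0.
Proof. exact: nbhs_dnbhs_neq. Qed.

Definition path_tangent n (F : R -> 'M[R]_n) (A : 'M[R]_n) :=
  mxlim (fun t => t^-1 *: (F t - 1%:M)) A.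

Lemma path_tangent_cvg n (F : R -> 'M[R]_n) A : path_tangent F A -> mxlim F 1%:M.
Proof.
move=> FA; have t0 : (t : R) @[t --> (0 : R)^'] --> (0 : R).
  by apply: cvg_dnbhs; exact: cvg_id.
have := mxlimD (mxlimZ t0 FA) (@mxlim_cst n n 1%:M).
rewrite scale0r add0r; apply: mxlim_near.
by apply: filterS near_dnbhs0_neq0 => t tn0; rewrite scalerA mulfV // scale1r subrK.
Qed.

Lemma path_tangent_opp n (F : R -> 'M[R]_n) A :
  path_tangent F A -> path_tangent (fun t => F (- t)) (- A).
Proof.
move=> /(mxlim_comp (@dnbhs0_opp R)) h; rewrite -scaleN1r.
have := mxlimZc (-1) h; apply: mxlim_near.
by apply: filterE => t /=; rewrite scalerA invrN mulrN mulN1r opprK.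
Qed.

(** The derivative of conjugation along a path is a commutator. Applied both in SO(N) and in a
    representation, it turns equivariance into bracket relations. *)
Lemma path_tangent_conj n (F : R -> 'M[R]_n) A X : path_tangent F A ->
  mxlim (fun t => t^-1 *: (F t *m X *m F (- t) - X)) (A *m X - X *m A).
Proof.
move=> FA; have FNA := path_tangent_opp FA.
have h1 := mxlimM (mxlimMl X FA) (path_tangent_cvg FNA).
have := mxlimD h1 (mxlimMr X FNA); rewrite mulmx1 mulmxN; apply: mxlim_near.
apply: filterE => t /=; rewrite -!scalemxAl -scalemxAr -scalerDr; congr (_ *: _).
by rewrite !mulmxBl mulmxBr !mul1mx mulmx1 addrA subrK.
Qed.

(** For a one-parameter group F(t) + F(-t) - 2 = (F(t/2) - F(-t/2))^2, so the first derivative alone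
    controls the second difference. *)
Lemma path_tangent_sq n (F : R -> 'M[R]_n) A : path_tangent F A ->
  (forall s t, F (s + t) = F s *m F t) -> F 0 = 1%:M ->
  mxlim (fun t => (t ^+ 2)^-1 *: (F t + F (- t) - 2%:M)) (A *m A).
Proof.
move=> FA FD F0.
have h0 : path_tangent (fun t => F (2^-1 * t)) (2^-1 *: A).
  have n0 : 2^-1 != 0 :> R by rewrite invr_eq0.
  have h := mxlim_comp (dnbhs0_scale n0) FA.
  have := mxlimZc 2^-1 h; apply: mxlim_near.
  by apply: filterE => t /=; rewrite scalerA invfM mulrA divff ?mul1r.
have h1 := mxlimD h0 (mxlimZc (-1) (path_tangent_opp h0)).
have {}h1 : mxlim (fun t => t^-1 *: (F (2^-1 * t) - F (- (2^-1 * t)))) A.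
  have -> : A = 2^-1 *: A + -1 *: - (2^-1 *: A).
    by apply/matrixP => a b; rewrite !mxE; field.
  apply: mxlim_near h1; apply: filterE => t /=.
  rewrite scaleN1r -scalerBr opprB addrA subrK -mulrN //.
have := mxlimM h1 h1; apply: mxlim_near; apply: filterE => t /=.
have F1 : F (2^-1 * t) *m F (- (2^-1 * t)) = 1%:M by rewrite -FD subrr F0.
have F2 : F (- (2^-1 * t)) *m F (2^-1 * t) = 1%:M by rewrite -FD addNr F0.
have tt : t = 2^-1 * t + 2^-1 * t by field.
rewrite -scalemxAl -scalemxAr scalerA -invfM -expr2; congr (_ *: _).
rewrite mulmxBl !mulmxBr F1 F2 -!FD -tt -opprD -tt.
by apply/matrixP => a b; rewrite !mxE; case: eqP => _; rewrite ?mulr1n ?mulr0n; ring.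
Qed.

End MatrixLimits.
Arguments mxlimZc {R m n F} k {A} _.
Arguments mxlimMl {R m n p F A} B _.
Arguments mxlimMr {R m n p F A} B _.
Arguments mxlim_cst {R m n} M.
Arguments path_tangent_conj {R n F A} X _.

(** * Periodic linear flows in the plane *)

Section PlanarFlow.
Variable R : realType.

(** For the fractional part r of b, cos(2 pi r) = 1 forces sin(pi r) = 0, while sin(pi r) > 0 for 0
    < r < 1. *)
Lemma cos_2pi_int (b : R) : cos (2 * pi * b) = 1 -> exists k : int, b = k%:~R.
Proof.
wlog b0 : b / 0 <= b => [h cb|cb].
  have [b0|b0] := leP 0 b; first exact: h.
  have [||k bk] := h (- b); first by rewrite oppr_ge0 ltW.
    by rewrite mulrN cosN.
  by exists (- k); rewrite intrN -bk opprK.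
have := truncn_itv b0; set k := Num.truncn b; set r := b - k%:R => /andP[kb bk].
exists k%:Z; suff : r = 0 by move/eqP; rewrite subr_eq0 => /eqP.
have r1 : r < 1 by rewrite ltrBlDl -(natrD _ k 1) addn1.
have r0 : 0 <= r by rewrite subr_ge0.
have : cos ((pi * r) *+ 2) = 1.
  rewrite -(periodicn (@cosD2pi R) k) -cb; congr cos.
  by rewrite /r -(mulr_natl _ k); ring.
rewrite cos_mulr2n => c1.
have /eqP : sin (pi * r) ^+ 2 = 0 by rewrite sin2cos2; lra.
rewrite sqrf_eq0 => /eqP s0; apply/eqP; rewrite -[_ == _]negbK; apply/negP => rn0.
suff : 0 < sin (pi * r) by rewrite s0 ltxx.
have rp : 0 < r by rewrite lt_neqAle eq_sym rn0.
by apply: sin_gt0_pi; rewrite mulr_gt0 ?pi_gt0 //= gtr_pMr ?pi_gt0.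
Qed.

(** The function z = x + i y solves z' = (a + i b) z. Constancy of |z|^2 exp(- 2 a t) together with
    periodicity gives a = 0; then z exp(- i b t), with real and imaginary parts [u] and [v], is
    constant, whence exp(2 pi i b) = 1. *)
Lemma periodic_planar_flow (x y : R -> R) (a b : R) :
  (forall t, is_derive t (1 : R) x (a * x t - b * y t)) ->
  (forall t, is_derive t (1 : R) y (b * x t + a * y t)) ->
  x (pi *+ 2) = x 0 -> y (pi *+ 2) = y 0 -> x 0 ^+ 2 + y 0 ^+ 2 != 0 ->
  a = 0 /\ exists k : int, b = k%:~R.
Proof.
move=> dx dy xp yp n0.
have a0 : a = 0.
  pose w t := (x t ^+ 2 + y t ^+ 2) * expR (- (2 * a) * t).
  have dw t : is_derive t (1 : R) w 0.
    rewrite /w; have := dx t; have := dy t => ? ?; apply: trigger_derive.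
    rewrite /GRing.scale /= ; ring.
  have : w (pi *+ 2) = w 0 by apply: is_derive_0_is_cst.
  rewrite /w xp yp => /(mulfI n0)/expR_inj.
  move=> e; have /eqP : a * pi = 0 by lra.
  by rewrite mulf_eq0 (gt_eqF (pi_gt0 R)) orbF => /eqP.
split=> //; apply: cos_2pi_int.
pose u t := x t * cos (b * t) + y t * sin (b * t).
pose v t := y t * cos (b * t) - x t * sin (b * t).
have du t : is_derive t (1 : R) u 0.
  rewrite /u; have := dx t; have := dy t; rewrite a0 => ? ?; apply: trigger_derive.
  by rewrite /GRing.scale /=; ring.
have dv t : is_derive t (1 : R) v 0.
  rewrite /v; have := dx t; have := dy t; rewrite a0 => ? ?; apply: trigger_derive.
  by rewrite /GRing.scale /=; ring.
have u0 : u (pi *+ 2) = u 0 by apply: is_derive_0_is_cst.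
have v0 : v (pi *+ 2) = v 0 by apply: is_derive_0_is_cst.
move: u0 v0; rewrite /u /v xp yp mulr0 cos0 sin0 !mulr1 !mulr0 addr0 subr0.
have -> : b * (pi *+ 2) = 2 * pi * b by ring.
set c := cos _; set s := sin _ => e1 e2.
apply: (mulfI n0).
have : x 0 * (x 0 * c + y 0 * s) + y 0 * (y 0 * c - x 0 * s) = x 0 * x 0 + y 0 * y 0.
  by rewrite e1 e2.
by rewrite !expr2 => e; rewrite mulr1 -[RHS]e; ring.
Qed.

End PlanarFlow.

(** * Representations of SO(N) *)

Section OneParameterGroup.
Variables (R : realType) (m : nat) (F : R -> 'M[R]_m) (A : 'M[R]_m).
Hypothesis F_add : forall s t, F (s + t) = F s *m F t.
Hypothesis F_tan : path_tangent F A.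
Hypothesis F_0 : F 0 = 1%:M.

Lemma one_param_derive (p : 'rV[R]_m) (w : 'I_m) (t : R) :
  is_derive t (1 : R) (fun s => (p *m F s) 0 w) ((p *m A *m F t) 0 w).
Proof.
have h : (fun h => h^-1 *: ((p *m F (h *: 1 + t)) 0 w - (p *m F t) 0 w)) @ (0 : R)^'
    --> (p *m A *m F t) 0 w.
  have /(_ 0 w) := mxlimMl (F t) (mxlimMr p F_tan).
  apply: cvg_trans; apply: near_eq_cvg; apply: filterE => s.
  rewrite -scalemxAr -scalemxAl mxE; congr (_ * _).
  by rewrite mulmxBr mulmx1 mulmxBl -mulmxA -F_add [s *: 1]mulr1 !mxE.
by split; [exact: cvgP h|exact: cvg_lim h].
Qed.

Hypothesis F_per : F (pi *+ 2) = 1%:M.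

Local Notation C := (complex R).

(** For an eigenvector v = p + i q, a coordinate of v F(t) that is nonzero at t = 0 solves z' = c z
    and has period 2 pi. *)
Lemma one_param_eigenvalue (c : C) : eigenvalue (map_mx (real_complex R) A) c ->
  exists k : int, c = 'i * k%:~R.
Proof.
case/eigenvalueP => v vA v0.
pose p := map_mx (@complex.Re R) v; pose q := map_mx (@complex.Im R) v.
have [w vw] : exists w, v 0 w != 0 by apply/rV0Pn.
pose a := complex.Re c; pose b := complex.Im c.
have ReS (f : 'I_m -> C) : complex.Re (\sum_k f k) = \sum_k complex.Re (f k).
  by apply: big_morph => // -[? ?] [? ?].
have ImS (f : 'I_m -> C) : complex.Im (\sum_k f k) = \sum_k complex.Im (f k).
  by apply: big_morph => // -[? ?] [? ?].
have pA : p *m A = a *: p - b *: q.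
  apply/rowP => j; have /rowP/(_ j) := vA; rewrite !mxE => /(congr1 (@complex.Re R)).
  rewrite ReS => e; transitivity (complex.Re (c * v 0 j)).
    rewrite -e; apply: eq_bigr => k _; rewrite !mxE.
    by case: (v 0 k) => x y /=; rewrite mulr0 subr0.
  by rewrite /a /b; case: (c) (v 0 j) => [? ?] [? ?].
have qA : q *m A = b *: p + a *: q.
  apply/rowP => j; have /rowP/(_ j) := vA; rewrite !mxE => /(congr1 (@complex.Im R)).
  rewrite ImS => e; transitivity (complex.Im (c * v 0 j)).
    rewrite -e; apply: eq_bigr => k _; rewrite !mxE.
    by case: (v 0 k) => x y /=; rewrite mulr0 add0r.
  by rewrite /a /b; case: (c) (v 0 j) => [? ?] [? ?] /=; rewrite addrC.
have [||||| a0 [k bk]] := @periodic_planar_flow R (fun t => (p *m F t) 0 w)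
   (fun t => (q *m F t) 0 w) a b.
- move=> t; have := one_param_derive p w t; rewrite pA mulmxBl -!scalemxAl.
  by rewrite !mxE.
- move=> t; have := one_param_derive q w t; rewrite qA mulmxDl -!scalemxAl.
  by rewrite !mxE.
- by rewrite F_per F_0.
- by rewrite F_per F_0.
- rewrite F_0 !mulmx1 !mxE; apply: contraNneq vw => /eqP.
  rewrite paddr_eq0 ?sqr_ge0 // !sqrf_eq0; case: (v 0 w) => x y /=.
  by move=> /andP[/eqP -> /eqP ->].
exists k; rewrite [c]complexE -/a -/b a0 bk complexiE rmorph0 add0r.
by rewrite rmorph_int.
Qed.

End OneParameterGroup.

(** * The differential of a representation and its Casimir operator *)

Section Representation.
Variables (R : realType) (N m : nat) (D : 'M[R]_N -> 'M[R]_m).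
Notation d := (dimSO N).
Hypothesis D1 : D 1%:M = 1%:M.
Hypothesis DM : forall g h, SO g -> SO h -> D (g *m h) = D g *m D h.
Variable B : 'I_d -> 'M[R]_m.
Hypothesis D_tan : forall x : 'rV[R]_d,
  path_tangent (fun t => D (cay (t *: skew x))) (\sum_k x 0 k *: B k).

(** The differential of [D] at the identity. Only entries above the diagonal are read; they
    determine a skew matrix, and the map becomes linear on all matrices. *)
Definition dD (X : 'M[R]_N) : 'M[R]_m := \sum_k X (plane k).1 (plane k).2 *: B k.

Lemma dDD X Y : dD (X + Y) = dD X + dD Y.
Proof. by rewrite -big_split; apply: eq_bigr => k _; rewrite mxE scalerDl. Qed.

Lemma dDZ c X : dD (c *: X) = c *: dD X.
Proof. by rewrite scaler_sumr; apply: eq_bigr => k _; rewrite mxE scalerA. Qed.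

HB.instance Definition _ := GRing.isSemilinear.Build R 'M[R]_N 'M[R]_m _ dD
  (dDZ, dDD).

Lemma dD_tangent X : X^T = - X -> path_tangent (fun t => D (cay (t *: X))) (dD X).
Proof.
move=> Xt; have := @D_tan (coords X); rewrite skew_coords //.
by congr (path_tangent _ _); apply: eq_bigr => k _; rewrite mxE.
Qed.

(** Since g Cay(t X) g^T = Cay(t g X g^T), both sides are the tangent of one path. *)
Lemma dD_conj g X : SO g -> X^T = - X -> D g *m dD X *m D g^T = dD (g *m X *m g^T).
Proof.
move=> gS Xt; have gtS := SO_tr gS.
have Yt : (g *m X *m g^T)^T = - (g *m X *m g^T).
  by rewrite !trmx_mul trmxK Xt mulNmx mulmxN mulmxA.
apply: mxlim_unique (dD_tangent Yt).
have := mxlimMl (D g^T) (mxlimMr (D g) (dD_tangent Xt)); apply: mxlim_near.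
apply: filterE => t; rewrite -scalemxAr -scalemxAl; congr (_ *: _).
have tXt : (t *: X)^T = - (t *: X) by rewrite linearZ /= Xt scalerN.
have cS := SO_cay tXt; have gcS := SO_mul gS cS.
rewrite mulmxBr mulmxBl mulmx1 -!DM // SO_mulVr // D1.
by rewrite SO_conj_cay // -scalemxAr -scalemxAl.
Qed.

(** The rotation by t is the Cayley path at parameter [tau t], and tau(t)/t tends to 1. *)
Lemma rot_tangent i j : i != j -> path_tangent (fun t => D (rot i j t)) (dD (gen R i j)).
Proof.
move=> ij.
have h := mxlimZ (@tau_quotient R) (mxlim_comp (@tau_dnbhs R) (dD_tangent (tr_gen R i j))).
rewrite scale1r in h; apply: mxlim_near h.
have tne : \forall t \near (0 : R)^', tau t != 0.
  by have := @tau_dnbhs R _ (near_dnbhs0_neq0 R).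
apply: filterS2 tne (near_cosD1 R) => t t0 c0 /=.
by rewrite scalerA -mulrA divff // mulr1 rot_cay.
Qed.

Lemma rot_path_tangent (i j : 'I_N) : path_tangent (rot i j) (gen R i j).
Proof.
have h1 := mxlimZ (@sin_quotient R) (mxlim_cst (gen R i j)).
have h2 := mxlimZ (@cos_quotient R) (mxlim_cst (delta_mx i i + delta_mx j j : 'M[R]_N)).
have := mxlimD h1 h2; rewrite scale1r scale0r addr0; apply: mxlim_near.
by apply: filterE => t /=; apply/matrixP => a b; rewrite !mxE; ring.
Qed.

Lemma mxlim_dD F X : mxlim F X -> mxlim (fun t => dD (F t)) (dD X).
Proof.
move=> FX; apply: mxlim_sum => k _; apply: mxlimZ (mxlim_cst _).
exact: FX.
Qed.

(** The derivative of [dD_conj] along the rotations g = [rot i j t] at t = 0. *)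
Lemma dD_bracket i j X : i != j -> X^T = - X ->
  dD (gen R i j) *m dD X - dD X *m dD (gen R i j) = dD (gen R i j *m X - X *m gen R i j).
Proof.
move=> ij Xt.
have h1 := path_tangent_conj (dD X) (rot_tangent ij).
have h2 := mxlim_dD (path_tangent_conj X (@rot_path_tangent i j)).
apply: (mxlim_unique h1); apply: mxlim_near h2; apply: filterE => t.
rewrite linearZ linearB /=; congr (_ *: (_ - _)).
by rewrite -tr_rot // dD_conj //; exact: SO_rot.
Qed.

Lemma gen_bracket (i j k l : 'I_N) :
  gen R i j *m gen R k l - gen R k l *m gen R i j =
  gen R i l *+ (j == k) - gen R i k *+ (j == l) - gen R j l *+ (i == k)
  + gen R j k *+ (i == l).
Proof.
have dm (a b c e : 'I_N) :
    delta_mx a b *m delta_mx c e = delta_mx a e *+ (b == c) :> 'M[R]_N.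
  by case: eqP => [->|/eqP bc]; rewrite ?mul_delta_mx ?mul_delta_mx_0.
rewrite /gen !mulmxBl !mulmxBr !dm ![k == _]eq_sym ![l == _]eq_sym.
by case: (j == k); case: (j == l); case: (i == k); case: (i == l);
  rewrite ?mulr1n ?mulr0n; apply/matrixP => a b; rewrite !mxE; ring.
Qed.

Lemma dD_comm (i j k l : 'I_N) :
  dD (gen R i j) *m dD (gen R k l) - dD (gen R k l) *m dD (gen R i j) =
  dD (gen R i l) *+ (j == k) - dD (gen R i k) *+ (j == l)
  - dD (gen R j l) *+ (i == k) + dD (gen R j k) *+ (i == l).
Proof.
(* For i = j the matrices [rot i j t] are not rotations, but the generator is 0. *)
have [->|ij] := eqVneq i j; last first.
  by rewrite dD_bracket ?tr_gen // gen_bracket !(raddfD, raddfB, raddfMn) /= !raddfN.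
have -> : gen R j j = 0 by rewrite /gen subrr.
rewrite linear0 mul0mx mulmx0 subrr.
move: (dD (gen R j l)) (dD (gen R j k)) => X Y.
by apply/matrixP => a b; rewrite !mxE; ring.
Qed.

Variable mu : R.
Hypothesis D_casimir : mxlim (fun t => (t ^+ 2)^-1 *: \sum_k
  (D (rot (plane k).1 (plane k).2 t) + D (rot (plane k).1 (plane k).2 (- t)) - 2%:M))
  (- mu)%:M.

Lemma rot_group i j : i != j ->
  forall s t, D (rot i j (s + t)) = D (rot i j s) *m D (rot i j t).
Proof. by move=> ij s t; rewrite rotD // DM //; exact: SO_rot. Qed.

Lemma dD_casimir :
  \sum_(i < N) \sum_(j < N | (i < j)%N) dD (gen R i j) *m dD (gen R i j) = (- mu)%:M.
Proof.
rewrite -(sum_planes (fun i j => dD (gen R i j) *m dD (gen R i j))).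
apply: mxlim_unique D_casimir.
have := @mxlim_sum _ _ _ xpredT _ _ _ _ (fun (k : 'I_d) _ => path_tangent_sq
  (rot_tangent (plane_neq k)) (rot_group (plane_neq k)) _).
move=> /(_ (index_enum _)) h; apply: mxlim_near (h _).
  by apply: filterE => t; rewrite scaler_sumr.
by move=> k; rewrite rot0 D1.
Qed.

Theorem casimir_int : (0 < m)%N -> exists k : int, mu = k%:~R.
Proof.
move=> m0; pose A i j := map_mx (real_complex R) (dD (gen R i j)).
have [|i j|i j c||k muk] := @casimir_scalar_int _ m N A _ _ _ (real_complex R (- mu)) m0.
- move=> i j k l; rewrite /A -!map_mxM -map_mxB dD_comm.
  rewrite !map_mxD.
  by case: (j == k); case: (j == l); case: (i == k); case: (i == l);
    rewrite ?mulr1n ?mulr0n ?oppr0 ?map_mx0 ?map_mxN ?oppr0.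
- by rewrite /A gen_anti linearN /= map_mxN.
- have [->|ij] := eqVneq i j.
    rewrite /A /gen subrr linear0 map_mx0 => /eigenvalueP[v].
    rewrite mulmx0 => /esym/eqP; rewrite scaler_eq0 => /orP[/eqP -> _|/eqP ->].
      by exists 0; rewrite mulr0.
    by rewrite eqxx.
  apply: one_param_eigenvalue (rot_group ij) (rot_tangent ij) _ _ _.
    by rewrite rot0 D1.
  by rewrite rot_2pi D1.
- rewrite /partial_casimir -map_scalar_mx -dD_casimir raddf_sum; apply: eq_bigr => i _.
  by rewrite raddf_sum; apply: eq_bigr => j _; rewrite /= map_mxM.
exists (- k); apply: oppr_inj; rewrite intrN opprK.
by apply: complexI; rewrite muk rmorph_int.
Qed.

End Representation.

(** * Spectral functions and the coupling argument *)

Section MatrixTopology.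
Variable R : realType.

Lemma cvg_mx_entry (T : Type) (F : set_system T) {FF : Filter F} m n
    (f : T -> 'M[R]_(m, n)) (M : 'M[R]_(m, n)) :
  (forall i j, f x i j @[x --> F] --> M i j) -> f x @[x --> F] --> M.
Proof.
move=> fM; apply/cvgrPdist_le => /= e e0; near=> x.
rewrite [leLHS]/Num.Def.normr/= mx_normrE (bigmax_le _ (ltW e0))//= => i _.
rewrite !mxE/=; move: i; near: x; apply: filter_forall => /= i.
exact: ((cvgrPdist_le _ _).1 (fM i.1 i.2)).
Unshelve. all: by end_near. Qed.

Lemma cvg_entry (T : Type) (F : set_system T) {FF : Filter F} m n
    (f : T -> 'M[R]_(m, n)) (M : 'M[R]_(m, n)) i j :
  f x @[x --> F] --> M -> f x i j @[x --> F] --> M i j.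
Proof.
move=> fM; exact: cvg_comp fM (@coord_continuous R m n i j M).
Qed.

Lemma cvg_mulmx (T : Type) (F : set_system T) {FF : Filter F} m n p
    (f : T -> 'M[R]_(m, n)) (g : T -> 'M[R]_(n, p)) (A : 'M[R]_(m, n)) (B : 'M[R]_(n, p)) :
  f x @[x --> F] --> A -> g x @[x --> F] --> B ->
  f x *m g x @[x --> F] --> A *m B.
Proof.
move=> fA gB; apply: cvg_mx_entry => i j; rewrite mxE; under eq_fun do rewrite mxE.
by apply: cvg_sum => k _; apply: cvgM; apply: cvg_entry.
Qed.

Lemma cvg_trmx (T : Type) (F : set_system T) {FF : Filter F} m n
    (f : T -> 'M[R]_(m, n)) (A : 'M[R]_(m, n)) : f x @[x --> F] --> A -> (f x)^T @[x --> F] --> A^T.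
Proof.
move=> fA; apply: cvg_mx_entry => i j; rewrite mxE; under eq_fun do rewrite mxE.
exact: cvg_entry.
Qed.

Lemma cvg_det (T : Type) (F : set_system T) {FF : Filter F} n
    (f : T -> 'M[R]_n) (A : 'M[R]_n) : f x @[x --> F] --> A -> \det (f x) @[x --> F] --> \det A.
Proof.
move=> fA; apply: cvg_sum => s _; apply: cvgM; first exact: cvg_cst.
by apply: cvg_prod => i _; exact: cvg_entry.
Qed.

(** Near an invertible limit the inverse is given by the adjugate formula, a rational expression in
    the entries. *)
Lemma cvg_invmx (T : Type) (F : set_system T) {FF : Filter F} n
    (f : T -> 'M[R]_n) (A : 'M[R]_n) : A \in unitmx ->
  f x @[x --> F] --> A -> invmx (f x) @[x --> F] --> invmx A.
Proof.
move=> uA fA; have dA : \det (f x) @[x --> F] --> \det A by exact: cvg_det.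
have A0 : \det A != 0 by rewrite -unitfE -unitmxE.
have h : (\det (f x))^-1 *: \adj (f x) @[x --> F] --> (\det A)^-1 *: \adj A.
  apply: cvg_mx_entry => i j; rewrite mxE; under eq_fun do rewrite mxE.
  apply: cvgM; first exact: (cvgV A0 dA).
  rewrite mxE; under eq_fun do rewrite mxE.
  apply: cvgM; first exact: cvg_cst.
  apply: cvg_det; apply: cvg_mx_entry => a b; rewrite !mxE.
  by under eq_fun do rewrite !mxE; exact: cvg_entry.
rewrite {2}/invmx uA; apply: cvg_trans h; apply: near_eq_cvg.
have : \forall x \near F, \det (f x) != 0 by exact: cvgr_neq0 dA A0.
by apply: filterS => x d0; rewrite /invmx unitmxE unitfE d0.
Qed.

Variable N : nat.

Lemma SO_closed : closed (@SO R N).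
Proof.
have -> : @SO R N = (fun g : 'M[R]_N => g^T *m g) @^-1` [set 1%:M] `&`
    (fun g : 'M[R]_N => \det g) @^-1` [set 1].
  by apply/seteqP; split => g [].
have c1 (V : normedModType R) (x : V) : closed [set x].
  by apply: accessible_closed_set1; apply: hausdorff_accessible; exact: norm_hausdorff.
apply: closedI.
  apply: closed_comp => [g _|]; last exact: c1.
  apply: (@cvg_mulmx _ (nbhs g) _ N N N (fun x => x^T) (fun x => x)); last exact: cvg_id.
  by apply: (@cvg_trmx _ (nbhs g) _ N N (fun x => x)); exact: cvg_id.
apply: closed_comp => [g _|]; last exact: (c1 R^o).
by apply: (@cvg_det _ (nbhs g) _ N (fun x => x)); exact: cvg_id.
Qed.

Lemma SO_entry (g : 'M[R]_N) i j : SO g -> `|g i j| <= 1.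
Proof.
move=> [go _]; rewrite -[leRHS]normr1 -ler_sqr ?nnegrE // ?normr_ge0 //.
have /matrixP/(_ j j) := go; rewrite !mxE eqxx mulr1n normr1 expr1n => <-.
rewrite (bigD1 i) //= mxE -normrX ger0_norm ?sqr_ge0 // expr2 lerDl.
by apply: sumr_ge0 => k _; rewrite mxE -expr2 sqr_ge0.
Qed.

Lemma SO_compact : compact (@SO R N).
Proof.
pose B := [set v : 'rV[R]_(N * N) | forall i, v ord0 i \in `[(-1), 1]].
have cB : compact B.
  apply: (@rV_compact R (N * N) (fun=> `[(-1 : R), 1]%classic)) => _.
  exact: segment_compact.
have cvec : continuous (vec_mx : 'rV[R]_(N * N) -> 'M[R]_N).
  move=> v; apply: (@cvg_mx_entry _ (nbhs v) _ N N vec_mx) => i j.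
  by rewrite mxE; under eq_fun do rewrite mxE; exact: coord_continuous.
have cV : compact (vec_mx @` B).
  by apply: continuous_compact cB; exact: continuous_subspaceT.
apply: subclosed_compact SO_closed cV _ => g gS.
exists (mxvec g); last by rewrite mxvecK.
move=> k; case/mxvec_indexP: k => i j; rewrite mxvecE in_itv /= -ler_norml.
exact: SO_entry.
Qed.

End MatrixTopology.

Section SpectralFunctions.
Variables (R : realType) (N : nat).
Notation d := (dimSO N).
Implicit Types (f : 'M[R]_N -> R) (g h a b : 'M[R]_N) (k : 'I_d) (s t : R).

Definition prot k t : 'M[R]_N := rot (plane k).1 (plane k).2 t.

Lemma SO_prot k t : SO (prot k t).
Proof. exact: SO_rot (plane_neq k) t. Qed.

Lemma protD k s t : prot k (s + t) = prot k s *m prot k t.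
Proof. exact: rotD (plane_neq k) s t. Qed.

Lemma prot0 k : prot k 0 = 1%:M. Proof. exact: rot0. Qed.

Definition second_diff f g h k t : R :=
  f (g *m prot k t *m h) + f (g *m prot k (- t) *m h) - 2 * f (g *m h).

(* What is used of an eigenfunction [f]: continuity on SO(N), the eigenvalue
   equation with the Laplacian written as a limit of second differences along
   plane rotations, and differentiability at the points of SO(N) in the Cayley
   charts. These properties are stable under two-sided translations. *)
Definition spectral (mu : R) f : Prop :=
  [/\ {within @SO R N, continuous f},
   forall g h, SO g -> SO h ->
    (t ^+ 2)^-1 * (\sum_k second_diff f g h k t) @[t --> (0 : R)^'] --> - mu * f (g *m h) &
   forall g h, SO g -> SO h -> exists c : 'I_d -> R, forall x : 'rV[R]_d,
    t^-1 * (f (g *m cay (t *: skew x) *m h) - f (g *m h)) @[t --> (0 : R)^'] -->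
    \sum_k x 0 k * c k].

Lemma cvg_withinP (T : Type) (F : set_system T) {FF : Filter F} (U : topologicalType)
    (phi : T -> U) (A : set U) (y : U) :
  phi x @[x --> F] --> y -> (\forall x \near F, A (phi x)) ->
  phi x @[x --> F] --> within A (nbhs y).
Proof.
move=> phiy FA B; rewrite /within /= => /phiy; apply: filterS2 FA => x Ax; exact.
Qed.

Lemma within_SO_cvg f (T : Type) (F : set_system T) {FF : Filter F}
    (phi : T -> 'M[R]_N) g : {within @SO R N, continuous f} -> SO g ->
  phi x @[x --> F] --> g -> (\forall x \near F, SO (phi x)) ->
  f (phi x) @[x --> F] --> f g.
Proof.
move=> /subspace_continuousP cf gS phig FS.
exact: cvg_comp (cvg_withinP phig FS) (cf g gS).
Qed.

(** At g x h the translated function is [f] at (a g) x (h b). This is why [spectral] is stated with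
    a factor on either side of the moving rotation. *)
Lemma spectral_trans mu f a b : spectral mu f -> SO a -> SO b ->
  spectral mu (fun g => f (a *m g *m b)).
Proof.
move=> [f1 f2 f3] aS bS; have e g h x : a *m (g *m x *m h) *m b = (a *m g) *m x *m (h *m b).
  by rewrite !mulmxA.
have e' g h : a *m (g *m h) *m b = (a *m g) *m (h *m b) by rewrite !mulmxA.
split.
- apply/subspace_continuousP => g gS.
  apply: (within_SO_cvg f1); first by do 2 apply: SO_mul => //.
    apply: cvg_mulmx; last exact: cvg_cst.
    by apply: cvg_mulmx; [exact: cvg_cst|exact: cvg_within].
  by apply: filterS (withinT _ _) => x xS; do 2 apply: SO_mul => //.
- move=> g h gS hS; have := f2 (a *m g) (h *m b) (SO_mul aS gS) (SO_mul hS bS).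
  by rewrite /second_diff; under eq_fun do under eq_bigr do rewrite -!e -e'; rewrite -e'.
- move=> g h gS hS; have [c cP] := f3 (a *m g) (h *m b) (SO_mul aS gS) (SO_mul hS bS).
  by exists c => x; have := cP x; under eq_fun do rewrite -!e -e'.
Qed.

Lemma spectralD mu f1 f2 : spectral mu f1 -> spectral mu f2 ->
  spectral mu (fun g => f1 g + f2 g).
Proof.
move=> [c1 l1 t1] [c2 l2 t2]; split.
- apply/subspace_continuousP => g gS.
  have h1 := (subspace_continuousP _ _).1 c1 g gS.
  have h2 := (subspace_continuousP _ _).1 c2 g gS.
  have h : (f1 x + f2 x) @[x --> within (@SO R N) (nbhs g)] --> f1 g + f2 g.
    exact: cvgD.
  exact: h.
- move=> g h gS hS; apply: cvg_ext (cvgD (l1 g h gS hS) (l2 g h gS hS)) _ _ => [t|].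
    rewrite -mulrDr -big_split; congr (_ * _); apply: eq_bigr => k _.
    by rewrite /second_diff /=; ring.
  by rewrite mulrDr.
- move=> g h gS hS; have [c cP] := t1 g h gS hS; have [c' cP'] := t2 g h gS hS.
  exists (fun k => c k + c' k) => x; apply: cvg_ext (cvgD (cP x) (cP' x)) _ _ => [t|].
    by rewrite /=; ring.
  by rewrite -big_split; apply: eq_bigr => k _; rewrite /= mulrDr.
Qed.

Lemma spectralZ mu f z : spectral mu f -> spectral mu (fun g => z * f g).
Proof.
move=> [c1 l1 t1]; split.
- apply/subspace_continuousP => g gS.
  have h1 := (subspace_continuousP _ _).1 c1 g gS.
  have h : (z * f x) @[x --> within (@SO R N) (nbhs g)] --> z * f g.
    by apply: cvgM => //; exact: cvg_cst.
  exact: h.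
- move=> g h gS hS; apply: cvg_ext (cvgM (cvg_cst z) (l1 g h gS hS)) _ _ => [t|].
    rewrite mulrCA; congr (_ * _); rewrite mulr_sumr; apply: eq_bigr => k _.
    by rewrite /second_diff /=; ring.
  by rewrite mulrCA.
- move=> g h gS hS; have [c cP] := t1 g h gS hS.
  exists (fun k => z * c k) => x; apply: cvg_ext (cvgM (cvg_cst z) (cP x)) _ _ => [t|].
    by rewrite /=; ring.
  by rewrite mulr_sumr; apply: eq_bigr => k _; rewrite mulrCA.
Qed.

End SpectralFunctions.

(** * Lipschitz bound along plane rotations *)

Section Coupling.
Variables (R : realType) (N : nat).
Notation d := (dimSO N).
Implicit Types (f : 'M[R]_N -> R) (g h a b : 'M[R]_N) (k : 'I_d) (s t : R).

(** A concave modulus with psi(0) = 0, psi'' = - 1 and psi(1) = 3/2, increasing on [0, 1]. Its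
    second difference with step 2 s is exactly - 4 s^2. *)
Definition psi (t : R) : R := 2 * t - t ^+ 2 / 2.

Lemma cvg_prot k (T : Type) (F : set_system T) {FF : Filter F} (phi : T -> R) t :
  phi x @[x --> F] --> t -> prot k (phi x) @[x --> F] --> prot k t.
Proof.
move=> phit; have st : sin (phi x) @[x --> F] --> sin t.
  exact: cvg_comp phit (@continuous_sin R t).
have ct : cos (phi x) @[x --> F] --> cos t.
  exact: cvg_comp phit (@continuous_cos R t).
apply: cvg_mx_entry => i j; rewrite !mxE.
under eq_fun do rewrite !mxE.
apply: cvgD; first apply: cvgD; first exact: cvg_cst.
  by apply: cvgM => //; exact: cvg_cst.
apply: cvgM; last exact: cvg_cst.
by apply: cvgB => //; exact: cvg_cst.
Qed.

Lemma near0_le_limit (F : R -> R) (l : R) : F t @[t --> (0 : R)^'] --> l ->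
  (\forall t \near (0 : R)^', F t <= 0) -> l <= 0.
Proof.
move=> Fl F0; rewrite leNgt; apply/negP => l0.
have h : \forall t \near (0 : R)^', 0 < F t by exact: cvgr_gt _ Fl _ l0.
have [t [/= t1 t2]] : exists t, 0 < F t /\ F t <= 0.
  by apply: (@filter_ex _ (0 : R)^'); apply: filterS2 h F0 => t; split.
by move: (lt_le_trans t1 t2); rewrite ltxx.
Qed.

(* Coupling argument. At an interior maximum of
   [f (g R(t)) - f g - K psi t] move [g] and [g R(t)] in parallel in all planes
   except the plane of [R], in which they are moved apart; the concavity of [psi]
   contradicts the eigenvalue equation. *)
Lemma coupling mu f M k : spectral mu f -> 0 < M ->
  (forall g, SO g -> `|f g| <= M) -> forall g t, SO g -> 0 <= t <= 1 ->
  f (g *m prot k t) - f g <= (2 * `|mu| + 2) * M * psi t.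
Proof.
(* The constant serves twice: K psi(1) >= 3 M rules out a positive maximum at t = 1, and 4 K exceeds
   the bound 2 M |mu| for the eigenvalue terms at an interior maximum. *)
move=> sf M0 fM; set K := (2 * `|mu| + 2) * M.
have K0 : 0 < K by rewrite /K mulr_gt0 // ltr_wpDl ?mulr_ge0.
pose Psi (p : 'M[R]_N * R) := f (p.1 *m prot k p.2) - f p.1 - K * psi p.2.
pose D := @SO R N `*` `[(0 : R), 1]%classic.
have cD : compact D by apply: compact_setX; [exact: SO_compact|exact: segment_compact].
have D0 : D !=set0.
  by exists (1%:M, 0); split; [exact: SO1|rewrite /= in_itv /= lexx ler01].
have [f1 f2 _] := sf.
have cPsi : {within D, continuous Psi}.
  apply/subspace_continuousP => -[g t] /= [gS tI].
  have near_D : \forall p \near within D (nbhs (g, t)), D p by exact: withinT.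
  have cid : (p : _ * _) @[p --> within D (nbhs (g, t))] --> (g, t) by exact: cvg_within.
  have c1 : p.1 @[p --> within D (nbhs (g, t))] --> g by exact: cvg_comp cid cvg_fst.
  have c2 : p.2 @[p --> within D (nbhs (g, t))] --> t by exact: cvg_comp cid cvg_snd.
  have h1 : f (p.1 *m prot k p.2) @[p --> within D (nbhs (g, t))] --> f (g *m prot k t).
    apply: within_SO_cvg f1 (SO_mul gS (SO_prot k t)) _ _.
      by apply: cvg_mulmx => //; exact: cvg_prot.
    by apply: filterS near_D => p [pS _]; apply: SO_mul (SO_prot k _).
  have h2 : f p.1 @[p --> within D (nbhs (g, t))] --> f g.
    by apply: within_SO_cvg f1 gS c1 _; apply: filterS near_D => p [].
  have h3 : (K * psi p.2) @[p --> within D (nbhs (g, t))] --> K * psi t.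
    apply: cvgM; first exact: cvg_cst.
    apply: cvgB; first by apply: cvgM => //; exact: cvg_cst.
    apply: cvgM; last exact: cvg_cst.
    by rewrite expr2; under eq_fun do rewrite expr2; exact: cvgM.
  have h : (f (p.1 *m prot k p.2) - f p.1 - K * psi p.2)
      @[p --> within D (nbhs (g, t))] --> f (g *m prot k t) - f g - K * psi t.
    by apply: cvgB => //; exact: cvgB.
  exact: h.
have [[g t] gtD max] := compact_EVT_max D0 cD cPsi.
move: gtD; rewrite inE => -[/= gS]; rewrite in_itv /= => /andP[t0 t1].
suff le0 : Psi (g, t) <= 0.
  move=> g' t' g'S t'I; rewrite -subr_le0.
  apply: le_trans le0; apply: (max (g', t')); rewrite inE; split => //=.
rewrite leNgt; apply/negP => pos.
have tp : 0 < t.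
  rewrite lt_neqAle t0 andbT; apply: contraTneq pos => <-.
  by rewrite /Psi /= prot0 mulmx1 subrr sub0r /psi mulr0 expr0n mul0r subrr mulr0 oppr0 ltxx.
have tl : t < 1.
  rewrite lt_neqAle t1 andbT; apply: contraTneq pos => ->.
  rewrite -leNgt /Psi /= /psi.
  have := fM _ (SO_mul gS (SO_prot k 1)); have := fM _ gS.
  rewrite !ler_norml => /andP[a1 a2] /andP[b1 b2].
  have : 3 * M <= K * (3 / 2).
    by rewrite /K; have := normr_ge0 mu => m0; nra.
  rewrite mulr1 expr1n; nra.
pose a x := f (x *m prot k t).
have sa : spectral mu a.
  have := spectral_trans sf (@SO1 R N) (SO_prot k t).
  by rewrite /a; congr spectral; apply/funext => x; rewrite mul1mx.
have [_ a2 _] := sa.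
have L1 := a2 g 1%:M gS (@SO1 R N); have L2 := f2 g 1%:M gS (@SO1 R N).
have L : (s ^+ 2)^-1 * (\sum_l second_diff a g 1%:M l s)
   - (s ^+ 2)^-1 * (\sum_l second_diff f g 1%:M l s) + 4 * K @[s --> (0 : R)^'] -->
   - mu * a (g *m 1%:M) - - mu * f (g *m 1%:M) + 4 * K.
  by apply: cvgD; [exact: cvgB|exact: cvg_cst].
have {}L : - mu * a (g *m 1%:M) - - mu * f (g *m 1%:M) + 4 * K <= 0.
  apply: near0_le_limit L _.
  (* This keeps t + 2 s and t - 2 s inside [0, 1]. *)
  have tn : \forall s \near (0 : R)^', `|s| < Num.min (t / 2) ((1 - t) / 2).
    by apply: dnbhs0_lt; rewrite lt_min !divr_gt0 // subr_gt0.
  have n0 := near_dnbhs0_neq0 R.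
  apply: filterS2 tn n0 => s; rewrite lt_min !ltr_norml => /andP[/andP[s1 s2] /andP[s3 s4]] sn0.
  have step l : second_diff a g 1%:M l s - second_diff f g 1%:M l s
     <= (if l == k then - (4 * K * s ^+ 2) else 0).
    rewrite /second_diff !mulmx1; case: eqP => [->|_].
      (* Rotations in one plane commute: the pair g R(-s), g R(t + s) again has the form x, x R(t +
         2 s), and likewise inwards with t - 2 s. *)
      have m1 := max (g *m prot k (- s), t + 2 * s).
      have m2 := max (g *m prot k s, t - 2 * s).
      have /m1 : (g *m prot k (- s), t + 2 * s) \in D.
        rewrite inE; split=> /=; first exact: SO_mul (SO_prot _ _).
        by rewrite in_itv /=; lra.
      have /m2 : (g *m prot k s, t - 2 * s) \in D.
        rewrite inE; split=> /=; first exact: SO_mul (SO_prot _ _).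
        by rewrite in_itv /=; lra.
      rewrite /Psi /= -!mulmxA -!protD.
      have -> : s + (t - 2 * s) = - s + t by ring.
      have -> : - s + (t + 2 * s) = s + t by ring.
      rewrite !protD !mulmxA -/(a _) -/(a (g *m prot k s)) -/(a g) /psi.
      set A1 := a (g *m prot k s); set A2 := a (g *m prot k (- s)).
      set F1 := f (g *m prot k s); set F2 := f (g *m prot k (- s)).
      lra.
    have lS s' : (g *m prot l s', t) \in D.
      by rewrite inE; split=> /=; [exact: SO_mul (SO_prot _ _)|rewrite in_itv /=; lra].
    have /= := max _ (lS s); have /= := max _ (lS (- s)).
    rewrite /Psi /= -/(a _) -/(a (g *m prot l s)) -/(a g).
    lra.
  rewrite -mulrBr -sumrB -lerBrDr sub0r.
  rewrite mulrC ler_pdivrMr ?exprn_even_gt0 //.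
  apply: le_trans (ler_sum _ (fun l _ => step l)) _.
  rewrite -big_mkcond /= big_pred1_eq; lra.
move: L; rewrite !mulmx1.
have := fM _ (SO_mul gS (SO_prot k t)); have := fM _ gS; rewrite -/(a g).
move=> fb ab.
have mb : mu * (a g - f g) <= `|mu| * (2 * M).
  apply: le_trans (ler_norm _) _; rewrite normrM ler_wpM2l //.
  by apply: le_trans (ler_normB _ _) _; lra.
have := normr_ge0 mu => m0; rewrite /K; nra.
Qed.

(** [coupling] is applied to f and - f translated by [b], and psi t <= 2 t doubles the constant. A
    negative angle is reduced to a positive one by exchanging the two end points. *)
Lemma spectral_lipschitz mu f M k a b t : spectral mu f -> 0 < M ->
  (forall g, SO g -> `|f g| <= M) -> SO a -> SO b -> `|t| <= 1 ->
  `|f (a *m prot k t *m b) - f (a *m b)| <= (4 * `|mu| + 4) * M * `|t|.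
Proof.
move=> sf M0 fM aS bS t1.
wlog t0 : t a t1 aS / 0 <= t => [H|].
  have [t0|t0] := leP 0 t; first exact: H.
  have := H (- t) (a *m prot k t); rewrite normrN -!mulmxA (mulmxA (prot k t)) -protD.
  rewrite subrr prot0 mul1mx distrC oppr_ge0 => -> //; last exact: ltW.
  exact: SO_mul (SO_prot _ _).
have main z : `|z| = 1 -> z * (f (a *m prot k t *m b) - f (a *m b)) <=
    (4 * `|mu| + 4) * M * t.
  move=> z1.
  have sfz := spectralZ z (spectral_trans sf (@SO1 R N) bS).
  have zM g : SO g -> `|z * f (1%:M *m g *m b)| <= M.
    by move=> gS; rewrite normrM z1 mul1r mul1mx fM //; exact: SO_mul.
  have tI : 0 <= t <= 1 by rewrite t0 -(ger0_norm t0).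
  have := coupling k sfz M0 zM aS tI; rewrite !mul1mx -mulrBr => h.
  apply: le_trans h _; rewrite /psi.
  have := normr_ge0 mu => m0; have t2 := sqr_ge0 t.
  have : 0 <= (2 * `|mu| + 2) * M * (t ^+ 2 / 2).
    by rewrite !mulr_ge0 ?invr_ge0 // ?addr_ge0 ?mulr_ge0 // ltW.
  lra.
rewrite (ger0_norm t0) ler_norml; have := main 1 (normr1 _); have := main (-1).
by rewrite normrN1 mulN1r mul1r => /(_ erefl) h1 h2; rewrite h2 andbT lerNl.
Qed.

End Coupling.

(** * Givens rotations and finite dimension *)

Section Givens.
Variables (R : realType) (N : nat).
Notation d := (dimSO N).
Implicit Types (f : 'M[R]_N -> R) (g h a b : 'M[R]_N) (k : 'I_d) (s t : R).

Lemma polar (c s : R) : c ^+ 2 + s ^+ 2 = 1 ->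
  exists t, [/\ 0 <= t <= pi *+ 2, cos t = c & sin t = s].
Proof.
move=> cs; have c1 : -1 <= c <= 1.
  by rewrite -ler_norml -(expr_le1 (n := 2)) // real_normK ?num_real //; have := sqr_ge0 s; lra.
have a0 := acos_ge0 c1; have a1 := acos_lepi c1; have p0 := pi_ge0 R.
have sa : sin (acos c) = `|s| by rewrite sin_acos // -sqrtr_sqr; congr Num.sqrt; lra.
have [s0|s0] := leP 0 s.
  exists (acos c); rewrite acosK ?in_itv //= sa ger0_norm //; split=> //.
  by rewrite a0 mulr2n; lra.
exists (pi *+ 2 - acos c); rewrite cosB sinB cos2pi sin2pi sa acosK ?in_itv //=.
by rewrite ltr0_norm //; split; [rewrite mulr2n; lra | ring | ring].
Qed.

(** The word of planes is separated from the angles, and the angles stay in a bounded interval, so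
    that finitely many angles per letter will approximate every product. *)
Fixpoint givens (w : seq 'I_d) g : Prop :=
  match w with
  | [::] => g = 1%:M
  | k :: w' => exists t h, [/\ 0 <= t <= pi *+ 2, givens w' h & g = prot k t *m h]
  end.

Lemma rot_mul_entry (i j a b : 'I_N) t g : i != j ->
  (rot i j t *m g) a b =
   if a == i then cos t * g i b + sin t * g j b
   else if a == j then cos t * g j b - sin t * g i b else g a b.
Proof.
move=> ij; have dm (x y : 'I_N) : (delta_mx x y *m g) a b = (a == x)%:R * g y b.
  rewrite mxE (bigD1 y) //= big1 ?addr0 => [|z zy]; rewrite mxE ?eqxx ?andbT //.
  by rewrite (negPf zy) andbF mul0r.
rewrite /rot /gen 2!mulmxDl mul1mx -!scalemxAl mulmxBl mulmxDl.
have aE (A B : 'M[R]_N) : (A + B) a b = A a b + B a b by rewrite mxE.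
have sE c (A : 'M[R]_N) : (c *: A) a b = c * A a b by rewrite mxE.
have oE (A : 'M[R]_N) : (- A) a b = - A a b by rewrite mxE.
rewrite !(aE, sE, oE) !dm.
case: eqP => [->|_]; first by rewrite (negPf ij) mulr0n mulr1n; ring.
by case: eqP => [->|_]; rewrite ?mulr0n ?mulr1n; ring.
Qed.

Lemma SO_col_orth g (i j : 'I_N) : SO g -> \sum_k g k i * g k j = (i == j)%:R.
Proof.
move=> [/matrixP/(_ i j) e _]; rewrite !mxE in e.
by rewrite -e; apply: eq_bigr => k _; rewrite mxE.
Qed.

Definition std_cols (m : nat) g := forall i j : 'I_N, (j < m)%N -> g i j = (i == j)%:R.

(** Column [i] is the i-th unit vector, and column [j] is orthogonal to it. *)
Lemma std_cols_upper m g (i j : 'I_N) : SO g -> std_cols m g -> (i < m)%N -> i != j ->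
  g i j = 0.
Proof.
move=> gS gm im ij; have := SO_col_orth i j gS; rewrite (negPf ij) mulr0n => <-.
rewrite (bigD1 i) //= (gm i i im) eqxx mul1r big1 ?addr0 // => k ki.
by rewrite (gm k i im) (negPf ki) mul0r.
Qed.

(** Column [m] has length one and only its diagonal entry left; the sign hypothesis excludes -1. *)
Lemma std_cols_succ (m : 'I_N) g : SO g -> std_cols m g ->
  (forall i : 'I_N, (m < i)%N -> g i m = 0) -> 0 <= g m m -> std_cols m.+1 g.
Proof.
move=> gS gm gz g0; have z (i : 'I_N) : i != m -> g i m = 0.
  move=> im; have [lt|lt|/val_inj e] := ltngtP i m; first exact: std_cols_upper gm lt im.
    exact: gz.
  by rewrite e eqxx in im.
move=> i j; rewrite ltnS leq_eqVlt => /orP[/eqP/val_inj ->|]; last exact: gm.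
have [->|im] := eqVneq i m; last exact: z.
have := SO_col_orth m m gS; rewrite eqxx (bigD1 m) //= big1 ?addr0 => [|k km].
  by move=> e; apply/eqP; rewrite -(eqrXn2 (n := 2)) // expr1n expr2 e.
by rewrite z // mul0r.
Qed.

(** Orthogonality makes g diagonal, and determinant 1 decides the last diagonal entry. *)
Lemma std_cols_last g : SO g -> std_cols N.-1 g -> g = 1%:M.
Proof.
move=> gS gm; have offd (i j : 'I_N) : i != j -> g i j = 0.
  move=> ij; have [jm|jm] := ltnP j N.-1; first by rewrite gm // (negPf ij).
  apply: (std_cols_upper gS gm) => //; have := ltn_ord i; have := ltn_ord j.
  have : nat_of_ord i <> j by move=> /val_inj e; rewrite e eqxx in ij.
  by lia.
have trig : is_trig_mx g by apply/is_trig_mxP => i j ij; rewrite offd // -val_eqE /= ltn_eqF.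
apply/matrixP => i j; rewrite mxE; have [<-|ij] := eqVneq i j; last exact: offd.
have [jm|jm] := ltnP i N.-1; first by rewrite gm // eqxx.
have := proj2 gS; rewrite det_trig // (bigD1 i) //= big1 ?mulr1 // => k ki.
rewrite gm ?eqxx //; have := ltn_ord k; have := ltn_ord i.
have : nat_of_ord k <> i by move=> /val_inj e; rewrite e eqxx in ki.
by lia.
Qed.

(** The angle turns the pair of entries in rows [m] and [l] of column [m] into (r, 0), where r >= 0
    is the length of the pair. The plane does not depend on g, which later gives one word for all of
    SO(N). *)
Lemma givens_step (m l : 'I_N) : (m < l)%N -> exists k, forall g, SO g -> std_cols m g ->
  (forall i : 'I_N, (m < i < l)%N -> g i m = 0) ->
  exists t h, [/\ 0 <= t <= pi *+ 2, g = prot k t *m h, SO h, std_cols m h &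
   (forall i : 'I_N, (m < i < l.+1)%N -> h i m = 0) /\ 0 <= h m m].
Proof.
move=> ml; have [k pk] := planeP ml; exists k => g gS gm gz.
have mnl : m != l by rewrite -val_eqE /= ltn_eqF.
have [t [tI tm tl]] : exists t, [/\ 0 <= t <= pi *+ 2,
    0 <= cos t * g m m - sin t * g l m & cos t * g l m + sin t * g m m = 0].
  set x := g m m; set y := g l m; pose r := Num.sqrt (x ^+ 2 + y ^+ 2).
  have r2 : r ^+ 2 = x ^+ 2 + y ^+ 2 by rewrite sqr_sqrtr // addr_ge0 ?sqr_ge0.
  have [r0|rn] := eqVneq r 0.
    have : x ^+ 2 + y ^+ 2 = 0 by rewrite -r2 r0 expr0n.
    move/eqP; rewrite paddr_eq0 ?sqr_ge0 // !sqrf_eq0 => /andP[/eqP -> /eqP ->].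
    exists 0; split; rewrite ?mulr0 ?subrr ?addr0 //.
    by rewrite lexx /= mulrn_wge0 ?pi_ge0.
  have rp : 0 < r by rewrite lt_neqAle eq_sym rn sqrtr_ge0.
  have [|t [tI tc ts]] := @polar (x / r) (- y / r).
    by rewrite !expr_div_n sqrrN -mulrDl -r2 divff // expf_neq0.
  exists t; split=> //; rewrite tc ts; last by field.
  have -> : x / r * x - - y / r * y = (x ^+ 2 + y ^+ 2) / r by field.
  by rewrite -r2 divr_ge0 ?sqr_ge0 // ltW.
pose h := prot k (- t) *m g.
have hE (a b : 'I_N) : h a b = if a == m then cos t * g m b - sin t * g l b
   else if a == l then cos t * g l b + sin t * g m b else g a b.
  by rewrite /h /prot pk /= rot_mul_entry // cosN sinN !mulNr opprK.
exists t, h; split=> //.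
- by rewrite /h mulmxA -protD subrr prot0 mul1mx.
- by apply: SO_mul (SO_prot _ _) gS.
- move=> i j jm; have gmj : g m j = 0 by rewrite gm // -val_eqE /= gtn_eqF.
  have glj : g l j = 0 by rewrite gm // -val_eqE /= gtn_eqF // (ltn_trans jm).
  rewrite hE gmj glj !mulr0 subrr addr0.
  case: eqP => [->|_]; first by rewrite -gm.
  by case: eqP => [->|_]; rewrite -gm.
split=> [i /andP[mi il]|]; last by rewrite hE eqxx.
rewrite hE -!val_eqE /= (gtn_eqF mi) tl; case: eqP => // il'.
by apply: gz; rewrite mi /=; lia.
Qed.

Lemma givens_cover : exists w, forall g, SO g -> givens w g.
Proof.
suff main n m : (m + n = N.-1)%N -> exists w, forall g, SO g -> std_cols m g -> givens w g.
  by have [w wP] := main N.-1 0%N erefl; exists w => g gS; apply: wP.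
elim: n m => [|n IHn] m mn.
  exists [::] => g gS; rewrite -[m]addn0 mn; exact: std_cols_last.
have [w wP] : exists w, forall g, SO g -> std_cols m.+1 g -> givens w g.
  by apply: IHn; lia.
have mN : (m < N)%N by lia.
pose m' := Ordinal mN.
(* Here [q] counts the rows still to be cleared in column [m]. The last two conditions ensure that
   the column receives at least one rotation, since only a rotation makes its diagonal entry
   nonnegative. *)
suff sub q l : (l + q = N)%N -> (m < l)%N -> exists w, forall g, SO g -> std_cols m g ->
   (forall i : 'I_N, (m < i < l)%N -> g i m' = 0) -> (m.+1 < l)%N || (q != 0)%N ->
   ((m.+1 < l)%N -> 0 <= g m' m') -> givens w g.
  have [||w' w'P] := sub (N - m.+1)%N m.+1; [lia|lia|].
  exists w' => g gS gm; apply: w'P => //; last by rewrite ltnn.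
    by move=> i; lia.
  by apply/orP; right; lia.
elim: q l => [|q IHq] l lq ml.
  exists w => g gS gm gz; rewrite orbF => ml' g0; apply: wP => //.
  apply: (@std_cols_succ m') => //; last exact: g0.
  by move=> i mi; apply: gz; rewrite mi /=; have := ltn_ord i; lia.
have [||w' w'P] := IHq l.+1; [lia|lia|].
have lN : (l < N)%N by lia.
have [k kP] := @givens_step m' (Ordinal lN) ml.
exists (k :: w') => g gS gm gz _ _.
have [t [h [tI gE hS hm [hz h0]]]] := kP g gS gm gz.
by exists t, h; split=> //; apply: w'P => //; apply/orP; left; lia.
Qed.

(* Finite dimension of eigenspaces and integrality *)
End Givens.

Section FiniteDimension.
Variables (R : realType) (N : nat).
Notation d := (dimSO N).
Implicit Types (f : 'M[R]_N -> R) (g h : 'M[R]_N) (k : 'I_d) (s t : R).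

Fixpoint givens_net (G : seq R) (w : seq 'I_d) : seq 'M[R]_N :=
  match w with
  | [::] => [:: 1%:M]
  | k :: w' => [seq prot k t *m h | t <- G, h <- givens_net G w']
  end.

Lemma givens_SO w g : givens w g -> SO g.
Proof.
elim: w g => [|k w IHw] g /=; first by move=> ->; exact: SO1.
by move=> [t [h [_ /IHw hS ->]]]; exact: SO_mul (SO_prot k t) hS.
Qed.

Lemma givens_net_SO G w g : g \in givens_net G w -> SO g.
Proof.
elim: w g => [|k w IHw] g /=; first by rewrite inE => /eqP ->; exact: SO1.
by move=> /allpairsP[[t h] /= [_ /IHw hS ->]]; exact: SO_mul (SO_prot k t) hS.
Qed.

Lemma grid (e : R) : 0 < e -> exists G : seq R, forall t, 0 <= t <= pi *+ 2 ->
  exists2 s, s \in G & `|t - s| <= e.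
Proof.
move=> e0; exists [seq e * i%:R | i <- iota 0 (Num.truncn (pi *+ 2 / e)).+1] => t /andP[t0 t1].
have te0 : 0 <= t / e by rewrite divr_ge0 // ltW.
exists (e * (Num.truncn (t / e))%:R).
  apply/mapP; exists (Num.truncn (t / e)) => //.
  rewrite mem_iota /= add0n ltnS; apply: le_truncn.
  by rewrite ler_pM2r ?invr_gt0.
have /andP[k1 k2] := truncn_itv te0; move: k1 k2; set k := Num.truncn _ => k1 k2.
rewrite ler_pdivlMr // in k1; rewrite ltr_pdivrMr // -[k.+1]addn1 natrD in k2.
by rewrite ler_norml; apply/andP; split; nra.
Qed.

(** Angles are rounded one at a time from the left, [a] collecting the factors already rounded. Each
    letter costs one application of the Lipschitz bound. *)
Lemma net_approx mu f M e G : spectral mu f -> 0 < M -> (forall g, SO g -> `|f g| <= M) ->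
  e <= 1 -> (forall t, 0 <= t <= pi *+ 2 -> exists2 s, s \in G & `|t - s| <= e) ->
  forall w g a, givens w g -> SO a -> exists2 p, p \in givens_net G w &
    `|f (a *m g) - f (a *m p)| <= (size w)%:R * ((4 * `|mu| + 4) * M * e).
Proof.
move=> sf M0 fM e1 Gnet; elim=> [|k w IHw] g a /=.
  by move=> -> aS; exists 1%:M; rewrite ?inE // subrr normr0 mul0r.
move=> [t [h [tI hw ->]]] aS; have [s sG ts] := Gnet t tI.
have hS := givens_SO hw; have asS := SO_mul aS (SO_prot k s).
have [p pw le] := IHw h (a *m prot k s) hw asS.
exists (prot k s *m p); first by apply/allpairsP; exists (s, p).
have := spectral_lipschitz k sf M0 fM asS hS (le_trans ts e1).
rewrite -[a *m _ *m prot _ _]mulmxA -protD [s + _]addrC subrK => lip.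
have lip' : (4 * `|mu| + 4) * M * `|t - s| <= (4 * `|mu| + 4) * M * e.
  by apply: ler_wpM2l ts; rewrite mulr_ge0 ?ltW // ltr_wpDl // mulr_ge0.
rewrite -natr1 mulrDl mul1r !mulmxA.
have -> : f (a *m prot k t *m h) - f (a *m prot k s *m p) =
  (f (a *m prot k t *m h) - f (a *m prot k s *m h)) +
  (f (a *m prot k s *m h) - f (a *m prot k s *m p)) by ring.
apply: le_trans (ler_normD _ _) _; rewrite addrC; apply: lerD => //.
exact: le_trans lip lip'.
Qed.

(* By the Lipschitz bound a spectral function vanishing on a fine enough net is
   smaller than its own maximum: the spectral functions form a finite-dimensional
   space. *)
Lemma determining_set mu : exists P : seq 'M[R]_N, (forall p, p \in P -> SO p) /\
  forall f, spectral mu f -> (forall p, p \in P -> f p = 0) -> forall g, SO g -> f g = 0.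
Proof.
have [w wP] := givens_cover R N; set C := 4 * `|mu| + 4 : R.
have C0 : 0 < C by rewrite /C ltr_wpDl ?mulr_ge0.
have C1 : 1 <= C by rewrite /C; have := normr_ge0 mu; lra.
(* With this mesh the total error is the maximum times n / (n + 1), where n is the length of [w],
   hence strictly below the maximum. *)
pose e := (C * (size w).+1%:R)^-1.
have n1 : 1 <= (size w).+1%:R :> R by rewrite ler1n.
have e0 : 0 < e by rewrite invr_gt0 mulr_gt0.
have e1 : e <= 1 by rewrite /e invf_le1 ?mulr_gt0 //; nra.
have [G GP] := grid e0; exists (givens_net G w); split=> [p|f sf fP]; first exact: givens_net_SO.
have [c1 _ _] := sf.
have [||g0 + max] := @compact_EVT_max _ R (fun g => `|f g|) (@SO R N) _ (@SO_compact R N).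
- by exists 1%:M; exact: SO1.
- apply/subspace_continuousP => g gS.
  have h : `|f x| @[x --> within (@SO R N) (nbhs g)] --> `|f g|.
    by apply: cvg_norm; exact: (subspace_continuousP _ _).1 c1 g gS.
  exact: h.
rewrite inE => g0S.
have bound g : SO g -> `|f g| <= `|f g0| by move=> gS; apply: max; rewrite inE.
have [M0 g gS|Mn] := eqVneq `|f g0| 0.
  by apply/eqP; rewrite -normr_le0 -M0 bound.
have M0 : 0 < `|f g0| by rewrite lt_neqAle eq_sym Mn normr_ge0.
have [p pP] := net_approx sf M0 bound e1 GP (wP _ g0S) (@SO1 R N).
rewrite !mul1mx (fP p pP) subr0 -/C => le.
suff : `|f g0| < `|f g0| by rewrite ltxx.
apply: le_lt_trans le _; rewrite /e.
have -> : (size w)%:R * (C * `|f g0| * (C * (size w).+1%:R)^-1) =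
   `|f g0| * ((size w)%:R / (size w).+1%:R).
  by field; rewrite !gt_eqF ?ltr0n.
by rewrite gtr_pMr // ltr_pdivrMr ?ltr0n // mul1r ltr_nat.
Qed.

Section Basis.
Variables (mu : R) (n : nat) (p : 'I_n -> 'M[R]_N).
Hypothesis pS : forall i, SO (p i).
Hypothesis p_det : forall f, spectral mu f -> (forall i, f (p i) = 0) ->
  forall g, SO g -> f g = 0.

(** By [p_det], evaluation at the points [p i] is injective on the spectral functions modulo their
    values off SO(N), so linear independence there becomes a rank condition. *)
Definition evals m (F : 'I_m -> 'M[R]_N -> R) : 'M[R]_(m, n) := \matrix_(a, i) F a (p i).

Lemma spectral_sum m (F : 'I_m -> 'M[R]_N -> R) (c : 'I_m -> R) :
  @spectral R N mu (fun=> 0) -> (forall a, spectral mu (F a)) ->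
  spectral mu (fun g => \sum_a c a * F a g).
Proof.
move=> s0 sF; elim: (index_enum _) => [|a r IHr].
  by under eq_fun do rewrite big_nil.
under eq_fun do rewrite big_cons.
by apply: spectralD => //; exact: spectralZ.
Qed.

(** A family with independent evaluations has at most [n] members; one of maximal size spans, since
    a function outside its span would enlarge it. *)
Lemma spectral_basis f g0 : spectral mu f -> SO g0 -> f g0 != 0 ->
  exists m (F : 'I_m -> 'M[R]_N -> R), [/\ (0 < m)%N, forall a, spectral mu (F a),
   row_free (evals F) &
   forall h : 'M[R]_N -> R, spectral mu h -> exists c : 'I_m -> R, forall g, SO g ->
     h g = \sum_a c a * F a g].
Proof.
move=> sf g0S f0; pose ok m := `[< exists F : 'I_m -> 'M[R]_N -> R,
   (forall a, spectral mu (F a)) /\ row_free (evals F) >].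
have s0 : @spectral R N mu (fun=> 0).
  by have := spectralZ 0 sf; under eq_fun do rewrite mul0r.
have ok0 : exists m, ok m.
  exists 0%N; apply/asboolP; exists (fun _ _ => 0); split=> [[]//|].
  by rewrite /row_free flatmx0 mxrank0.
have okn m : ok m -> (m <= n)%N.
  by move=> /asboolP[F [_ /eqP <-]]; exact: rank_leq_col.
case: (ex_maxnP ok0 okn) => m /asboolP[F [sF fF]] mmax.
have span (h : 'M[R]_N -> R) : spectral mu h -> exists c : 'I_m -> R, forall g, SO g ->
     h g = \sum_a c a * F a g.
  move=> sh; pose u : 'rV[R]_n := \row_i h (p i).
  have /submxP[c uc] : (u <= evals F)%MS.
    apply: contraT => nu.
    suff : (m.+1 <= m)%N by rewrite ltnn.
    apply: mmax; apply/asboolP.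
    pose F1 (i : 'I_(1 + m)) := match fintype.split i with inl _ => h | inr j => F j end.
    exists F1; split=> [i|]; first by rewrite /F1; case: (@fintype.split 1 m i).
    have -> : evals F1 = col_mx u (evals F).
      apply/matrixP => i j; rewrite [RHS]mxE mxE /F1.
      by case: (@fintype.split 1 m i) => l; rewrite !mxE.
    have rE : \rank (col_mx u (evals F)) = \rank (u + evals F)%MS by rewrite addsmxE.
    rewrite /row_free eqn_leq rank_leq_row /= rE.
    rewrite -[X in (X < _)%N](eqP fF); apply: rank_ltmx.
    by rewrite ltmxE addsmxSr /= addsmx_sub submx_refl andbT.
  exists (fun a => c 0 a) => g gS; apply/eqP; rewrite -subr_eq0; apply/eqP.
  pose h' g := h g + -1 * \sum_a c 0 a * F a g.
  have sh' : spectral mu h' :=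
    spectralD sh (spectralZ (-1) (spectral_sum (fun a => c 0 a) s0 sF)).
  transitivity (h' g); first by rewrite /h' mulN1r.
  apply: (p_det sh') => // i; rewrite /h'; have /rowP/(_ i) := uc; rewrite !mxE => ->.
  by rewrite mulN1r; apply/eqP; rewrite subr_eq0; apply/eqP; apply: eq_bigr => a _; rewrite mxE.
exists m, F; split=> //; case: m F sF fF span {mmax} => // F _ _ span.
have [c cP] := span f sf; move: f0; rewrite cP // big_ord0 eqxx //.
Qed.

(** Left translation acts on the basis by matrices [D h] with F_a(h g) = sum_b (D h)_ab F_b(g). The
    pseudo-inverse of [Phi] reads them off from values at the points [p i], so limits of basis
    functions pass to [D]. *)
Lemma spectral_int_aux f g0 : spectral mu f -> SO g0 -> f g0 != 0 -> exists z : int, mu = z%:~R.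
Proof.
move=> sf g0S f0; have [m [F [m0 sF fF span]]] := spectral_basis sf g0S f0.
pose Phi := evals F; pose Ev h : 'M[R]_(m, n) := \matrix_(a, i) F a (h *m p i).
pose D h := Ev h *m pinvmx Phi.
have PhiV : Phi *m pinvmx Phi = 1%:M by rewrite mulmxVp.
have Ev1 : Ev 1%:M = Phi by apply/matrixP => a i; rewrite !mxE mul1mx.
have DF h g : SO h -> SO g -> forall a, F a (h *m g) = \sum_b D h a b * F b g.
  move=> hS gS a; have := spectral_trans (sF a) hS (@SO1 R N) => /span[c cP].
  have {}cP g' : SO g' -> F a (h *m g') = \sum_b c b * F b g'.
    by move=> /cP; rewrite mulmx1.
  rewrite cP //; apply: eq_bigr => b _; congr (_ * _).
  have : row a (D h) = (\row_b' c b') *m Phi *m pinvmx Phi.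
    rewrite /D row_mul; congr (_ *m _); apply/rowP => i; rewrite !mxE cP //.
    by apply: eq_bigr => b' _; rewrite !mxE.
  by rewrite -mulmxA PhiV mulmx1 => /rowP/(_ b); rewrite !mxE => ->.
have D1 : D 1%:M = 1%:M by rewrite /D Ev1.
have DM h h' : SO h -> SO h' -> D (h *m h') = D h *m D h'.
  move=> hS h'S; rewrite /D mulmxA; congr (_ *m _).
  apply/matrixP => a i; rewrite mxE -mulmxA DF //; last exact: SO_mul.
  by rewrite [RHS]mxE; apply: eq_bigr => b _; congr (_ * _); rewrite mxE.
have [c cP] : exists c : 'I_m -> 'I_n -> 'I_d -> R, forall a i (x : 'rV[R]_d),
    t^-1 * (F a (cay (t *: skew x) *m p i) - F a (p i)) @[t --> (0 : R)^'] -->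
    \sum_k x 0 k * c a i k.
  have C a i := let: And3 _ _ h := sF a in h _ _ (@SO1 R N) (pS i).
  exists (fun a i => sval (cid (C a i))) => a i x.
  by have := svalP (cid (C a i)) x; under eq_fun do rewrite !mul1mx; rewrite ?mul1mx.
pose B k : 'M[R]_m := (\matrix_(a, i) c a i k) *m pinvmx Phi.
apply: (@casimir_int R N m D D1 DM B _ mu _ m0).
- move=> x; have -> : \sum_k x 0 k *: B k =
     (\matrix_(a, i) \sum_k x 0 k * c a i k) *m pinvmx Phi.
    rewrite /B; under eq_bigr do rewrite scalemxAl.
    rewrite -mulmx_suml; congr (_ *m _); apply/matrixP => a i.
    by rewrite summxE mxE; apply: eq_bigr => k _; rewrite !mxE.
  have h : mxlim (fun t => t^-1 *: (Ev (cay (t *: skew x)) - Phi))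
     (\matrix_(a, i) \sum_k x 0 k * c a i k).
    by move=> a i; apply: cvg_ext (cP a i x) _ _ => [t|]; rewrite !mxE.
  apply: mxlim_near (mxlimMl (pinvmx Phi) h); apply: filterE => t /=.
  by rewrite -scalemxAl mulmxBl PhiV.
- have h : mxlim (fun t => (t ^+ 2)^-1 *: \sum_k (Ev (prot k t) + Ev (prot k (- t)) - 2 *: Phi))
     (- mu *: Phi).
    move=> a i; have [_ h _] := sF a.
    apply: cvg_ext (h _ _ (@SO1 R N) (pS i)) _ _ => [t|]; last by rewrite !mxE mul1mx.
    rewrite mxE summxE; congr (_ * _); apply: eq_bigr => k _.
    by rewrite /second_diff !mxE !mul1mx.
  have := mxlimMl (pinvmx Phi) h; rewrite -scalemxAl PhiV scalemx1.
  apply: mxlim_near; apply: filterE => t /=.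
  rewrite -scalemxAl mulmx_suml; congr (_ *: _); apply: eq_bigr => k _.
  by rewrite mulmxBl mulmxDl -scalemxAl PhiV scalemx1.
Qed.

End Basis.

Theorem spectral_int mu f g : spectral mu f -> SO g -> f g != 0 -> exists z : int, mu = z%:~R.
Proof.
have [P [PS Pdet]] := determining_set mu.
apply: (@spectral_int_aux mu (size P) (fun i => tnth (in_tuple P) i)).
  by move=> i; apply: PS; exact: mem_tnth.
move=> h sh hP; apply: Pdet => // q /(tnthP (in_tuple P))[i ->]; exact: hP.
Qed.

End FiniteDimension.

(** * Cayley charts *)

Section CayleyCalculus.
Variables (R : realType) (N : nat).
Notation d := (dimSO N).
Implicit Types (x v : 'rV[R]_d) (u w : 'rV[R]_d -> 'M[R]_N) (g h : 'M[R]_N).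

Definition dder n p (u : 'rV[R]_d -> 'M[R]_(n, p)) x v (z : 'M[R]_(n, p)) : Prop :=
  mxlim (fun t => t^-1 *: (u (t *: v + x) - u x)) z.

Lemma dder_derive n p (u : 'rV[R]_d -> 'M[R]_(n, p)) x v z :
  dder u x v z -> derivable u x v /\ 'D_v u x = z.
Proof.
move=> h; have c : (fun t => t^-1 *: (u (t *: v + x) - u x)) @ (0 : R)^' --> z.
  by apply: cvg_mx_entry.
by split; [exact: cvgP c|exact: cvg_lim c].
Qed.

Lemma dder_cvg n p (u : 'rV[R]_d -> 'M[R]_(n, p)) x v z :
  dder u x v z -> mxlim (fun t => u (t *: v + x)) (u x).
Proof.
move=> h; have t0 : (t : R) @[t --> (0 : R)^'] --> (0 : R).
  by apply: cvg_dnbhs; exact: cvg_id.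
have := mxlimD (mxlimZ t0 h) (mxlim_cst (u x)).
rewrite scale0r add0r; apply: mxlim_near.
by apply: filterS (near_dnbhs0_neq0 R) => t tn0; rewrite scalerA mulfV // scale1r subrK.
Qed.

Lemma dderD u w x v z z' : dder u x v z -> dder w x v z' ->
  dder (fun y => u y + w y) x v (z + z').
Proof.
move=> hu hw; apply: mxlim_near (mxlimD hu hw); apply: filterE => t.
by rewrite -scalerDr opprD addrACA.
Qed.

Lemma dderM u w x v z z' : dder u x v z -> dder w x v z' ->
  dder (fun y => u y *m w y) x v (z *m w x + u x *m z').
Proof.
move=> hu hw; have := mxlimD (mxlimM hu (dder_cvg hw)) (mxlimMr (u x) hw).
apply: mxlim_near; apply: filterE => t.
rewrite -scalemxAl -scalemxAr -scalerDr; congr (_ *: _).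
by rewrite mulmxBl mulmxBr addrA subrK.
Qed.

Definition cinv x : 'M[R]_N := invmx (1%:M - 2^-1 *: skew x).

Lemma skew_cvg (T : Type) (F : set_system T) {FF : Filter F} (f : T -> 'rV[R]_d) x :
  f y @[y --> F] --> x -> skew (f y) @[y --> F] --> skew x.
Proof.
move=> fx; apply: cvg_mx_entry => i j; rewrite summxE; under eq_fun do rewrite summxE.
apply: cvg_sum => k _; rewrite mxE; under eq_fun do rewrite mxE.
by apply: cvgM; [exact: cvg_entry|exact: cvg_cst].
Qed.

Lemma cinv_unit x : 1%:M - 2^-1 *: skew x \in unitmx.
Proof. by apply: halfskew_unit; exact: tr_skew. Qed.

Lemma cinv_cvg (T : Type) (F : set_system T) {FF : Filter F} (f : T -> 'rV[R]_d) x :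
  f y @[y --> F] --> x -> cinv (f y) @[y --> F] --> cinv x.
Proof.
move=> fx; apply: cvg_invmx; first exact: cinv_unit.
have sx : skew (f y) @[y --> F] --> skew x by exact: skew_cvg.
 apply: cvg_mx_entry => i j; rewrite !mxE.
under eq_fun do rewrite !mxE.
apply: cvgB; first exact: cvg_cst.
by apply: cvgM; [exact: cvg_cst|exact: cvg_entry].
Qed.

Lemma line_cvg x v : (t *: v + x) @[t --> (0 : R)^'] --> x.
Proof.
apply: cvg_mx_entry => i j; under eq_fun do rewrite !mxE.
have h : (t * v i j + x i j) @[t --> (0 : R)^'] --> 0 * v i j + x i j.
  apply: cvgD; last exact: cvg_cst.
  by apply: cvgM; [apply: cvg_dnbhs; exact: cvg_id|exact: cvg_cst].
by rewrite mul0r add0r in h.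
Qed.

(** The resolvent identity A - B = A (B^-1 - A^-1) B, where B^-1 - A^-1 is linear in the
    increment. *)
Lemma dder_cinv x v : dder cinv x v (cinv x *m (2^-1 *: skew v) *m cinv x).
Proof.
have c : mxlim (fun t => cinv (t *: v + x)) (cinv x).
  by move=> i j; apply: cvg_entry; apply: cinv_cvg; exact: line_cvg.
have := mxlimMl (cinv x) (mxlimMl (2^-1 *: skew v) c).
apply: mxlim_near; apply: filterS (near_dnbhs0_neq0 R) => t t0.
set A := cinv (t *: v + x); set B := cinv x.
have -> : A - B = A *m (1%:M - 2^-1 *: skew x - (1%:M - 2^-1 *: skew (t *: v + x))) *m B.
  by rewrite mulmxBr mulmxBl mulmxK ?cinv_unit // mulVmx ?cinv_unit // mul1mx.
have -> : 1%:M - 2^-1 *: skew x - (1%:M - 2^-1 *: skew (t *: v + x)) = t *: (2^-1 *: skew v).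
  rewrite skewD skewZ; move: (skew x) (skew v) => X V.
  by apply/matrixP => i j; rewrite !mxE; ring.
move: (2^-1 *: skew v) => V.
by rewrite -scalemxAr -scalemxAl scalerA mulVf // scale1r.
Qed.

(* Matrix words in the resolvent [cinv]: a class closed under differentiation
   that contains the Cayley charts. *)
Inductive cayley_word : ('rV[R]_d -> 'M[R]_N) -> Prop :=
| word_cst B : cayley_word (fun=> B)
| word_inv : cayley_word cinv
| word_mul u w : cayley_word u -> cayley_word w -> cayley_word (fun x => u x *m w x)
| word_add u w : cayley_word u -> cayley_word w -> cayley_word (fun x => u x + w x).

Lemma word_continuous u : cayley_word u -> continuous u.
Proof.
elim=> [B|||] => [x|x|u' w _ cu _ cw x|u' w _ cu _ cw x].
- exact: cst_continuous.
- exact: (@cinv_cvg _ (nbhs x) _ id x cvg_id).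
- exact: (@cvg_mulmx _ _ (nbhs x) _ N N N u' w _ _ (cu x) (cw x)).
- exact: (@cvgD _ _ _ (nbhs x) _ u' w _ _ (cu x) (cw x)).
Qed.

Lemma word_dder u : cayley_word u -> forall v, exists2 u', cayley_word u' &
  forall x, dder u x v (u' x).
Proof.
elim=> [B|||] => [v|v|u1 u2 w1 h1 w2 h2 v|u1 u2 w1 h1 w2 h2 v].
- exists (fun=> 0); first exact: word_cst.
  move=> x; apply: mxlim_near (mxlim_cst _); apply: filterE => t.
  by rewrite subrr scaler0.
- exists (fun x => cinv x *m (2^-1 *: skew v) *m cinv x).
    exact: word_mul (word_mul word_inv (word_cst _)) word_inv.
  by move=> x; exact: dder_cinv.
- have [u1' w1' d1] := h1 v; have [u2' w2' d2] := h2 v.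
  exists (fun x => u1' x *m u2 x + u1 x *m u2' x).
    by apply: word_add; apply: word_mul.
  by move=> x; exact: dderM.
- have [u1' w1' d1] := h1 v; have [u2' w2' d2] := h2 v.
  exists (fun x => u1' x + u2' x); first exact: word_add.
  by move=> x; exact: dderD.
Qed.

Lemma word_smooth u : cayley_word u -> smooth_on setT u.
Proof.
move=> wu k; elim: k u wu => [|k IHk] u wu.
  by split=> // x _; exact: word_continuous.
split=> [x _|i]; first exact: word_continuous.
have [u' wu' du] := word_dder wu (delta_mx 0 i); split=> [x _|].
  by have [] := dder_derive (du x).
have -> : partial i u = u' by apply/funext => x; have [] := dder_derive (du x).
exact: IHk.
Qed.

Definition chart g h x : 'M[R]_N := g *m cay (skew x) *m h.

Lemma chartE g h : chart g h = fun x => (g *m 2%:M) *m cinv x *m h + - (g *m h).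
Proof.
apply/funext => x; rewrite /chart /cay -/(cinv x) mulmxBr mulmx1 mulmxBl.
by rewrite -scalemxAr mul_mx_scalar -!scalemxAl.
Qed.

Lemma chart_word g h : cayley_word (chart g h).
Proof.
rewrite chartE; apply: word_add; last exact: word_cst.
by apply: word_mul; [apply: word_mul; [exact: word_cst|exact: word_inv]|exact: word_cst].
Qed.

Lemma chart_partial g h k x :
  partial k (chart g h) x = g *m cinv x *m gen R (plane k).1 (plane k).2 *m cinv x *m h.
Proof.
have hc B : dder (fun=> B) x (delta_mx 0 k) (0 : 'M[R]_N).
  by apply: mxlim_near (mxlim_cst _); apply: filterE => t; rewrite subrr scaler0.
have hd := dderM (dderM (hc (g *m 2%:M)) (@dder_cinv x (delta_mx 0 k))) (hc h).
have := dderD hd (hc (- (g *m h))).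
rewrite mul0mx add0r mulmx0 !addr0 => /dder_derive[_].
rewrite -chartE /partial => ->; rewrite skew_delta -!mulmxA; congr (_ *m _).
by rewrite mul_scalar_mx -scalemxAl -scalemxAr scalerA mulfV ?scale1r ?pnatr_eq0.
Qed.

Lemma chart_SO g h x : SO g -> SO h -> SO (chart g h x).
Proof.
by move=> gS hS; apply: SO_mul hS; apply: SO_mul gS _; apply: SO_cay; exact: tr_skew.
Qed.

Definition chart_inv g h (y : 'M[R]_N) : 'rV[R]_d := coords (icay (g^T *m y *m h^T)).

Lemma chart_strip g h x : SO g -> SO h -> g^T *m chart g h x *m h^T = cay (skew x).
Proof.
move=> gS hS; rewrite /chart !mulmxA (proj1 gS) mul1mx -mulmxA SO_mulVr //.
by rewrite mulmx1.
Qed.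

Lemma chartK g h x : SO g -> SO h -> chart_inv g h (chart g h x) = x.
Proof.
by move=> gS hS; rewrite /chart_inv chart_strip // cayK ?tr_skew // coords_skew.
Qed.

Lemma chart_unit g h x : SO g -> SO h -> 1%:M + g^T *m chart g h x *m h^T \in unitmx.
Proof. by move=> gS hS; rewrite chart_strip // add1_cay_unit // tr_skew. Qed.

Lemma chart_invK g h y : SO g -> SO h -> SO y -> 1%:M + g^T *m y *m h^T \in unitmx ->
  chart g h (chart_inv g h y) = y.
Proof.
move=> gS hS yS u; have zS := SO_mul (SO_mul (SO_tr gS) yS) (SO_tr hS).
rewrite /chart /chart_inv skew_coords; last exact: tr_icay (proj1 zS) u.
rewrite icayK //; last exact: proj1 zS.
by rewrite !mulmxA SO_mulVr // mul1mx -mulmxA (proj1 hS) mulmx1.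
Qed.

Lemma cvg_add1 (T : Type) (F : set_system T) {FF : Filter F} g h (f : T -> 'M[R]_N) y :
  f z @[z --> F] --> y -> 1%:M + g^T *m f z *m h^T @[z --> F] --> 1%:M + g^T *m y *m h^T.
Proof.
move=> fy; have c : g^T *m f z *m h^T @[z --> F] --> g^T *m y *m h^T.
  by apply: cvg_mulmx; [apply: cvg_mulmx => //; exact: cvg_cst|exact: cvg_cst].
by apply: cvgD => //; exact: cvg_cst.
Qed.

Lemma chart_inv_cvg (T : Type) (F : set_system T) {FF : Filter F} g h (f : T -> 'M[R]_N) y :
  1%:M + g^T *m y *m h^T \in unitmx ->
  f z @[z --> F] --> y -> chart_inv g h (f z) @[z --> F] --> chart_inv g h y.
Proof.
move=> u fy.
have c : invmx (1%:M + g^T *m f z *m h^T) @[z --> F] --> invmx (1%:M + g^T *m y *m h^T).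
  by apply: cvg_invmx u _; exact: cvg_add1.
apply: cvg_mx_entry => i j; rewrite mxE; under eq_fun do rewrite mxE.
rewrite /icay mxE [X in _ + X]mxE [X in _ - X]mxE.
under eq_fun do rewrite /icay mxE [X in _ + X]mxE [X in _ - X]mxE.
apply: cvgB; first exact: cvg_cst.
by apply: cvgM; [exact: cvg_cst|exact: cvg_entry].
Qed.

(** The inverse of the chart is given by a formula that is continuous on an open set of matrices;
    [W] is the preimage of [V] under it. *)
Lemma chart_open g h (V : set 'rV[R]_d) : SO g -> SO h -> open V ->
  exists2 W : set 'M[R]_N, open W & chart g h @` V = W `&` @SO R N.
Proof.
move=> gS hS oV.
exists [set y | 1%:M + g^T *m y *m h^T \in unitmx /\ V (chart_inv g h y)].
  rewrite openE => y /= [u Vy]; rewrite /interior.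
  have n1 : \forall z \near y, \det (1%:M + g^T *m z *m h^T) != 0.
    apply: (@cvgr_neq0 _ _ _ (nbhs y) _ (fun z => \det (1%:M + g^T *m z *m h^T))
      (\det (1%:M + g^T *m y *m h^T))).
      by apply: (@cvg_det _ _ (nbhs y)); apply: (@cvg_add1 _ (nbhs y) _ g h id); exact: cvg_id.
    by rewrite -unitfE -unitmxE.
  have n2 : \forall z \near y, V (chart_inv g h z).
    have := @chart_inv_cvg _ (nbhs y) _ g h id y u cvg_id; apply.
    exact: open_nbhs_nbhs.
  by apply: filterS2 n1 n2 => z z1 z2; split=> //; rewrite unitmxE unitfE.
apply/seteqP; split=> [_ [x Vx <-]|y [[u Vy] yS]].
  split; last exact: chart_SO.
  by split; [exact: chart_unit|rewrite chartK].
by exists (chart_inv g h y) => //; exact: chart_invK.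
Qed.

Lemma chart_local_parametrization g h : SO g -> SO h ->
  local_parametrization setT (chart g h).
Proof.
move=> gS hS; split; [exact: openT|exact: word_smooth (chart_word g h)| | |split].
- by move=> x _; exact: chart_SO.
- move=> x _ c c0 i.
  have : g *m cinv x *m skew (\row_k c k) *m cinv x *m h = 0.
    rewrite -[RHS]c0 /skew mulmx_sumr !mulmx_suml; apply: eq_bigr => k _.
    by rewrite chart_partial mxE -scalemxAr -!scalemxAl.
  have ug : g \in unitmx by rewrite unitmxE (proj2 gS) unitr1.
  have uh : h \in unitmx by rewrite unitmxE (proj2 hS) unitr1.
  have uc : cinv x \in unitmx by rewrite unitmx_inv cinv_unit.
  move/(congr1 (mulmxr (invmx h))); rewrite /= mulmxK // mul0mx.
  move/(congr1 (mulmxr (invmx (cinv x)))); rewrite /= mulmxK // mul0mx -mulmxA.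
  move/(congr1 (mulmx (invmx g))); rewrite mulKmx // mulmx0.
  move/(congr1 (mulmx (invmx (cinv x)))); rewrite mulKmx // mulmx0.
  move=> s0; have : skew (\row_k c k) = skew 0 by rewrite s0 linear0.
  by move/skew_inj/rowP/(_ i); rewrite !mxE.
- by move=> x y _ _ e; rewrite -(@chartK g h x) // e chartK.
- by move=> V oV _; exact: chart_open.
Qed.

End CayleyCalculus.

(** * The Laplacian at the center of a Cayley chart *)

Section OneVariable.
Variable R : realType.

Lemma second_difference (F F1 : R -> R) (l : R) :
  (forall s, is_derive s (1 : R) F (F1 s)) ->
  t^-1 * (F1 t - F1 0) @[t --> (0 : R)^'] --> l ->
  (t ^+ 2)^-1 * (F t + F (- t) - 2 * F 0) @[t --> (0 : R)^'] --> l.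
Proof.
move=> dF lF.
(* At 0 the quotient [df / dg] receives the value [l], because its limit is needed on a full
   neighbourhood of 0. Away from 0 these are the derivatives of numerator and denominator. *)
pose df x := if x == 0 then l else F1 x - F1 (- x).
pose dg x : R := if x == 0 then 1 else 2 * x.
have cF : continuous F.
  by move=> s; apply: differentiable_continuous; apply/derivable1_diffP; have [] := dF s.
have q : (F t + F (- t) - 2 * F 0) / t ^+ 2 @[t --> (0 : R)^'] --> l.
  apply: (@lhopital R (fun t => F t + F (- t) - 2 * F 0) df (fun t => t ^+ 2) dg (-1) 1 0).
  - by rewrite in_itv /= oppr_lt0 ltr01.
  - move=> x; rewrite inE => -[_ /= x0].
    rewrite /df ifF; last by apply/eqP.
    have := dF x; have := dF (- x) => ? ?; apply: trigger_derive.
    by rewrite /GRing.scale /=; ring.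
  - move=> x; rewrite inE => -[_ /= x0].
    rewrite /dg ifF; last by apply/eqP.
    by apply: trigger_derive; rewrite /GRing.scale /=; ring.
  - have : F t + F (- t) - 2 * F 0 @[t --> (0 : R)] --> F 0 + F (- 0) - 2 * F 0.
      apply: cvgB; last exact: cvg_cst.
      apply: cvgD; first exact: cF.
      by apply: continuous_comp; [exact: opp_continuous|exact: cF].
    by rewrite oppr0 (_ : F 0 + F 0 - 2 * F 0 = 0) //; ring.
  - have : t ^+ 2 @[t --> (0 : R)] --> (0 : R) ^+ 2 by exact: exprn_continuous.
    by rewrite expr0n.
  - move=> x; rewrite inE => -[_ /= /eqP x0].
    by rewrite /dg (negPf x0) mulf_neq0.
  have lim : df t / dg t @[t --> (0 : R)^'] --> l.
    have lF' := cvg_comp _ _ (@dnbhs0_opp R) lF.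
    have h : 2^-1 * (t^-1 * (F1 t - F1 0) + (- t)^-1 * (F1 (- t) - F1 0))
       @[t --> (0 : R)^'] --> 2^-1 * (l + l).
      by apply: cvgM; [exact: cvg_cst|exact: cvgD].
    have -> : l = 2^-1 * (l + l) by field.
    apply: cvg_trans h; apply: near_eq_cvg.
    apply: filterS (near_dnbhs0_neq0 R) => t t0.
    by rewrite /df /dg (negPf t0); field.
  move=> A /= Al; have := lim A Al; rewrite /nbhs /= => -[e /= e0 eA].
  exists e => //= x xe; have [->|x0] := eqVneq x 0; last exact: eA.
  change (A (df 0 / dg 0)); rewrite /df /dg eqxx divr1; exact: nbhs_singleton.
by apply: cvg_ext q _ _ => // t; rewrite mulrC.
Qed.

Lemma mvt0 (F F1 : R -> R) : (forall s, is_derive s (1 : R) F (F1 s)) ->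
  forall u, exists2 s, `|s| <= `|u| & F u - F 0 = u * F1 s.
Proof.
move=> dF u; have cF : continuous F.
  by move=> s; apply: differentiable_continuous; apply/derivable1_diffP; have [] := dF s.
have [u0|u0] := leP 0 u.
  have [|s sI e] := @MVT_segment R F F1 0 u u0 (fun x _ => dF x).
    exact: continuous_subspaceT.
  move: sI; rewrite in_itv /= => /andP[s0 su].
  by exists s; rewrite ?ger0_norm // e subr0 mulrC.
have [|s sI e] := @MVT_segment R F F1 u 0 (ltW u0) (fun x _ => dF x).
  exact: continuous_subspaceT.
move: sI; rewrite in_itv /= => /andP[us s0].
exists s; first by rewrite !ler0_norm ?lerN2 // ltW.
by rewrite -opprB e; ring.
Qed.

End OneVariable.

Section FirstOrder.
Variables (R : realType) (d : nat).

Lemma partial_line (F : 'rV[R]_d -> R) k (y : 'rV[R]_d) :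
  (forall x, derivable F x (delta_mx 0 k)) ->
  forall s : R, is_derive s (1 : R) (fun s => F (s *: delta_mx 0 k + y))
    (partial k F (s *: delta_mx 0 k + y)).
Proof.
move=> dF s; have D := dF (s *: delta_mx 0 k + y).
have h : (fun h : R => h^-1 *: (F ((h *: 1 + s) *: delta_mx 0 k + y) - F (s *: delta_mx 0 k + y)))
   @ (0 : R)^' --> partial k F (s *: delta_mx 0 k + y).
  have := D; rewrite /derivable /partial /derive => D'.
  apply: cvg_trans D'; apply: near_eq_cvg; apply: filterE => t /=.
  by rewrite [_ *: 1]mulr1 scalerDl addrA.
by split; [exact: cvgP h|exact: cvg_lim h].
Qed.

(** The increment is split into moves along one coordinate at a time; the mean value theorem and the
    continuity of the partial derivatives handle each move. *)
Lemma C1_directional (F : 'rV[R]_d -> R) :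
  (forall k x, derivable F x (delta_mx 0 k)) -> (forall k, continuous (partial k F)) ->
  forall x : 'rV[R]_d, t^-1 * (F (t *: x) - F 0) @[t --> (0 : R)^'] -->
    \sum_k x 0 k * partial k F 0.
Proof.
move=> dF cF x.
suff main (r : seq 'I_d) :
    t^-1 * (F (t *: \sum_(k <- r) x 0 k *: delta_mx 0 k) - F 0) @[t --> (0 : R)^'] -->
      \sum_(k <- r) x 0 k * partial k F 0.
  by have := main (index_enum _); rewrite -row_sum_delta.
elim: r => [|k r IHr].
  by apply: cvg_ext (cvg_cst (0 : R)) _ _ => [t|]; rewrite !big_nil // scaler0 subrr mulr0.
set y := \sum_(k <- r) _ in IHr; rewrite big_cons -/y.
have step : t^-1 * (F (t *: (x 0 k *: delta_mx 0 k + y)) - F (t *: y)) @[t --> (0 : R)^'] -->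
   x 0 k * partial k F 0.
  have mvt t : exists2 s, `|s| <= `|t * x 0 k| &
     F (t *: (x 0 k *: delta_mx 0 k + y)) - F (t *: y) =
     t * x 0 k * partial k F (s *: delta_mx 0 k + t *: y).
    have [s sle sE] := mvt0 (partial_line (t *: y) (dF k)) (t * x 0 k).
    by exists s => //; rewrite -sE scale0r add0r scalerDr scalerA.
  pose s t := sval (cid2 (mvt t)).
  have sP t : `|s t| <= `|t * x 0 k| by rewrite /s; case: (cid2 _).
  have sE t : F (t *: (x 0 k *: delta_mx 0 k + y)) - F (t *: y) =
     t * x 0 k * partial k F (s t *: delta_mx 0 k + t *: y).
    by rewrite /s; case: (cid2 _).
  have s0 : s t @[t --> (0 : R)^'] --> (0 : R).
    apply/cvgrPdist_lt => e e0; have c0 : 0 < `|x 0 k| + 1 by rewrite ltr_wpDl.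
    have : \forall t \near (0 : R)^', `|t| < e / (`|x 0 k| + 1).
      by apply: dnbhs0_lt; rewrite divr_gt0.
    apply: filterS => t; rewrite ltr_pdivlMr // => te; rewrite sub0r normrN.
    apply: le_lt_trans (sP t) _; rewrite normrM; apply: le_lt_trans te.
    by rewrite ler_wpM2l // lerDl.
  have l0 : (s t *: delta_mx 0 k + t *: y) @[t --> (0 : R)^'] --> (0 : 'rV[R]_d).
    apply: cvg_mx_entry => i j; rewrite !mxE; under eq_fun do rewrite !mxE.
    have h : (s t * ((i == 0) && (j == k))%:R + t * y i j) @[t --> (0 : R)^'] -->
        0 * ((i == 0) && (j == k))%:R + 0 * y i j.
      apply: cvgD; apply: cvgM => //; try exact: cvg_cst.
      by apply: cvg_dnbhs; exact: cvg_id.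
    by rewrite !mul0r addr0 in h.
  have h : x 0 k * partial k F (s t *: delta_mx 0 k + t *: y) @[t --> (0 : R)^'] -->
      x 0 k * partial k F 0.
    by apply: cvgM; [exact: cvg_cst|exact: cvg_comp l0 (cF k 0)].
  apply: cvg_trans h; apply: near_eq_cvg.
  apply: filterS (near_dnbhs0_neq0 R) => t t0.
  by rewrite sE !mulrA mulVf // mul1r.
apply: cvg_ext (cvgD step IHr) _ _ => [t|]; last by rewrite ?big_cons.
by rewrite /= ?big_cons -/y; ring.
Qed.

End FirstOrder.

Section Flat.
Variable R : realType.

(** The expansion u(t) = l + o(t). It expresses that metric coefficients agree with Euclidean ones
    to first order and is preserved by the operations that form the Laplacian. *)
Definition flat (u : R -> R) (l : R) := t^-1 * (u t - l) @[t --> (0 : R)^'] --> (0 : R).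

Lemma flat_cvg u l : flat u l -> u t @[t --> (0 : R)^'] --> l.
Proof.
move=> h; have t0 : (t : R) @[t --> (0 : R)^'] --> (0 : R).
  by apply: cvg_dnbhs; exact: cvg_id.
apply: cvg_near_ext (cvgD (cvgM t0 h) (cvg_cst l)) _ _; last by rewrite mul0r add0r.
by apply: filterS (near_dnbhs0_neq0 R) => t tn0 /=; rewrite mulrA mulfV // mul1r subrK.
Qed.

Lemma flat_cst l : flat (fun=> l) l.
Proof.
by rewrite /flat; under eq_fun do rewrite subrr mulr0; exact: cvg_cst.
Qed.

Lemma flatD u v l m : flat u l -> flat v m -> flat (fun t => u t + v t) (l + m).
Proof. by move=> hu hv; apply: cvg_ext (cvgD hu hv) _ _ => [t|]; rewrite /= ?addr0 //; ring. Qed.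

Lemma flatM u v l m : flat u l -> flat v m -> flat (fun t => u t * v t) (l * m).
Proof.
move=> hu hv.
apply: cvg_ext (cvgD (cvgM hu (flat_cvg hv)) (cvgM (cvg_cst l) hv)) _ _ => [t|].
  by rewrite /=; ring.
by rewrite mul0r mulr0 addr0.
Qed.

Lemma flat_sum (I : Type) (r : seq I) (P : pred I) (u : I -> R -> R) (l : I -> R) :
  (forall i, P i -> flat (u i) (l i)) ->
  flat (fun t => \sum_(i <- r | P i) u i t) (\sum_(i <- r | P i) l i).
Proof.
move=> h; elim: r => [|i r IHr].
  by rewrite big_nil; under eq_fun do rewrite big_nil; exact: flat_cst.
rewrite big_cons; under eq_fun do rewrite big_cons.
by case: ifP => // Pi; exact: flatD (h i Pi) IHr.
Qed.

Lemma flat_prod (I : Type) (r : seq I) (P : pred I) (u : I -> R -> R) (l : I -> R) :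
  (forall i, P i -> flat (u i) (l i)) ->
  flat (fun t => \prod_(i <- r | P i) u i t) (\prod_(i <- r | P i) l i).
Proof.
move=> h; elim: r => [|i r IHr].
  by rewrite big_nil; under eq_fun do rewrite big_nil; exact: flat_cst.
rewrite big_cons; under eq_fun do rewrite big_cons.
by case: ifP => // Pi; exact: flatM (h i Pi) IHr.
Qed.

Lemma flatV u l : l != 0 -> flat u l -> flat (fun t => (u t)^-1) l^-1.
Proof.
move=> l0 hu; have c := flat_cvg hu.
apply: cvg_near_ext (cvgM (cvgM (cvg_cst (- l^-1)) hu) (cvgV l0 c)) _ _; last first.
  by rewrite mulr0 mul0r.
have un : \forall t \near (0 : R)^', u t != 0 by exact: cvgr_neq0 c l0.
by apply: filterS2 un (near_dnbhs0_neq0 R) => t ut tn /=; field; rewrite l0 ut.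
Qed.

Lemma flat_sqrt u : flat u 1 -> flat (fun t => Num.sqrt (u t)) 1.
Proof.
move=> hu; have c := flat_cvg hu.
have c1 : Num.sqrt (u t) + 1 @[t --> (0 : R)^'] --> Num.sqrt 1 + 1.
  by apply: cvgD; [exact: cvg_comp c (@sqrt_continuous R 1)|exact: cvg_cst].
have n0 : Num.sqrt 1 + 1 != 0 :> R by rewrite sqrtr1 (_ : 1 + 1 = 2) ?pnatr_eq0.
apply: cvg_near_ext (cvgM hu (cvgV n0 c1)) _ _; last by rewrite mul0r.
have up : \forall t \near (0 : R)^', 0 < u t by exact: cvgr_gt _ c _ ltr01.
apply: filterS2 up (near_dnbhs0_neq0 R) => t ut tn /=.
have s1 : Num.sqrt (u t) + 1 != 0 by rewrite gt_eqF // ltr_wpDl ?sqrtr_ge0.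
have -> : u t - 1 = (Num.sqrt (u t) - 1) * (Num.sqrt (u t) + 1).
  by rewrite -[in LHS](sqr_sqrtr (ltW ut)); ring.
by field; rewrite tn s1.
Qed.

Definition mxflat m n (F : R -> 'M[R]_(m, n)) (M : 'M[R]_(m, n)) :=
  forall i j, flat (fun t => F t i j) (M i j).

Lemma mxflat_cst m n (M : 'M[R]_(m, n)) : mxflat (fun=> M) M.
Proof. by move=> i j; exact: flat_cst. Qed.

Lemma mxflatM m n p F G (A : 'M[R]_(m, n)) (B : 'M[R]_(n, p)) :
  mxflat F A -> mxflat G B -> mxflat (fun t => F t *m G t) (A *m B).
Proof.
move=> hF hG i j; rewrite mxE; under eq_fun do rewrite mxE.
by apply: flat_sum => k _; exact: flatM.
Qed.

Lemma flat_tr n F (A : 'M[R]_n) : mxflat F A -> flat (fun t => \tr (F t)) (\tr A).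
Proof. by move=> h; apply: flat_sum => i _. Qed.

Lemma flat_det n F (A : 'M[R]_n) : mxflat F A -> flat (fun t => \det (F t)) (\det A).
Proof.
by move=> h; apply: flat_sum => s _; apply: flatM; [exact: flat_cst|exact: flat_prod].
Qed.

Lemma mxflatV n F (A : 'M[R]_n) : A \in unitmx -> mxflat F A ->
  mxflat (fun t => invmx (F t)) (invmx A).
Proof.
rewrite unitmxE unitfE => d0 hF i j; have hd := flat_det hF.
have h : flat (fun t => (\det (F t))^-1 * cofactor (F t) j i) (invmx A i j).
  rewrite /invmx unitmxE unitfE d0 !mxE.
  apply: flatM; first exact: flatV.
  apply: flatM; first exact: flat_cst.
  by apply: flat_det => a b; rewrite !mxE; under eq_fun do rewrite !mxE; exact: hF.
have un : \forall t \near (0 : R)^', \det (F t) != 0.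
  exact: cvgr_neq0 (flat_cvg hd) d0.
apply: cvg_near_ext h _ _ => //; apply: filterS un => t dt /=.
by rewrite [in RHS]/invmx unitmxE unitfE dt !mxE.
Qed.

(* Only the first-order behaviour of a flat factor matters for a derivative at 0. *)
Lemma flat_mul_quotient (w H : R -> R) (l l' : R) : flat w l -> w 0 = l ->
  t^-1 * (H t - H 0) @[t --> (0 : R)^'] --> l' ->
  t^-1 * (w t * H t - w 0 * H 0) @[t --> (0 : R)^'] --> l * l'.
Proof.
move=> hw w0 hH; have t0 : (t : R) @[t --> (0 : R)^'] --> (0 : R).
  by apply: cvg_dnbhs; exact: cvg_id.
have cH : H t @[t --> (0 : R)^'] --> H 0.
  apply: cvg_near_ext (cvgD (cvgM t0 hH) (cvg_cst (H 0))) _ _; last by rewrite mul0r add0r.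
  by apply: filterS (near_dnbhs0_neq0 R) => t tn0 /=; rewrite mulrA mulfV // mul1r subrK.
by apply: cvg_ext (cvgD (cvgM hw cH) (cvgM (cvg_cst l) hH)) _ _ => [t|]; rewrite ?mul0r ?add0r //= w0; ring.
Qed.

End Flat.

Section LaplacianAtCenter.
Variables (R : realType) (N : nat).
Notation d := (dimSO N).
Implicit Types (g h : 'M[R]_N) (i j k : 'I_d) (f : 'M[R]_N -> R).

Notation pgen k := (gen R (plane k).1 (plane k).2).

Lemma tr_cinv (x : 'rV[R]_d) : (cinv x)^T = invmx (1%:M + 2^-1 *: skew x).
Proof.
by rewrite /cinv trmx_inv linearB linearZ /= trmx1 tr_skew scalerN opprK.
Qed.

(** By bi-invariance g and h drop out, and x enters only through P^T P and P P^T for P =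
    [cinv x]. *)
Lemma chart_gram g h x i j : SO g -> SO h -> gram (chart g h) x i j =
  2^-1 * \tr ((pgen i)^T *m ((cinv x)^T *m cinv x) *m pgen j *m (cinv x *m (cinv x)^T)).
Proof.
move=> gS hS; rewrite mxE /metric; have cS := chart_SO x gS hS.
have -> : invmx (chart g h x) = (chart g h x)^T.
  have u : chart g h x \in unitmx by rewrite unitmxE (proj2 cS) unitr1.
  by apply: (can_inj (mulmxK u)); rewrite mulVmx // (proj1 cS).
have e (C V W : 'M[R]_N) : SO C -> (C^T *m V)^T *m (C^T *m W) = V^T *m W.
  by move=> CS; rewrite trmx_mul trmxK mulmxA -(mulmxA V^T) SO_mulVr // mulmx1.
rewrite e // !chart_partial !trmx_mul; congr (_ * _).
set P := cinv x; set G := pgen i; set G' := pgen j.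
have -> : h^T *m (P^T *m (G^T *m (P^T *m g^T))) *m (g *m P *m G' *m P *m h) =
   h^T *m (P^T *m (G^T *m (P^T *m (g^T *m g) *m P) *m G' *m P) *m h).
  by rewrite !mulmxA.
rewrite (proj1 gS) mulmx1 mxtrace_mulC -!mulmxA (SO_mulVr hS) mulmx1.
by rewrite mxtrace_mulC !mulmxA.
Qed.

(** The factor 1/2 in the metric makes the standard generators unit vectors. *)
Lemma pgen_orthonormal i j : 2^-1 * \tr ((pgen i)^T *m pgen j) = (i == j)%:R.
Proof.
have te (a b : 'I_N) : \tr (delta_mx a b : 'M[R]_N) = (a == b)%:R.
  rewrite /mxtrace (bigD1 a) //= big1 ?addr0 => [|c ca]; rewrite mxE ?eqxx //=.
  by rewrite (negPf ca).
have dm (a b c e : 'I_N) :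
    delta_mx a b *m delta_mx c e = (b == c)%:R *: delta_mx a e :> 'M[R]_N.
  by case: eqP => [->|/eqP bc]; rewrite ?mul_delta_mx ?mul_delta_mx_0 ?scale1r ?scale0r.
have pi := plane_lt i; have pj := plane_lt j.
have -> : (i == j) = (plane i == plane j) by rewrite (inj_eq (@plane_inj N)).
rewrite tr_gen; case: (plane i) (plane j) pi pj => [a b] [c e] /= ab ce.
rewrite mulNmx /gen mulmxBl !mulmxBr !dm linearN !linearB !linearZ /= !te.
have ne : (b == c) && (a == e) = false.
  by apply/negP => /andP[/eqP bc /eqP ae]; rewrite bc ae in ab; lia.
rewrite xpair_eqE /GRing.scale /=.
move: ne; case: (b == c); case: (a == e) => //= _;
  by case: (a == c); case: (b == e); rewrite /= ?mulr1n ?mulr0n; field.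
Qed.

(** On the coordinate line both products are the inverse of (1 - t L/2)(1 + t L/2) = 1 - t^2 L^2 /
    4, which has no first-order term. *)
Lemma cinv_gram_flat k :
  mxflat (fun t => (cinv (t *: delta_mx 0 k + 0))^T *m cinv (t *: delta_mx 0 k + 0)) (1%:M : 'M[R]_N)
  /\ mxflat (fun t => cinv (t *: delta_mx 0 k + 0) *m (cinv (t *: delta_mx 0 k + 0))^T) (1%:M : 'M[R]_N).
Proof.
pose L := pgen k; pose M t := 1%:M - (t ^+ 2 / 4) *: (L *m L) : 'M[R]_N.
have sk t : skew (t *: delta_mx 0 k + 0) = t *: L by rewrite addr0 skewZ skew_delta.
have Mf : mxflat (fun t => invmx (M t)) 1%:M.
  rewrite -(@invmx1 R N); apply: mxflatV; first exact: unitmx1.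
  move=> i j; have t0 : (t * (- (L *m L) i j / 4)) @[t --> (0 : R)^'] --> 0 * (- (L *m L) i j / 4).
    by apply: cvgM; [apply: cvg_dnbhs; exact: cvg_id|exact: cvg_cst].
  apply: cvg_near_ext t0 _ _; last by rewrite mul0r.
  apply: filterS (near_dnbhs0_neq0 R) => t tn0; rewrite /M.
  move: (L *m L) => LL; rewrite !mxE; move: ((i == j)%:R : R) => z; by field.
have E1 t : (1%:M - 2^-1 *: (t *: L)) *m (1%:M + 2^-1 *: (t *: L)) = M t.
  rewrite mulmxBl !mulmxDr !mul1mx mulmx1 /M -!scalemxAl -!scalemxAr.
  by move: (L *m L) => LL; apply/matrixP => a b; rewrite !mxE; field.
have E2 t : (1%:M + 2^-1 *: (t *: L)) *m (1%:M - 2^-1 *: (t *: L)) = M t.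
  rewrite mulmxDl !mulmxBr !mul1mx mulmx1 /M -!scalemxAl -!scalemxAr.
  by move: (L *m L) => LL; apply/matrixP => a b; rewrite !mxE; field.
have u1 t : 1%:M - 2^-1 *: (t *: L) \in unitmx by rewrite -sk cinv_unit.
have u2 t : 1%:M + 2^-1 *: (t *: L) \in unitmx.
  by have := u1 (- t); rewrite scaleNr scalerN opprK.
have uM t : M t \in unitmx by rewrite -E1 unitmx_mul u1 u2.
split=> i j; apply: cvg_ext (Mf i j) _ _ => // t; congr (_ * (fun_of_matrix _ _ _ - _));
  rewrite tr_cinv /cinv sk; apply: (can_inj (mulmxK (uM t))); rewrite mulVmx //.
  by rewrite -E1 !mulmxA mulmxKV // mulVmx.
by rewrite -E2 !mulmxA mulmxKV // mulVmx.
Qed.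

Section Center.
Variables g h : 'M[R]_N.
Hypotheses (gS : SO g) (hS : SO h).
Let phi := chart g h.

Lemma cinv0 : cinv (0 : 'rV[R]_d) = 1%:M.
Proof. by rewrite /cinv linear0 scaler0 subr0 invmx1. Qed.

Lemma gram_center : gram phi 0 = 1%:M.
Proof.
apply/matrixP => i j; rewrite chart_gram // cinv0 trmx1 !mulmx1 mxE.
exact: pgen_orthonormal.
Qed.

Lemma gram_flat k : mxflat (fun t => gram phi (t *: delta_mx 0 k + 0)) 1%:M.
Proof.
move=> i j; have [f1 f2] := cinv_gram_flat k.
have := flatM (flat_cst 2^-1) (flat_tr (mxflatM (mxflatM (mxflatM (mxflat_cst (pgen i)^T) f1)
  (mxflat_cst (pgen j))) f2)).
rewrite !mulmx1 pgen_orthonormal => H; apply: cvg_ext H _ _ => // t.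
by rewrite [in RHS]chart_gram // mxE.
Qed.

Lemma volume_density_flat k :
  flat (fun t => volume_density phi (t *: delta_mx 0 k + 0)) 1.
Proof. by apply: flat_sqrt; rewrite -(@det1 R d); apply: flat_det; exact: gram_flat. Qed.

Lemma volume_density_center : volume_density phi 0 = 1.
Proof. by rewrite /volume_density gram_center det1 sqrtr1. Qed.

Lemma partial_quotient (F : 'rV[R]_d -> R) k : derivable F 0 (delta_mx 0 k) ->
  t^-1 * (F (t *: delta_mx 0 k + 0) - F 0) @[t --> (0 : R)^'] --> partial k F 0.
Proof. by []. Qed.

Lemma partial_lim (G : 'rV[R]_d -> R) k l :
  t^-1 * (G (t *: delta_mx 0 k + 0) - G 0) @[t --> (0 : R)^'] --> l -> partial k G 0 = l.
Proof. by move=> Gl; apply: cvg_lim. Qed.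

(** The coefficients under the outer derivative are flat with the identity matrix as value, so they
    contribute nothing to the derivative at 0. *)
Lemma laplace_center f : smooth_on setT (f \o phi) ->
  laplace_beltrami phi f 0 = \sum_k partial k (partial k (f \o phi)) 0.
Proof.
move=> sf; rewrite /laplace_beltrami volume_density_center invr1 mul1r.
apply: eq_bigr => k _; set F := f \o phi.
have [_ /(_ _)c1] := sf 2%N.
have D2 j : derivable (partial j F) 0 (delta_mx 0 k).
  by have [_ [_ /(_ k)[dd _]]] := c1 j; exact: dd.
pose w j t := volume_density phi (t *: delta_mx 0 k + 0) *
   invmx (gram phi (t *: delta_mx 0 k + 0)) k j.
have w_flat j : flat (w j) ((k == j)%:R).
  have := flatM (volume_density_flat k) (mxflatV (unitmx1 _ _) (gram_flat k) k j).
  by rewrite invmx1 mxE mul1r.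
have w0 j : w j 0 = (k == j)%:R.
  by rewrite /w scale0r addr0 volume_density_center gram_center invmx1 mxE mul1r.
have H j := flat_mul_quotient (w_flat j) (w0 j) (H := fun t => partial j F (t *: delta_mx 0 k + 0)).
have {}H j : t^-1 * (w j t * partial j F (t *: delta_mx 0 k + 0) -
    w j 0 * partial j F (0 *: delta_mx 0 k + 0)) @[t --> (0 : R)^'] -->
    (k == j)%:R * partial k (partial j F) 0.
  by apply: H; rewrite scale0r addr0; exact: partial_quotient.
pose Q t j := t^-1 * (w j t * partial j F (t *: delta_mx 0 k + 0) -
    w j 0 * partial j F (0 *: delta_mx 0 k + 0)).
have S : \sum_j Q t j @[t --> (0 : R)^'] --> \sum_j (k == j)%:R * partial k (partial j F) 0.
  by apply: cvg_sum => j _; exact: H.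
set G := (X in partial k X 0).
have GE t : G (t *: delta_mx 0 k + 0) = \sum_j w j t * partial j F (t *: delta_mx 0 k + 0).
  by rewrite /G mulr_sumr; apply: eq_bigr => j _; rewrite mulrA.
have G0 : G 0 = \sum_j w j 0 * partial j F (0 *: delta_mx 0 k + 0).
  by rewrite -GE scale0r addr0.
apply: partial_lim; apply: cvg_ext S _ _ => [t|].
  by rewrite GE G0 -mulr_sumr -sumrB.
rewrite (bigD1 k) //= eqxx mul1r big1 ?addr0 // => j jk.
by rewrite eq_sym (negPf jk) mul0r.
Qed.

End Center.

(** The eigenvalue equation is read at the center of [chart g h]. As [tau] is odd, a second
    difference along rotations by t is one along a coordinate axis with step tau(t), and tau(t)/t
    tends to 1. *)
Theorem eigenspace_spectral mu f : eigenspace_LB mu f -> spectral mu f.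
Proof.
move=> [sm ev].
have smooth g h : SO g -> SO h -> smooth_on setT (f \o chart g h).
  by move=> gS hS; apply: sm; exact: chart_local_parametrization.
have c0 g h : chart g h 0 = g *m h.
  by rewrite /chart linear0 cay0 mulmx1.
split.
- apply/subspace_continuousP => g gS.
  pose F := f \o chart g 1%:M.
  have [cF _] := smooth g 1%:M gS (@SO1 R N) 0%N.
  have u : 1%:M + g^T *m g *m (1%:M)^T \in unitmx.
    rewrite (proj1 gS) trmx1 mulmx1; have := @add1_cay_unit R N 0.
    by rewrite cay0 trmx0 oppr0; apply.
  have inv0 : chart_inv g 1%:M g = 0.
    by have := chartK 0 gS (@SO1 R N); rewrite c0 mulmx1.
  have ci : chart_inv g 1%:M y @[y --> within (@SO R N) (nbhs g)] --> (0 : 'rV[R]_d).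
    by rewrite -inv0; apply: chart_inv_cvg => //; exact: cvg_within.
  have h : F (chart_inv g 1%:M y) @[y --> within (@SO R N) (nbhs g)] --> f g.
    have -> : f g = F 0 by rewrite /F /= c0 mulmx1.
    exact: cvg_comp _ _ ci (cF 0 I).
  have H : f y @[y --> within (@SO R N) (nbhs g)] --> f g.
    apply: cvg_trans h; apply: near_eq_cvg.
    have u1 : \forall y \near within (@SO R N) (nbhs g),
        \det (1%:M + g^T *m y *m (1%:M)^T) != 0.
      have dc : \det (1%:M + g^T *m y *m (1%:M)^T) @[y --> within (@SO R N) (nbhs g)] -->
          \det (1%:M + g^T *m g *m (1%:M)^T).
        by apply: cvg_det; apply: cvg_add1; exact: cvg_within.
      by apply: cvgr_neq0 dc _; rewrite -unitfE -unitmxE.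
    have SOw : \forall y \near within (@SO R N) (nbhs g), SO y by exact: withinT.
    apply: filterS2 u1 SOw => y yu yS /=.
    by rewrite /F /= chart_invK //; [exact: SO1|rewrite unitmxE unitfE].
  exact: H.
- move=> g h gS hS; set F := f \o chart g h; have sF := smooth g h gS hS.
  have [_ c1] := sF 2%N.
  have l2 k : (t ^+ 2)^-1 * (F (t *: delta_mx 0 k) + F (- t *: delta_mx 0 k) - 2 * F 0)
     @[t --> (0 : R)^'] --> partial k (partial k F) 0.
    have [d1 [_ c2]] := c1 k; have [d2 _] := c2 k.
    have := @second_difference R (fun s => F (s *: delta_mx 0 k + 0))
      (fun s => partial k F (s *: delta_mx 0 k + 0)) _ (partial_line 0 _).
    rewrite scale0r addr0 => H; apply: cvg_ext (H _ _ _) _ _ => //.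
    + by move=> x; apply: d1.
    + exact: partial_quotient (d2 0 I).
    + by move=> t; rewrite !addr0.
  have L : (t ^+ 2)^-1 * (\sum_k (F (t *: delta_mx 0 k) + F (- t *: delta_mx 0 k) - 2 * F 0))
     @[t --> (0 : R)^'] --> - mu * f (g *m h).
    pose Q t k := (t ^+ 2)^-1 * (F (t *: delta_mx 0 k) + F (- t *: delta_mx 0 k) - 2 * F 0).
    have S : \sum_k Q t k @[t --> (0 : R)^'] --> \sum_k partial k (partial k F) 0.
      by apply: cvg_sum => k _; exact: l2.
    apply: cvg_ext S _ _ => [t|]; first by rewrite mulr_sumr.
    rewrite -laplace_center // -[LHS]opprK (ev _ _ (chart_local_parametrization gS hS)) //.
    by rewrite c0 mulNr.
  have Lt : (tau t ^+ 2)^-1 *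
      (\sum_k (F (tau t *: delta_mx 0 k) + F (- tau t *: delta_mx 0 k) - 2 * F 0))
     @[t --> (0 : R)^'] --> - mu * f (g *m h) := cvg_comp _ _ (@tau_dnbhs R) L.
  have tq := @tau_quotient R.
  have {}Lt : t^-1 * tau t * (t^-1 * tau t) * ((tau t ^+ 2)^-1 *
      (\sum_k (F (tau t *: delta_mx 0 k) + F (- tau t *: delta_mx 0 k) - 2 * F 0)))
     @[t --> (0 : R)^'] --> 1 * 1 * (- mu * f (g *m h)).
    by apply: cvgM Lt; exact: cvgM.
  apply: cvg_near_ext Lt _ _; last by rewrite mulr1 mul1r.
  have tne : \forall t \near (0 : R)^', tau t != 0.
    by have := @tau_dnbhs R _ (near_dnbhs0_neq0 R).
  apply: filterS3 tne (near_cosD1 R) (near_dnbhs0_neq0 R) => t t0 ct tn0 /=.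
  have -> : \sum_k second_diff f g h k t =
     \sum_k (F (tau t *: delta_mx 0 k) + F (- tau t *: delta_mx 0 k) - 2 * F 0).
    apply: eq_bigr => k _; rewrite /second_diff /F /= c0 /chart !skewZ skew_delta /prot.
    rewrite !rot_cay ?plane_neq ?cosN //.
    by rewrite /tau sinN mulrN mulNr.
  by field; rewrite t0 tn0.
- move=> g h gS hS; set F := f \o chart g h.
  have [cF1 c1] := smooth g h gS hS 1%N.
  exists (fun k => partial k F 0) => x.
  have H := @C1_directional R d F (fun k x => (c1 k).1 x I) (fun k x => (c1 k).2.1 x I) x.
  apply: cvg_ext H _ _ => // t.
  by rewrite /F /= c0 /chart skewZ.
Qed.

End LaplacianAtCenter.

(** * Gaps in the spectrum *)

Section Counting.
Variables (R : realType) (N : nat).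

Lemma multiplicity_nonint (mu : R) : ~ (exists z : int, mu = z%:~R) ->
  multiplicity N mu = 0%E.
Proof.
move=> nz; have van (f : 'M[R]_N -> R) g : eigenspace_LB mu f -> SO g -> f g = 0.
  move=> ef gS; apply: contrapT => /eqP f0; apply: nz.
  exact: spectral_int (eigenspace_spectral ef) gS f0.
apply/eqP; rewrite eq_le; apply/andP; split.
  apply: ge_ereal_sup => _ [k [F eF iF] <-].
  case: k F eF iF => [|k] F eF iF //.
  have e g : SO g -> \sum_i 1 * F i g = 0.
    by move=> gS; rewrite big1 // => i _; rewrite (van _ _ (eF i) gS) mulr0.
  by have /eqP := iF (fun=> 1) e ord0; rewrite oner_eq0.
apply: ereal_sup_ubound; exists 0%N => //; exists (fun _ _ => 0) => [[]//|c _ []//].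
Qed.

(** The two sums are compared term by term: they differ only at values in (k, k + 1/2], which are
    not integers and have multiplicity 0. *)
Lemma eigenvalue_count_gap (k : nat) :
  eigenvalue_count N (k%:R : R) = eigenvalue_count N (k%:R + 2^-1).
Proof.
rewrite /eigenvalue_count esum_mkcond [in RHS]esum_mkcond; congr fine.
apply: eq_esum => mu _.
have e (l : R) : (mu \in [set m : R | m <= l]) = (mu <= l) by apply/idP/idP; rewrite inE.
rewrite !e.
have [mk|mk] := lerP mu k%:R; first by rewrite ifT // (le_trans mk) // lerDl.
case: ifP => // mk2; apply/esym/multiplicity_nonint => -[z zE].
move: mk mk2; rewrite zE -[k%:R]/(k%:Z%:~R) ltr_int => kz.
have : (k%:Z + 1)%:~R <= z%:~R :> R by rewrite ler_int; lia.
by rewrite intrD; lra.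
Qed.

End Counting.

Lemma gapped_count_remainder (R : realType) (n : R -> R) (C p : R) : 1 <= p -> C != 0 ->
  (forall k : nat, n k%:R = n (k%:R + 2^-1)) ->
  ~ (forall eps : R, 0 < eps -> \forall x \near pinfty_nbhs R,
       `|n x - C * x `^ p| <= eps * `|x `^ (p - 1)|).
Proof.
move=> p1 C0 gap H; have p0 : 0 < p by lra.
have Cp : 0 < `|C| by rewrite normr_gt0.
set T := 2 `^ (p - 1) : R; have Tp : 0 < T by apply: powR_gt0.
(* For a = k >= 1 and b = a + 1/2 <= 2 a one has B <= T A. With this choice of eps the two errors
   add up to at most |C| A / 4, while the main term grows by at least |C| A / 2. *)
have e0 : 0 < `|C| / (8 * T) by rewrite divr_gt0 // mulr_gt0.
have [M [_ HM]] := H _ e0.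
set k := (Num.truncn `|M|).+1.
have Mk : M < k%:R by apply: le_lt_trans (ler_norm M) _; exact: truncnS_gt.
have k1 : 1 <= k%:R :> R by rewrite ler1n.
set a := k%:R : R in Mk k1; pose b := a + 2^-1.
have a0 : 0 <= a by lra.
have b0 : 0 <= b by rewrite /b; lra.
have ha := HM a Mk; have hb := HM b (lt_trans Mk _); have {}hb := hb ltac:(rewrite /b; lra).
rewrite /b -gap -/a -/b in hb.
set A := a `^ (p - 1) in ha; set B := b `^ (p - 1) in hb.
have A0 : 0 < A by apply: powR_gt0; lra.
have AB : A <= B by apply: ge0_ler_powR; rewrite ?nnegrE /b //; lra.
have BT : B <= T * A.
  rewrite /T /A -powRM //; apply: ge0_ler_powR; rewrite ?nnegrE /b //; lra.
have B0 : 0 < B by lra.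
have aE : a `^ p = a * A by rewrite mulr_powRB1.
have bE : b `^ p = b * B by rewrite mulr_powRB1.
rewrite aE (gtr0_norm A0) in ha; rewrite bE (gtr0_norm B0) in hb.
have d : `|C| * (b * B - a * A) <= `|C| / (8 * T) * A + `|C| / (8 * T) * B.
  apply: le_trans (lerD ha hb).
  have -> : `|C| * (b * B - a * A) = `|(n a - C * (a * A)) - (n a - C * (b * B))|.
    rewrite -[X in _ * X]ger0_norm -?normrM; first by congr `|_|; ring.
    by rewrite /b; nra.
  exact: ler_normB.
have : `|C| / (8 * T) * A + `|C| / (8 * T) * B <= `|C| / 4 * A.
  have T1 : 1 <= T by rewrite /T -[leLHS](powRr0 2); apply: ler_powR; lra.
  have -> : `|C| / 4 * A = `|C| / (8 * T) * (2 * T * A) by field; rewrite gt_eqF.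
  have TA : A <= T * A by rewrite ler_peMl // ltW.
  by rewrite -mulrDr ler_wpM2l ?(ltW e0) //; lra.
have : `|C| * (2^-1 * A) <= `|C| * (b * B - a * A).
  by rewrite ler_wpM2l // /b; nra.
nra.
Qed.

(** * The Weyl constant *)

Section Integrals.
Context {R : realType}.

(* Unlike [ge0_le_integral], this needs no measurability. *)
Lemma le_integral_nonneg d (T : measurableType d) (mu : {measure set T -> \bar R})
    (f g : T -> \bar R) : (forall x, 0 <= f x)%E -> (forall x, f x <= g x)%E ->
  (\int[mu]_x f x <= \int[mu]_x g x)%E.
Proof.
move=> f0 fg; have g0 x : (0 <= g x)%E := le_trans (f0 x) (fg x).
rewrite !ge0_integralTE //; apply: le_ereal_sup => _ [h hf <-].
by exists h => // x; exact: le_trans (hf x) (fg x).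
Qed.

Lemma integral_Rn_ge0 n (f : 'rV[R]_n -> \bar R) : (forall x, 0 <= f x)%E ->
  (0 <= integral_Rn f)%E.
Proof.
elim: n f => [|n IHn] f f0 /=; first exact: f0.
by apply: integral_ge0 => t _; apply: IHn.
Qed.

Lemma le_integral_Rn n (f g : 'rV[R]_n -> \bar R) : (forall x, 0 <= f x)%E ->
  (forall x, f x <= g x)%E -> (integral_Rn f <= integral_Rn g)%E.
Proof.
elim: n f g => [|n IHn] f g f0 fg /=; first exact: fg.
apply: le_integral_nonneg => t; first by apply: integral_Rn_ge0.
by apply: IHn.
Qed.

(** Cubes are used because their iterated integral is computed one coordinate at a time; they bound
    the volume integrals from below for positivity and from above for finiteness. *)
Definition box n (x0 : 'rV[R]_n) (r : R) (y : 'rV[R]_n) : bool :=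
  [forall i, `|y 0 i - x0 0 i| <= r].

Lemma integral_Rn_box n (x0 : 'rV[R]_n) (r c : R) : 0 <= r -> 0 <= c ->
  integral_Rn (fun y => if box x0 r y then c%:E else 0%E) = (c * (2 * r) ^+ n)%:E.
Proof.
move=> r0; elim: n x0 c => [|n IHn] x0 c c0 /=.
  by rewrite /box ifT ?mulr1 //; apply/forallP => -[].
pose a := x0 0 0; pose x1 : 'rV[R]_n := \row_i x0 0 (lift 0 i).
have boxE (t : R) (y : 'rV[R]_n) :
    box x0 r (row_mx (t%:M : 'rV_1) y) = (`|t - a| <= r) && box x1 r y.
  have e0 : (row_mx (t%:M : 'rV_1) y) 0 (0 : 'I_(1 + n)) = t.
    by rewrite mxE; case: fintype.splitP => // j _; rewrite (ord1 j) mxE mulr1n.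
  have e1 i : (row_mx (t%:M : 'rV_1) y) 0 (lift 0 i : 'I_(1 + n)) = y 0 i.
    rewrite mxE; case: fintype.splitP => [j|j [] /val_inj -> //].
    by rewrite (ord1 j).
  apply/forallP/andP => [h|[h1 /forallP h2] i].
    split; first by have := h 0; rewrite e0.
    by apply/forallP => i; have := h (lift 0 i); rewrite e1 mxE.
  case: (unliftP 0 i) => [j ->|->]; last by rewrite e0.
  by rewrite e1; have := h2 j; rewrite mxE.
transitivity (\int[lebesgue_measure]_(t in `[(a - r)%R, (a + r)%R]%classic) (cst (c * (2 * r) ^+ n)%R%:E) t)%E.
  rewrite [RHS]integral_mkcond; apply: eq_integral => t _ /=.
  have E : (t \in `[a - r, a + r]%classic) = (`|t - a| <= r).
    by rewrite mem_setE in_itv /= ler_distl.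
  rewrite patchE E; case: ifP => ta.
    by rewrite -(IHn x1) //; congr integral_Rn; apply/funext => y; rewrite boxE ta.
  rewrite (_ : (fun _ => _) = fun y => if box x1 r y then 0%:E else 0%E).
    by rewrite IHn // mul0r.
  by apply/funext => y; rewrite boxE ta /=; case: ifP.
rewrite integral_cst //= lebesgue_measure_itv /= lte_fin.
case: ltP => h; last first.
  have -> : r = 0 by lra.
  by rewrite mulr0 exprS mul0r mulr0 mule0.
by rewrite -EFinB -EFinM exprS; congr (_%:E); ring.
Qed.

(** The inequality x <= exp x at x = t / (2 p), raised to the power p. It bounds the integrand of
    [Gamma] by a multiple of the exponential density of rate 1/2. *)
Lemma powR_le_expR (p t : R) : 0 < p -> 0 < t -> t `^ p <= (2 * p) `^ p * expR (t / 2).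
Proof.
move=> p0 t0; have p2 : 0 < 2 * p by rewrite mulr_gt0.
have h : t <= 2 * p * expR (t / (2 * p)).
  have := expR_ge1Dx (t / (2 * p)) => h.
  have : t / (2 * p) <= expR (t / (2 * p)) by lra.
  by rewrite ler_pdivrMr // mulrC.
apply: (@le_trans _ _ ((2 * p * expR (t / (2 * p))) `^ p)).
  apply: ge0_ler_powR h; rewrite ?nnegrE ?mulr_ge0 ?expR_ge0 ?(ltW p2) ?(ltW p0) //.
  exact: ltW.
have E x : expR x `^ p = expR (p * x) by rewrite /powR gt_eqF ?expR_gt0 // expRK.
rewrite powRM ?expR_ge0 ?(ltW p2) // E.
by have -> : p * (t / (2 * p)) = t / 2 by field; rewrite gt_eqF.
Qed.

(** The real-valued integral would be 0 if the extended one were infinite, so an upper bound is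
    proved besides the lower one. On [1, 2] the integrand is at least exp(- 2). *)
Lemma Gamma_gt0 (s : R) : 1 < s -> 0 < Gamma s.
Proof.
move=> s1; set p := s - 1; have p0 : 0 < p by rewrite subr_gt0.
pose f (t : R) := (t `^ p * expR (- t))%:E; pose F := f \_ `]0, +oo[%classic.
rewrite /Gamma /Rintegral integral_mkcond.
rewrite -[X in integral _ _ X]/F.
have F0 t : (0 <= F t)%E.
  rewrite /F patchE; case: ifP => // _.
  by rewrite /f lee_fin mulr_ge0 ?powR_ge0 ?expR_ge0.
have tD (t : R) : (t \in `]0, +oo[%classic) = (0 < t).
  by rewrite mem_setE in_itv /= andbT.
have up : (\int[lebesgue_measure]_x F x <= ((2 * p) `^ p * 2)%:E)%E.
  pose K := (2 * p) `^ p * 2; have K0 : 0 <= K by rewrite mulr_ge0 ?powR_ge0.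
  have e0 x : 0 <= exponential_pdf (2^-1) x :> R by rewrite exponential_pdf_ge0.
  apply: (@le_trans _ _ (\int[lebesgue_measure]_x (K%:E * (exponential_pdf 2^-1 x)%:E))%E).
    apply: le_integral_nonneg => // t; rewrite /F patchE tD; case: ifP => t0; last first.
      by rewrite -EFinM lee_fin mulr_ge0.
    rewrite /f -EFinM lee_fin (exponential_pdfE _ (ltW t0)).
    apply: (@le_trans _ _ ((2 * p) `^ p * expR (t / 2) * expR (- t))).
      by rewrite ler_wpM2r ?expR_ge0 // powR_le_expR.
    rewrite -mulrA -expRD /K -!mulrA ler_wpM2l ?powR_ge0 // mulrA mulfV // mul1r.
    by rewrite ler_expR; lra.
  rewrite ge0_integralZl //.
  - by rewrite integral_exponential_pdf ?invr_gt0 // mule1.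
  - by apply/measurable_realfun.measurable_EFinP; exact: measurable_exponential_pdf.
  - by move=> x _; rewrite lee_fin.
have low : ((expR (- 2))%:E <= \int[lebesgue_measure]_x F x)%E.
  apply: (@le_trans _ _ (\int[lebesgue_measure]_(x in `[1%R, 2%R]%classic) (cst (expR (- 2))%:E) x)%E).
    rewrite integral_cst //= lebesgue_measure_itv /= lte_fin.
    rewrite (_ : (1 < 2)%R = true); last by apply/idP; lra.
    by rewrite -EFinB -EFinM lee_fin; lra.
  rewrite integral_mkcond; apply: le_integral_nonneg => t.
    by rewrite patchE; case: ifP => // _; rewrite lee_fin expR_ge0.
  rewrite [X in (X <= _)%E]patchE mem_setE in_itv /=; case: ifP => // /andP[t1 t2].
  rewrite /F patchE tD ifT; last by lra.
  rewrite /f lee_fin -[leLHS]mul1r ler_pM ?expR_ge0 ?ler_expR ?lerN2 //.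
  have e : 1 `^ p = 1 :> R by rewrite powR1.
  by rewrite -[leLHS]e; apply: ge0_ler_powR; rewrite ?nnegrE //; lra.
apply: fine_gt0; apply/andP; split.
  by apply: lt_le_trans low; rewrite lte_fin expR_gt0.
by apply: le_lt_trans up _; rewrite ltry.
Qed.

End Integrals.

Section PositiveDefinite.
Variable R : realType.

(** The segment from [M] to the identity consists of positive definite, hence invertible matrices,
    so the determinant cannot change sign along it. *)
Lemma posdef_det n (M : 'M[R]_n) :
  (forall v : 'rV[R]_n, v != 0 -> 0 < (v *m M *m v^T) 0 0) -> 0 < \det M.
Proof.
move=> pos; pose H t := t *: 1%:M + (1 - t) *: M.
have v2 (v : 'rV[R]_n) : v != 0 -> 0 < (v *m v^T) 0 0.
  move=> v0; rewrite lt_neqAle eq_sym; apply/andP; split.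
    by apply: contraNneq v0 => /row_normsq_eq0 ->.
  by rewrite mxE; apply: sumr_ge0 => k _; rewrite mxE -expr2 sqr_ge0.
have dn t : 0 <= t <= 1 -> \det (H t) != 0.
  move=> /andP[t0 t1]; apply/negP => /det0P[v v0 vH].
  have : (v *m H t *m v^T) 0 0 = 0 by rewrite vH mul0mx mxE.
  rewrite /H mulmxDr -!scalemxAr mulmx1 mulmxDl -!scalemxAl.
  have := pos v v0; have := v2 v v0; rewrite !mxE => a b; nra.
have cH : continuous (fun t => \det (H t)).
  move=> t; apply: (@cvg_det R _ (nbhs t) _ n H); apply: cvg_mx_entry => i j.
  rewrite !mxE; under eq_fun do rewrite !mxE.
  apply: cvgD; apply: cvgM; try exact: cvg_cst; first exact: cvg_id.
  by apply: cvgB; [exact: cvg_cst|exact: cvg_id].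
have H0 : H 0 = M by rewrite /H scale0r add0r subr0 scale1r.
have H1 : H 1 = 1%:M by rewrite /H subrr scale0r addr0 scale1r.
rewrite ltNge; apply/negP => d0.
have [||c cI c0] := @IVT R (fun t => \det (H t)) 0 1 0 ler01 _ _.
- exact: continuous_subspaceT.
- by rewrite H0 H1 det1 ge_min d0 /= le_max ler01 orbT.
by move: cI; rewrite in_itv /= => /dn; rewrite c0 eqxx.
Qed.

End PositiveDefinite.

(** * Existence and positivity of the Riemannian volume *)

Section Volume.
Variables (R : realType) (N : nat).
Notation d := (dimSO N).
Implicit Types (U : set 'rV[R]_d) (phi : 'rV[R]_d -> 'M[R]_N).

Lemma SO_unit (g : 'M[R]_N) : SO g -> g \in unitmx.
Proof. by case=> _ g1; rewrite unitmxE g1 unitr1. Qed.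

Lemma frobenius_ge0 (A : 'M[R]_N) : 0 <= \tr (A^T *m A).
Proof.
by apply: sumr_ge0 => i _; rewrite mxE; apply: sumr_ge0 => j _; rewrite mxE -expr2 sqr_ge0.
Qed.

Lemma frobenius_eq0 (A : 'M[R]_N) : \tr (A^T *m A) = 0 -> A = 0.
Proof.
move/eqP; rewrite psumr_eq0; last first.
  by move=> i _; rewrite mxE; apply: sumr_ge0 => j _; rewrite mxE -expr2 sqr_ge0.
move=> /allP h; apply/matrixP => i j; have /= := h j (mem_index_enum _).
rewrite mxE psumr_eq0 => [/allP/(_ i (mem_index_enum _))|k _]; last first.
  by rewrite mxE -expr2 sqr_ge0.
by rewrite !mxE -expr2 sqrf_eq0 => /eqP.
Qed.

Lemma gram_quad phi x (v : 'rV[R]_d) : (v *m gram phi x *m v^T) 0 0 =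
  2^-1 * \tr ((invmx (phi x) *m \sum_i v 0 i *: partial i phi x)^T *m
              (invmx (phi x) *m \sum_i v 0 i *: partial i phi x)).
Proof.
pose V i := invmx (phi x) *m partial i phi x.
have e : invmx (phi x) *m \sum_i v 0 i *: partial i phi x = \sum_i v 0 i *: V i.
  by rewrite mulmx_sumr; apply: eq_bigr => i _; rewrite scalemxAr.
have eT : (\sum_i v 0 i *: V i)^T = \sum_i v 0 i *: (V i)^T.
  by rewrite linear_sum /=; apply: eq_bigr => i _; rewrite linearZ.
rewrite e eT mulmx_suml [\tr _]raddf_sum /= mulr_sumr -mulmxA mxE; apply: eq_bigr => i _.
rewrite mulmx_sumr [\tr _]raddf_sum /= mulr_sumr mxE mulr_sumr; apply: eq_bigr => j _.
by rewrite !mxE /metric -/(V i) -/(V j) -scalemxAr -scalemxAl !mxtraceZ; ring.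
Qed.

Lemma gram_det_gt0 U phi x : local_parametrization U phi -> U x -> 0 < \det (gram phi x).
Proof.
move=> [_ _ pS pI _] Ux; apply: posdef_det => v v0; rewrite gram_quad.
rewrite mulr_gt0 ?invr_gt0 // lt_neqAle frobenius_ge0 andbT eq_sym.
apply: contraNneq v0 => /frobenius_eq0 /(congr1 (mulmx (phi x))).
rewrite (mulKVmx (SO_unit (pS x Ux))) mulmx0.
by move/(pI x Ux (fun i => v 0 i)) => v0; apply/eqP/rowP => i; rewrite mxE v0.
Qed.

Lemma volume_density_gt0 U phi x : local_parametrization U phi -> U x ->
  0 < volume_density phi x.
Proof. by move=> lp Ux; rewrite sqrtr_gt0 (gram_det_gt0 lp Ux). Qed.

Lemma volume_density_cvg U phi x : local_parametrization U phi -> U x ->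
  volume_density phi y @[y --> x] --> volume_density phi x.
Proof.
move=> [_ sm pS _ _] Ux; have [c0 c1] := sm 1%N.
have [F [FF FE]] : exists F : set_system 'rV[R]_d, Filter F /\ F = nbhs x.
  by exists (nbhs x); split=> //; exact: nbhs_filter.
have cphi : phi y @[y --> F] --> phi x by rewrite FE; exact: c0.
have cp i : partial i phi y @[y --> F] --> partial i phi x.
  by rewrite FE; have [_ [c _]] := c1 i; exact: c.
have ci : invmx (phi y) @[y --> F] --> invmx (phi x).
  by apply: cvg_invmx cphi; apply: SO_unit; exact: pS.
have c i : invmx (phi y) *m partial i phi y @[y --> F] -->
      invmx (phi x) *m partial i phi x by exact: cvg_mulmx.
have gE y i j : gram phi y i j = metric (phi y) (partial i phi y) (partial j phi y).
  by rewrite [LHS]mxE.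
have cg : gram phi y @[y --> F] --> gram phi x.
  apply: cvg_mx_entry => i j.
  suff h : metric (phi y) (partial i phi y) (partial j phi y) @[y --> F] -->
      metric (phi x) (partial i phi x) (partial j phi x).
    by apply: cvg_ext h _ _ => [y|]; rewrite gE.
  apply: cvgM; first exact: cvg_cst.
  apply: cvg_sum => k _; apply: cvg_entry.
  by apply: cvg_mulmx (c j); exact: cvg_trmx.
have cd : \det (gram phi y) @[y --> F] --> \det (gram phi x) by exact: cvg_det.
have res : volume_density phi y @[y --> F] --> volume_density phi x.
  exact: cvg_comp cd (@sqrt_continuous R _).
by rewrite FE in res.
Qed.

Lemma box_norm n (x0 y : 'rV[R]_n) (r : R) : 0 <= r -> box x0 r y -> `|x0 - y| <= r.
Proof.
move=> r0 /forallP h; rewrite [leLHS]/Num.Def.normr/= mx_normrE (bigmax_le _ r0) //= => -[i j] _.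
by rewrite !mxE ord1 distrC.
Qed.

Lemma integral_Rn_gt0 n (F : 'rV[R]_n -> \bar R) (x0 : 'rV[R]_n) (c : R) :
  (forall x, 0 <= F x)%E -> 0 < c -> (\forall y \near x0, c%:E <= F y)%E ->
  (0 < integral_Rn F)%E.
Proof.
move=> F0 c0 /nbhs_ballP[e /= e0 eF]; have e2 : 0 < e / 2 by rewrite divr_gt0.
apply: (@lt_le_trans _ _ (integral_Rn (fun y => if box x0 (e / 2) y then c%:E else 0%E))).
  by rewrite integral_Rn_box ?ltW // lte_fin mulr_gt0 // exprn_gt0 // mulr_gt0.
apply: le_integral_Rn => y; case: ifP => // b; first by rewrite lee_fin ltW.
apply: eF; rewrite -ball_normE /ball_ /=.
by apply: le_lt_trans (box_norm (ltW e2) b) _; lra.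
Qed.

(** Some [rho i] is positive at the identity, so the support condition puts the identity in the i-th
    chart. By continuity the i-th integrand has a positive lower bound near the corresponding
    point. *)
Lemma riemannian_volume_neq0 (v : R) : is_riemannian_volume N v -> v != 0.
Proof.
move=> [m [U [phi [rho [lp rc rs r1 vE]]]]].
set F := fun i x => if x \in U i then (rho i (phi i x) * volume_density (phi i) x)%:E else 0%E.
have SOp i x : U i x -> SO (phi i x) by have [_ _ + _ _] := lp i; apply.
have F0 i x : (0 <= F i x)%E.
  rewrite /F; case: ifPn => //; rewrite inE => Ux; rewrite lee_fin mulr_ge0 //.
    exact: (rc i).2 (SOp i x Ux).
  by rewrite ltW // (volume_density_gt0 (lp i)).
have I0 i : (0 <= integral_Rn (F i))%E by exact: integral_Rn_ge0.
have [i ri] : exists i, 0 < rho i 1%:M.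
  apply: contrapT => /forallNP h; have := r1 _ (@SO1 R N).
  rewrite big1 => [/esym/eqP|i _]; first by rewrite oner_eq0.
  by apply/eqP; rewrite eq_le leNgt; apply/andP; split; [apply/negP; exact: h|exact: (rc i).2 (@SO1 R N)].
have [K [_ KU Kr]] := rs i.
have [x Kx px] : (phi i @` K) 1%:M.
  by apply: contrapT => /(Kr _ (@SO1 R N)) e; rewrite e ltxx in ri.
have Ux := KU x Kx; have [oU sm _ _ _] := lp i.
have vx := volume_density_gt0 (lp i) Ux.
have Ipos : (0 < integral_Rn (F i))%E.
  apply: (@integral_Rn_gt0 _ _ x (rho i 1%:M / 2 * (volume_density (phi i) x / 2))) => //.
    by rewrite mulr_gt0 ?divr_gt0.
  have n1 : \forall y \near x, U i y by exact: open_nbhs_nbhs.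
  have cphi : phi i y @[y --> x] --> (1%:M : 'M[R]_N).
    by rewrite -px; exact: (sm 0%N).1.
  have crho : rho i (phi i y) @[y --> x] --> rho i 1%:M.
    apply: (within_SO_cvg (rc i).1 (@SO1 R N) cphi).
    by apply: filterS n1 => y; exact: SOp.
  have n2 : \forall y \near x, rho i 1%:M / 2 < rho i (phi i y).
    by apply: cvgr_gt _ crho _ _; lra.
  have n3 : \forall y \near x, volume_density (phi i) x / 2 < volume_density (phi i) y.
    by apply: cvgr_gt _ (volume_density_cvg (lp i) Ux) _ _; lra.
  apply: filterS3 n1 n2 n3 => y Uy h2 h3.
  have yU : (y \in U i) = true by apply/mem_set.
  rewrite /F yU lee_fin; apply: ler_pM (ltW h2) (ltW h3).
    exact: divr_ge0 (ltW ri) (ler0n _ 2).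
  exact: divr_ge0 (ltW vx) (ler0n _ 2).
have : (0 < v%:E)%E.
  rewrite vE (bigD1 i) //=; apply: lt_le_trans Ipos _.
  rewrite leeDl //; apply: sume_ge0 => j _; exact: I0.
by rewrite lte_fin => /gt_eqF ->.
Qed.

(** Supplies the radius of the bump functions: their translated supports must stay where Cayley
    coordinates exist and lie in the compact cube [-1, 1]^d. *)
Lemma cayley_ball : exists2 r : R, 0 < r & forall k : 'M[R]_N, `|k - 1%:M| < r ->
  1%:M + k \in unitmx /\ forall i, `|coords (icay k) 0 i| <= 1.
Proof.
have S1 := @SO1 R N; pose I1 : 'M[R]_N := 1%:M.
have [F [FF FE]] : exists F : set_system 'M[R]_N, Filter F /\ F = nbhs I1.
  by exists (nbhs I1); split=> //; exact: nbhs_filter.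
have Fid : y @[y --> F] --> I1 by rewrite FE; exact: cvg_id.
have u : 1%:M + I1^T *m I1 *m I1^T \in unitmx.
  rewrite trmx1 !mulmx1; have := @add1_cay_unit R N 0.
  by rewrite cay0 trmx0 oppr0; apply.
have c0 : chart_inv I1 I1 I1 = 0.
  have := chartK 0 S1 S1; rewrite /chart linear0 cay0 !mulmx1; exact.
have ci : chart_inv I1 I1 y @[y --> F] --> (0 : 'rV[R]_d).
  by rewrite -c0; exact: chart_inv_cvg.
have n1 : \forall y \near F, `|chart_inv I1 I1 y| < 1.
  exact: cvgr0_norm_lt ci _ ltr01.
have dc : \det (1%:M + I1^T *m y *m I1^T) @[y --> F] --> \det (1%:M + I1^T *m I1 *m I1^T).
  by apply: cvg_det; exact: cvg_add1.
have n2 : \forall y \near F, \det (1%:M + I1^T *m y *m I1^T) != 0.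
  by apply: cvgr_neq0 dc _; rewrite -unitfE -unitmxE.
have : \forall y \near F, 1%:M + y \in unitmx /\ forall i, `|coords (icay y) 0 i| <= 1.
  apply: filterS2 n1 n2 => y; rewrite /chart_inv trmx1 mul1mx mulmx1 => y1 y2.
  split=> [|i]; first by rewrite unitmxE unitfE.
  apply: le_trans (ltW y1); rewrite [leRHS]/Num.Def.normr/= mx_normrE.
  exact: (le_bigmax _ _ (0, i)).
rewrite FE => /nbhs_ballP[r /= r0 rP]; exists r => // k kr; apply: rP.
by rewrite -ball_normE /ball_ /= distrC.
Qed.

Lemma riemannian_volume_exists : exists v : R, is_riemannian_volume N v.
Proof.
have S1 := @SO1 R N; have [r r0 rP] := cayley_ball.
pose w (g0 y : 'M[R]_N) := r - `|g0^T *m y - 1%:M|.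
have cw (T : Type) (F : set_system T) (FF : Filter F) (f : T -> 'M[R]_N) g0 y :
    f z @[z --> F] --> y -> w g0 (f z) @[z --> F] --> w g0 y.
  move=> fy; apply: cvgB; first exact: cvg_cst.
  apply: cvg_norm; apply: cvgB; last exact: cvg_cst.
  by apply: cvg_mulmx => //; exact: cvg_cst.
have wg g0 : SO g0 -> w g0 g0 = r by move=> [e _]; rewrite /w e subrr normr0 subr0.
have [D' D'S cov] : finite_subset_cover (@SO R N) (fun g0 => [set y | 0 < w g0 y]) (@SO R N).
  have := @SO_compact R N; rewrite compact_cover; apply=> [g0 _|y yS]; last first.
    by exists y => //=; rewrite wg.
  rewrite openE => y /= wy; rewrite /interior.
  have c : w g0 z @[z --> nbhs y] --> w g0 y := @cw _ (nbhs y) (nbhs_filter y) id g0 y cvg_id.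
  have h : \forall z \near y, 0 < w g0 z := cvgr_gt _ c _ wy.
  exact: h.
pose s := finmap.enum_fset D'; pose m := size s; pose g (i : 'I_m) := nth 1%:M s i.
have gS i : SO (g i) by have := D'S (g i) (mem_nth _ (ltn_ord i)); rewrite inE.
have gcov y : SO y -> exists i, 0 < w (g i) y.
  move=> /cov[g0 /= g0D wy].
  have ig : (index g0 s < m)%N by rewrite index_mem.
  by exists (Ordinal ig); rewrite /g /= nth_index.
(* This is 2 max(w, 0), a continuous bump that vanishes outside the ball of radius [r]; dividing by
   the sum [S] gives the partition of unity. *)
pose u i y := w (g i) y + `|w (g i) y|.
have u0 i y : 0 <= u i y by rewrite /u; have := ler_norm (- w (g i) y); rewrite normrN; lra.
pose S y := \sum_i u i y.
have Spos y : SO y -> 0 < S y.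
  move=> /gcov[i wi]; rewrite /S (bigD1 i) //= ltr_pwDl ?sumr_ge0 //.
  by rewrite /u gtr0_norm // addr_gt0.
pose rho i y := u i y / S y.
have rho0 i y : SO y -> 0 <= rho i y by move=> /Spos /ltW ?; exact: divr_ge0.
have rho1 i y : SO y -> rho i y <= 1.
  move=> yS; rewrite /rho ler_pdivrMr ?Spos // mul1r /S (bigD1 i) //= lerDl.
  by apply: sumr_ge0.
pose K := [set x : 'rV[R]_d | forall k, x ord0 k \in `[(-1), 1]].
have cK : compact K.
  apply: (@rV_compact R d (fun=> `[(-1 : R), 1]%classic)) => _; exact: segment_compact.
have rhoK i y : SO y -> ~ (chart (g i) 1%:M @` K) y -> rho i y = 0.
  move=> yS nK; rewrite /rho; suff -> : u i y = 0 by rewrite mul0r.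
  rewrite /u; have [w0|w0] := lerP (w (g i) y) 0; first by rewrite ler0_norm // subrr.
  exfalso; apply: nK.
  have [un ck] : 1%:M + (g i)^T *m y \in unitmx /\
      forall k, `|coords (icay ((g i)^T *m y)) 0 k| <= 1.
    by apply: rP; rewrite /w subr_gt0 in w0.
  exists (chart_inv (g i) 1%:M y).
    by move=> k; rewrite /chart_inv trmx1 mulmx1 in_itv /= -ler_norml.
  by rewrite chart_invK // trmx1 mulmx1.
pose phi i := chart (g i) 1%:M.
have lp i : local_parametrization setT (phi i) by exact: chart_local_parametrization.
pose F i x := if x \in setT then (rho i (phi i x) * volume_density (phi i) x)%:E else 0%E.
have SOp i x : SO (phi i x) by exact: chart_SO.
have vd0 i x : 0 < volume_density (phi i) x by exact: volume_density_gt0 (lp i) _.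
have F0 i x : (0 <= F i x)%E.
  by rewrite /F in_setT lee_fin; apply: mulr_ge0 (ltW (vd0 i x)); exact: rho0.
have Ffin i : (integral_Rn (F i) \is a fin_num)%E.
  have cv : {within K, continuous (volume_density (phi i))}.
    by apply: continuous_subspaceT => x; exact: volume_density_cvg (lp i) _.
  have K0 : K !=set0 by exists 0 => k; rewrite mxE in_itv /= oppr_le0 ler01.
  have [c _ cmax] := compact_EVT_max K0 cK cv.
  set B := volume_density (phi i) c in cmax.
  rewrite ge0_fin_numE; last exact: integral_Rn_ge0.
  (* Off the cube [K] the function [rho i] vanishes; on it [rho i] is at most 1 and the density at
     most its maximum [B]. *)
  apply: (@le_lt_trans _ _ (integral_Rn (fun y => if box (0 : 'rV[R]_d) 1 y then B%:E else 0%E))).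
    apply: le_integral_Rn => // x; rewrite /F in_setT; case: ifPn => b.
      rewrite lee_fin -[leRHS]mul1r.
      apply: ler_pM (rho1 i _ (SOp i x)) _; [exact: rho0|exact: ltW (vd0 i x)|].
      apply: cmax; apply/mem_set => k; rewrite in_itv /= -ler_norml.
      by have /forallP/(_ k) := b; rewrite mxE subr0.
    rewrite rhoK ?mul0r // => -[z zK]; rewrite /phi => e.
    move: b; rewrite -(chartK x (gS i) S1) -e chartK // => /negP; apply.
    by apply/forallP => k; have := zK k; rewrite mxE subr0 in_itv /= -ler_norml.
  by rewrite integral_Rn_box ?ltry //; exact: ltW (vd0 i c).
exists (\sum_i fine (integral_Rn (F i))).
exists m, (fun=> setT), phi, rho; split=> //.
- move=> i; split; last by move=> y; exact: rho0.
  apply/subspace_continuousP => y yS.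
  have cu j : u j z @[z --> within (@SO R N) (nbhs y)] --> u j y.
    have c : w (g j) z @[z --> within (@SO R N) (nbhs y)] --> w (g j) y.
      by apply: cw; exact: cvg_within.
    have cn : `|w (g j) z| @[z --> within (@SO R N) (nbhs y)] --> `|w (g j) y|.
      by apply: cvg_norm; exact: c.
    have cc : w (g j) z + `|w (g j) z| @[z --> within (@SO R N) (nbhs y)] -->
      w (g j) y + `|w (g j) y| by apply: cvgD.
    exact: cc.
  have cS : S z @[z --> within (@SO R N) (nbhs y)] --> S y by apply: cvg_sum.
  have h : u i z / S z @[z --> within (@SO R N) (nbhs y)] --> u i y / S y.
    by apply: cvgM (cu i) _; apply: cvgV cS; rewrite gt_eqF // Spos.
  exact: h.
- move=> i; exists K; split=> //.
  by move=> y yS; exact: rhoK.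
- by move=> y yS; rewrite -mulr_suml mulfV // gt_eqF // Spos.
rewrite -sumEFin; apply: eq_bigr => i _; exact: fineK.
Qed.

(** [xget] would return the default 0 if no admissible value existed, so existence has to be shown;
    whichever value is chosen is nonzero. *)
Lemma Vol_neq0 : Vol N != 0 :> R.
Proof.
apply: riemannian_volume_neq0; rewrite /Vol.
by have [v vP] := riemannian_volume_exists; exact: (@xgetPex _ 0 _ (ex_intro _ v vP)).
Qed.

End Volume.

Lemma weyl_constant_neq0 (R : realType) N : (10 <= N)%N -> weyl_constant R N != 0.
Proof.
(* This makes d/2 > 1, the range of [Gamma_gt0]. *)
move=> hN; have d3 : (3 <= dimSO N)%N.
  by rewrite /dimSO leq_divRL //; nia.
have d3' : 3 <= (dimSO N)%:R :> R by rewrite ler_nat.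
rewrite /weyl_constant mulf_neq0 //.
  by rewrite mulf_neq0 ?pnatr_eq0 // Vol_neq0.
rewrite invr_eq0 !mulf_neq0 //.
- by rewrite gt_eqF //; lra.
- by rewrite gt_eqF // powR_gt0 // mulr_gt0 // pi_gt0.
- by rewrite gt_eqF // Gamma_gt0 //; lra.
Qed.

Unset Implicit Arguments.
Set Strict Implicit.
Set Printing Implicit Defensive.

Theorem mainTheorem2 (R : realType) (N : nat) (hN : (10 <= N)%N) :
  ~ (forall eps : R, 0 < eps -> \forall lambda \near (pinfty_nbhs R),
       `|eigenvalue_count N lambda
           - weyl_constant R N * lambda `^ ((dimSO N)%:R / 2)|
       <= eps * `|lambda `^ ((dimSO N)%:R / 2 - 1)|).
Proof.
apply: gapped_count_remainder (weyl_constant_neq0 R hN) (@eigenvalue_count_gap R N).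
have d2 : (2 <= dimSO N)%N by rewrite /dimSO leq_divRL //; nia.
by rewrite ler_pdivlMr // mul1r ler_nat.
Qed.
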